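(* Let $\mathcal G$ be a compact metric graph, $N\ge1$ an integer, and let $p\in\left(2,\frac{2(N+1)}{N-1}\right)$ ($p\in(2,+\infty)$ if $N=1$). Set $$\theta(p):=\frac{(N+1)(p-2)}2,\qquad\delta(p):=\max\Big\{0,\,1-\frac{\theta(p)}2\Big\},$$ and, for $u\in H^1(\mathbb R^N\times\mathcal G)$, $S(u):=\sup_{n\in\mathbb N}\|u\|_{L^2(Q_n\times\mathcal G)}$. Then there exists $C=C(N,p,\mathcal G)>0$ such that $$\|u\|_{L^p(\mathbb R^N\times\mathcal G)}^p\le C\,\|u\|_{H^1(\mathbb R^N\times\mathcal G)}^{\theta(p)}\,\|u\|_{L^2(\mathbb R^N\times\mathcal G)}^{2\delta(p)}\,S(u)^{p-\theta(p)-2\delta(p)}\qquad\forall u\in H^1(\mathbb R^N\times\mathcal G).$$ In particular, this reads $\|u\|_p^p\le C\|u\|_{H^1}^{\theta(p)}S(u)^{p-\theta(p)}$ if $p\ge2+\frac4{N+1}$, and $\|u\|_p^p\le C\|u\|_{H^1}^{\theta(p)}\|u\|_2^{2-\theta(p)}S(u)^{p-2}$ if $p<2+\frac4{N+1}$.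
   Context: A compact metric graph $\mathcal G$ is a connected graph with finitely many edges (edge set $\mathfrak E$) and vertices, each edge $e$ being identified with an interval $[0,\ell_e]$, $0<\ell_e<\infty$, whose endpoints are glued at vertices (self-loops and multiple edges allowed). All functions are real-valued. $H^1(\mathbb R^N\times\mathcal G)$ is the set of $u=\{u_e\}_{e\in\mathfrak E}$ with $u_e\in H^1(\mathbb R^N\times e)$ for every $e$, and equal traces (in $L^2(\mathbb R^N)$) on $\mathbb R^N\times\{v\}$ from any two edges meeting at the vertex $v$; $\|u\|_{H^1(\mathbb R^N\times\mathcal G)}^2=\sum_e\|u_e\|_{H^1(\mathbb R^N\times e)}^2$ and $\|u\|_{L^p(\mathbb R^N\times\mathcal G)}^p=\sum_e\|u_e\|_{L^p(\mathbb R^N\times e)}^p$. $\{Q_n\}_{n\in\mathbb N}$ is the family of open unit cubes of $\mathbb R^N$ (sides parallel to the axes) centred at the points of $\mathbb Z^N$. The convention $s^0=1$ is used. *)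

(* Defs.v *)
From HB Require Import structures.
From mathcomp Require Import all_boot all_order all_algebra.
From mathcomp Require Import all_classical all_reals all_analysis.

Set Implicit Arguments.
Unset Strict Implicit.
Unset Printing Implicit Defensive.

Import Order.TTheory GRing.Theory Num.Theory.
Import numFieldTopology.Exports numFieldNormedType.Exports.

Local Open Scope classical_set_scope.
Local Open Scope ring_scope.

(* R^n is 'rV[R]_n, with the sigma-algebra generated by the coordinates and
   the n-fold product of the Lebesgue measure of R. *)

Section measurable_rV.
Context {R : realType} (n : nat).

Let coords (i : 'I_n) (x : 'rV[R]_n) : R := x 0 i.

Let rV_set0 : g_sigma_preimage coords set0.
Proof. exact: sigma_algebra0. Qed.

Let rV_setC A : g_sigma_preimage coords A -> g_sigma_preimage coords (~` A).
Proof. exact: sigma_algebraC. Qed.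

Let rV_bigcup (F : _^nat) : (forall i, g_sigma_preimage coords (F i)) ->
  g_sigma_preimage coords (\bigcup_i (F i)).
Proof. exact: sigma_algebra_bigcup. Qed.

HB.instance Definition _ := @isMeasurable.Build default_measure_display
  'rV[R]_n (g_sigma_preimage coords) rV_set0 rV_setC rV_bigcup.

End measurable_rV.

Section measurability_rV.
Context {R : realType}.

Lemma measurable_coord n (i : 'I_n) :
  measurable_fun [set: 'rV[R]_n] (fun x : 'rV[R]_n => x 0 i).
Proof.
move=> _ Y mY; rewrite setTI; apply: sub_sigma_algebra.
case: n i => [[]//|n] i.
rewrite -bigcup_mkord_ord; exists i => //=.
by exists Y => //; rewrite setTI; apply/seteqP; split => x /=;
  rewrite inord_val.
Qed.

Lemma measurable_rVP d (T : measurableType d) n (f : T -> 'rV[R]_n) :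
  (forall i, measurable_fun setT (fun t => f t 0 i)) -> measurable_fun setT f.
Proof.
move=> mf; apply: (@measurability _ _ _ _ _ _
    (\big[setU/set0]_(i < n) preimage_set_system setT
      (fun x : 'rV[R]_n => x 0 i) measurable)) => //.
case: n f mf => [|n] f mf; first by rewrite big_ord0 preimage_set_system0.
move=> A [B]; rewrite -bigcup_mkord_ord => -[i Ii [C mC <-]] <-.
by rewrite setTI; exact: (mf (inord i) measurableT C mC).
Qed.

Definition rV_cons n (p : measurableTypeR R * 'rV[R]_n) : 'rV[R]_n.+1 :=
  row_mx (p.1 : R)%:M p.2.

Definition rV_uncons n (x : 'rV[R]_n.+1) : measurableTypeR R * 'rV[R]_n :=
  (x 0 0, \row_i x 0 (lift 0 i)).

Lemma rV_cons0 n (p : measurableTypeR R * 'rV[R]_n) : rV_cons p 0 0 = p.1.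
Proof.
rewrite /rV_cons (_ : 0 = lshift n (0 : 'I_1) :> 'I_(1 + n)); last exact: val_inj.
by rewrite (@row_mxEl _ 1 1 n) mxE eqxx mulr1n.
Qed.

Lemma rV_consS n (p : measurableTypeR R * 'rV[R]_n) (i : 'I_n) :
  rV_cons p 0 (lift 0 i) = p.2 0 i.
Proof.
rewrite /rV_cons (_ : lift 0 i = rshift 1 i); last exact: val_inj.
exact: (@row_mxEr _ 1 1 n).
Qed.

Lemma rV_consK n : cancel (@rV_cons n) (@rV_uncons n).
Proof.
move=> p; rewrite /rV_uncons rV_cons0 [RHS]surjective_pairing; congr pair.
by apply/rowP => i; rewrite mxE rV_consS.
Qed.

Lemma measurable_rV_cons n : measurable_fun setT (@rV_cons n).
Proof.
apply: measurable_rVP => i; case: (unliftP 0 i) => [j|] ->.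
- under eq_fun do rewrite rV_consS.
  exact: (measurableT_comp (measurable_coord j) measurable_snd).
- under eq_fun do rewrite rV_cons0.
  exact: measurable_fst.
Qed.

Lemma measurable_rV_uncons n : measurable_fun setT (@rV_uncons n).
Proof.
apply: measurable_fun_pair; first exact: measurable_coord.
apply: measurable_rVP => i; under eq_fun do rewrite mxE.
exact: measurable_coord.
Qed.

End measurability_rV.

Lemma product_sigma_finite d1 d2 (T1 : measurableType d1)
    (T2 : measurableType d2) (R : realType)
    (m1 : {sigma_finite_measure set T1 -> \bar R})
    (m2 : {sigma_finite_measure set T2 -> \bar R}) :
  sigma_finite setT (m1 \x m2)%E.
Proof.
have /sigma_finiteP[F [TF ndF Foo]] := sigma_finiteT m1.
have /sigma_finiteP[G [TG ndG Goo]] := sigma_finiteT m2.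
exists (fun n => F n `*` G n).
  rewrite -setXTT TF TG predeqE => -[x y]; split.
    move=> [/= [n _ Fnx] [k _ Gky]]; exists (maxn n k) => //; split.
    - by move: x Fnx; exact/subsetPset/ndF/leq_maxl.
    - by move: y Gky; exact/subsetPset/ndG/leq_maxr.
  by move=> [n _ []/= ? ?]; split; exists n.
move=> k; have [? ?] := Foo k; have [? ?] := Goo k.
split; first exact: measurableX.
by rewrite product_measure1E// lte_mul_pinfty// ge0_fin_numE.
Qed.

Section lebesgue_rV.
Context {R : realType}.

Definition lebesgue_rV_step n (m : {sigma_finite_measure set 'rV[R]_n -> \bar R}) :
    set 'rV[R]_n.+1 -> \bar R :=
  pushforward (lebesgue_measure \x m)%E (@rV_cons R n).

Section step.
Variables (n : nat) (m : {sigma_finite_measure set 'rV[R]_n -> \bar R}).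
Local Open Scope ereal_scope.

Let prod_m : {measure set (measurableTypeR R * 'rV[R]_n) -> \bar R} :=
  lebesgue_measure \x m.

Let step0 : lebesgue_rV_step m set0 = 0.
Proof. by rewrite /lebesgue_rV_step /pushforward preimage_set0 measure0. Qed.

Let step_ge0 A : 0 <= lebesgue_rV_step m A.
Proof. exact: (measure_ge0 prod_m). Qed.

Let step_sigma_additive : semi_sigma_additive (lebesgue_rV_step m).
Proof.
have mX X : measurable X -> measurable (@rV_cons R n @^-1` X).
  by move=> mX; rewrite -[_ @^-1` _]setTI; exact: measurable_rV_cons.
move=> F mF tF mUF; rewrite /lebesgue_rV_step /pushforward preimage_bigcup.
apply: (@measure_semi_sigma_additive _ _ _ prod_m).
- by move=> k; exact: mX.
- apply/trivIsetP => /= i j _ _ ij; rewrite -preimage_setI.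
  by move/trivIsetP : tF => /(_ _ _ _ _ ij) ->//; rewrite preimage_set0.
- by rewrite -preimage_bigcup; exact: mX.
Qed.

HB.instance Definition _ := isMeasure.Build _ _ _
  (lebesgue_rV_step m) step0 step_ge0 step_sigma_additive.

Let step_sigma_finite : sigma_finite setT (lebesgue_rV_step m).
Proof.
have [F TF Foo] := product_sigma_finite lebesgue_measure m.
exists (fun k => @rV_uncons R n @^-1` F k).
  by rewrite -preimage_bigcup -TF preimage_setT.
move=> k; have [mFk Fkoo] := Foo k; split.
  by rewrite -[_ @^-1` _]setTI; exact: measurable_rV_uncons.
rewrite /lebesgue_rV_step /pushforward -comp_preimage.
by rewrite (_ : _ \o _ = id)//; apply/funext => p /=; rewrite rV_consK.
Qed.

HB.instance Definition _ := Measure_isSigmaFinite.Build _ _ _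
  (lebesgue_rV_step m) step_sigma_finite.

End step.

Fixpoint lebesgue_rV n : {sigma_finite_measure set 'rV[R]_n -> \bar R} :=
  if n is n'.+1 then
    [the {sigma_finite_measure set _ -> \bar R} of
      lebesgue_rV_step (lebesgue_rV n')]
  else [the {sigma_finite_measure set _ -> \bar R} of dirac (0 : 'rV[R]_0)].

Lemma lebesgue_rV_box n (A : 'I_n -> set (measurableTypeR R)) :
  (forall i, measurable (A i)) ->
  lebesgue_rV n [set x | forall i, A i (x 0 i)] =
  (\prod_(i < n) lebesgue_measure (A i))%E.
Proof.
elim: n A => [|n IHn] A mA.
  by rewrite big_ord0 /= diracE mem_set// => -[].
have mB : measurable [set x : 'rV[R]_n | forall i, A (lift 0 i) (x 0 i)].
  rewrite [X in measurable X](_ : _ = \bigcap_(i in [set: 'I_n])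
    ((fun x : 'rV[R]_n => x 0 i) @^-1` A (lift 0 i))); last first.
    by apply/seteqP; split => x /= h i => [_|]; exact: h.
  apply: fin_bigcap_measurable => [|i _]; first exact: finite_finset.
  rewrite -[_ @^-1` _]setTI.
  exact: (@measurable_coord R n i measurableT _ (mA (lift 0 i))).
rewrite big_ord_recl -IHn; last by move=> i; exact: mA.
rewrite -product_measure1E//=.
rewrite /lebesgue_rV_step /pushforward.
congr (_ _); apply/seteqP; split => -[a x] /=.
- move=> h; split => [|i] /=.
    by have := h 0; rewrite rV_cons0.
  by have := h (lift 0 i); rewrite rV_consS.
- move=> [/= ha hx] i; case: (unliftP 0 i) => [j|] ->.
    by rewrite rV_consS.
  by rewrite rV_cons0.
Qed.

End lebesgue_rV.

(* Lebesgue measure on R^N * R, for the measurable structure of R itself rather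
   than that of its alias measurableTypeR R. *)
Section lebesgue_strip.
Context {R : realType} (N : nat).
Local Notation mu := (lebesgue_rV N \x @lebesgue_measure R)%E.

Definition lebesgue_strip : set ('rV[R]_N * R) -> \bar R := mu.

HB.instance Definition _ := isMeasure.Build _ ('rV[R]_N * R)%type R
  lebesgue_strip (measure0 mu) (measure_ge0 mu)
  (@measure_semi_sigma_additive _ _ _ mu).

HB.instance Definition _ := Measure_isSigmaFinite.Build _ ('rV[R]_N * R)%type R
  lebesgue_strip (product_sigma_finite (lebesgue_rV N) (@lebesgue_measure R)).

End lebesgue_strip.
Arguments lebesgue_strip {R} N.

Section test_functions.
Context {R : realType} {V : normedModType R}.

Fixpoint Ck k (f : V -> R) : Prop :=
  if k is k'.+1 then
    (forall x, differentiable f x) /\ (forall v, Ck k' ('D_v f))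
  else continuous f.

Definition support (f : V -> R) : set V := closure [set x | f x != 0].

(* C_c^oo(D), for D open *)
Definition test_function (D : set V) (f : V -> R) : Prop :=
  [/\ forall k, Ck k f, compact (support f) & support f `<=` D].

End test_functions.

Section Lebesgue_spaces.
Context d (T : measurableType d) {R : realType}.
Variable mu : {measure set T -> \bar R}.

(* f \_ D vanishes outside D, the default point of R being 0. *)
Definition LnormD (D : set T) (q : R) (f : T -> R) : \bar R :=
  'N[mu]_q%:E [EFin \o (f \_ D)].

Definition L2 (D : set T) (f : T -> R) : Prop :=
  measurable_fun D f /\ (LnormD D 2 f < +oo)%E.

End Lebesgue_spaces.

Section Sobolev.
Context {R : realType} {N : nat}.
Local Notation X := ('rV[R]_N * R)%type.
Implicit Types (D : set X) (u g : X -> R) (j : option 'I_N).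

(* Canonical basis of R^N * R: Some i is the i-th direction of R^N and None the
   direction along the edge. *)
Definition direction j : X :=
  if j is Some i then (delta_mx 0 i, 0) else (0, 1).

Definition is_weak_derivative D j u g : Prop :=
  forall phi : X -> R, test_function D phi ->
    \int[lebesgue_strip N]_(z in D) (u z * 'D_(direction j) phi z) =
    - \int[lebesgue_strip N]_(z in D) (g z * phi z).

Definition L2_weak_derivatives D j u : set (X -> R) :=
  [set g | L2 (lebesgue_strip N) D g /\ is_weak_derivative D j u g].

Definition H1 D u : Prop :=
  L2 (lebesgue_strip N) D u /\ forall j, L2_weak_derivatives D j u !=set0.

(* A representative of the weak derivative, which is unique up to a.e. equality;
   junk if there is none in L^2. *)
Definition weak_derivative D j u : X -> R := get (L2_weak_derivatives D j u).

Definition H1norm D u : \bar R :=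
  ((LnormD (lebesgue_strip N) D 2 u `^ 2 +
    \sum_(j : option 'I_N)
      LnormD (lebesgue_strip N) D 2 (weak_derivative D j u) `^ 2) `^ 2^-1)%E.

(* A x e, where the edge e of length l is identified with ]0, l[ up to its
   endpoints. *)
Definition strip (A : set 'rV[R]_N) (l : R) : set X := A `*` `]0, l[%classic.

Definition end_coord (l : R) (s : bool) : R := if s then l else 0.

(* g is the trace of u on R^N * {end_coord l s}: the trace operator is the
   continuous extension, from H^1(R^N * ]0, l[) to L^2(R^N), of the restriction
   w |-> w(., end_coord l s), defined on the smooth functions on the closed
   strip with compact support. *)
Definition is_trace (l : R) (s : bool) u (g : 'rV[R]_N -> R) : Prop :=
  L2 (lebesgue_rV N) setT g /\
  exists w : nat -> X -> R,
    [/\ forall k, test_function setT (w k),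
        (H1norm (strip setT l) (u \- w k))%R @[k --> \oo] --> 0%E &
        (LnormD (lebesgue_rV N) setT 2
           (fun x => g x - w k (x, end_coord l s))) @[k --> \oo] --> 0%E].

End Sobolev.

(* Edges are oriented: endpoint e false and endpoint e true are the vertices at
   coordinates 0 and len e. Loops and multiple edges are allowed. *)
Record metric_graph (R : realType) := MetricGraph {
  vertex : finType;
  edge : finType;
  endpoint : edge -> bool -> vertex;
  len : edge -> R;
  len_gt0 : forall e, 0 < len e;
  graph_connected : forall v w, connect
    (fun a b => [exists e, [exists s,
       (endpoint e s == a) && (endpoint e (~~ s) == b)]]) v w
}.
Arguments endpoint {R} _ _ _.
Arguments len {R} _ _.

Section graph_functions.
Context {R : realType} {G : metric_graph R} {N : nat}.
Implicit Types u : edge G -> 'rV[R]_N * R -> R.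

Definition H1_graph u : Prop :=
  (forall e, H1 (strip setT (len G e)) (u e)) /\
  (forall v, exists g : 'rV[R]_N -> R, forall e s,
     endpoint G e s = v -> is_trace (len G e) s (u e) g).

Definition H1norm_graph u : \bar R :=
  ((\sum_(e : edge G) H1norm (strip setT (len G e)) (u e) `^ 2) `^ 2^-1)%E.

(* the L^q norm on A x G *)
Definition Lnorm_graph (A : set 'rV[R]_N) (q : R) u : \bar R :=
  ((\sum_(e : edge G)
      LnormD (lebesgue_strip N) (strip A (len G e)) q (u e) `^ q) `^ q^-1)%E.

Definition cube (c : 'rV[int]_N) : set 'rV[R]_N :=
  [set x | forall i, `|x 0 i - (c 0 i)%:~R| < 2^-1].

Definition sup_cubes u : \bar R :=
  ereal_sup [set Lnorm_graph (cube c) 2 u | c in [set: 'rV[int]_N]].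

End graph_functions.

Section exponents.
Context {R : realType}.

Definition theta (N : nat) (p : R) : R := N.+1%:R * (p - 2) / 2.

Definition delta (N : nat) (p : R) : R := Num.max 0 (1 - theta N p / 2).

End exponents.

(* Main.v *)
Require Import Defs.
From HB Require Import structures.
From mathcomp Require Import all_boot all_order all_algebra.
From mathcomp Require Import all_classical all_reals all_analysis.
From mathcomp Require Import measurable_realfun.
From mathcomp Require Import ring lra.

(* The compatibility conditions at the vertices play no role: one argues edge by
   edge, on the strip R^N x ]0, l[ of dimension d = N + 1. A half-open box is cut in
   two along its sides, taken cyclically, and E_m u denotes the average of u on the
   cells obtained after m cuts. Testing the weak derivative in direction j against a
   (smoothed) tent function supported in a cell shows that the averages of u on the
   two halves of the cell differ by at most (side / 2 vol) * int |d_j u|. Hence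
   f_m = E_(m+1) u - E_m u satisfies
     |f_m|_2 <= D_m := min (C rho^m A, B),   |f_m|_oo <= C 2^(m/2) D_m,
   where A and B are the H^1 and L^2 norms of u on the box and rho^d = 1/2, and
   interpolation gives |f_m|_p <= C rho^(- s m) D_m with s = theta / p < 1. The sum
   over m converges and is at most C A^s B^(1 - s).
   The E_m u converge almost everywhere, the f_m being summable in L^1; since E_m is
   self-adjoint, the limit has the same integral as u on the orthants, so it is u. By
   Fatou's lemma, |u|_p^p <= C A^theta B^(p - theta) on every unit cube times an edge,
   and summing over the cubes yields the theorem. *)

Set Implicit Arguments.
Unset Strict Implicit.
Unset Printing Implicit Defensive.

Import Order.TTheory GRing.Theory Num.Theory.
Import numFieldTopology.Exports numFieldNormedType.Exports.

Local Open Scope classical_set_scope.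
Local Open Scope ring_scope.

(** * Smooth functions of one variable *)

(** Membership in H^1 is given only through test functions, and [u] is never approximated by smooth
    functions: its gradient is read off from differences of averages. This is why each cut is made
    in one direction only. A cut isolates one partial derivative and doubles the number of cells, so
    the gain [rho] in L^2 and the loss [2^(1/2)] in sup norm per cut can be compared. Since
    [2 = rho^(-d)], interpolation turns the loss into [rho^(-s)], and the upper bound on [p] amounts
    to [s < 1], that is, the gain wins. The two entries of [D_m] exchange roles when [rho^m] is
    about [B / A]; at that scale the terms of both geometric series have size [A^s B^(1 - s)], which
    is where this product comes from. The local bound has total degree [p > 2], whereas only squares
    of norms add up over the cubes. The excess is paid by global quantities: a power of S(u),
    together with a power of the global H^1 norm when theta > 2. When theta < 2, Young's inequality
    shares the degree 2 between the H^1 and the L^2 norms. *)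

Section smooth_upto.
Context {R : realType}.
Implicit Types (f g : R -> R) (k n : nat).

(** The derivative is carried as a witness, so that sums, products and affine substitutions are
    handled by induction on [k] without evaluating a limit. *)
Fixpoint smooth_upto k f : Prop :=
  if k is k'.+1 then
    exists2 f' : R -> R, (forall x : R, is_derive x (1 : R) f (f' x)) & smooth_upto k' f'
  else continuous f.

Lemma is_derive_continuous f (f' : R -> R) :
  (forall x, is_derive x (1 : R) f (f' x)) -> continuous f.
Proof.
move=> df x; apply: differentiable_continuous.
by apply/derivable1_diffP; exact: (@ex_derive _ _ _ _ _ _ _ (df x)).
Qed.

Lemma smooth_uptoS k f : smooth_upto k.+1 f -> smooth_upto k f.
Proof.
elim: k f => [f [f' /is_derive_continuous]//|k IH f [f' df sf']].
by exists f' => //; exact: IH.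
Qed.

Lemma smooth_upto_continuous k f : smooth_upto k f -> continuous f.
Proof. by elim: k f => // k IH f /smooth_uptoS/IH. Qed.

Lemma smooth_uptoD k f g :
  smooth_upto k f -> smooth_upto k g -> smooth_upto k (f \+ g).
Proof.
elim: k f g => [f g cf cg x|k IH f g [f' df sf] [g' dg sg]].
  by apply: continuousD; [exact: cf|exact: cg].
by exists (f' \+ g'); [move=> x; exact: is_deriveD|exact: IH].
Qed.

Lemma smooth_uptoM k f g :
  smooth_upto k f -> smooth_upto k g -> smooth_upto k (f \* g).
Proof.
elim: k f g => [f g cf cg x|k IH f g].
  by apply: continuousM; [exact: cf|exact: cg].
move=> sf sg; move: (sf) (sg) => [f' df sf'] [g' dg sg'].
exists ((f \* g') \+ (g \* f')); first by move=> x; exact: is_deriveM.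
by apply: smooth_uptoD; apply: IH => //; exact: smooth_uptoS.
Qed.

Lemma smooth_upto_cst k (c : R) : smooth_upto k (cst c).
Proof.
elim: k c => [c|k IH c]; first exact: cst_continuous.
by exists (cst 0) => // x; exact: is_derive_cst.
Qed.

Lemma smooth_uptoZ k (c : R) f : smooth_upto k f -> smooth_upto k (c \*o f).
Proof. by move=> sf; apply: (@smooth_uptoM k (cst c)) => //; exact: smooth_upto_cst. Qed.

Lemma smooth_uptoB k f g :
  smooth_upto k f -> smooth_upto k g -> smooth_upto k (f \- g).
Proof.
move=> sf sg; rewrite (_ : f \- g = f \+ (-1 \*o g)); last first.
  by apply/funext => x /=; rewrite mulN1r.
by apply: smooth_uptoD => //; exact: smooth_uptoZ.
Qed.

Lemma is_derive_affine (a b x : R) f (df : R) :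
  is_derive (a * x + b) (1 : R) f df ->
  is_derive x (1 : R) (fun y => f (a * y + b)) (a * df).
Proof.
move=> h.
have da : is_derive x (1 : R) (fun y : R => a * y + b) a.
  by apply: is_derive_eq; rewrite addr0 scaler1 // scaler0 addr0.
have := @is_derive1_comp R f (fun y => a * y + b) x df a h da.
by rewrite mulrC.
Qed.

Lemma smooth_upto_affine k f (a b : R) :
  smooth_upto k f -> smooth_upto k (fun x => f (a * x + b)).
Proof.
elim: k f => [f cf x|k IH f [f' df sf']].
  apply: (@continuous_comp _ _ _ (fun x => a * x + b) f); last exact: cf.
  apply: continuousD; last exact: cst_continuous.
  by apply: continuousM; [exact: cst_continuous|exact: cvg_id].
exists (a \*o (fun x => f' (a * x + b))).
  by move=> x; exact: is_derive_affine.
exact/smooth_uptoZ/IH.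
Qed.

End smooth_upto.

(** * The function exp(-1/x), extended by zero *)

Section flat.
Context {R : realType}.

(** [flat 0] is the classical smooth function that is not analytic at 0. Dividing by powers of [x]
    gives a family whose derivatives are linear combinations of its own members, so that smoothness
    follows by induction. *)
Definition flat n (x : R) : R := if 0 < x then expR (- x^-1) / x ^+ n else 0.

Lemma flat_ge0 n x : 0 <= flat n x.
Proof.
by rewrite /flat; case: ifP => // x0; rewrite divr_ge0 ?expR_ge0 ?exprn_ge0 ?ltW.
Qed.

Lemma flat_le0 n x : x <= 0 -> flat n x = 0.
Proof. by rewrite /flat leNgt => /negbTE ->. Qed.

Lemma flat0_le1 x : flat 0 x <= 1.
Proof.
rewrite /flat; case: ifP => // x0.
by rewrite expr0 divr1 expR_le1 oppr_le0 invr_ge0 ltW.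
Qed.

(** The exponential of [1/x] dominates the single term of degree [n.+1] of its series, one more than
    the power in the denominator; the spare factor [x] gives continuity at 0. *)
Lemma flat_small n x : `|flat n x| <= (n.+1)`!%:R * `|x|.
Proof.
rewrite ger0_norm ?flat_ge0// /flat; case: ifP => [x0|_]; last by rewrite mulr_ge0.
rewrite (gtr0_norm x0) ler_pdivrMr ?exprn_gt0// expRN -mulrA -exprS.
rewrite invf_ple ?posrE ?expR_gt0 ?mulr_gt0 ?exprn_gt0 ?ltr0n ?fact_gt0//.
have xi : 0 <= x^-1 by rewrite invr_ge0 ltW.
apply: le_trans (expR_ge1Dxn n xi).
by rewrite invfM exprVn mulrC lerDr.
Qed.

Lemma flat_cvg0 n : {for 0, continuous (flat n)}.
Proof.
rewrite /prop_for /continuous_at flat_le0//.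
apply/cvgr0Pnorm_lt => e e0.
near=> x; apply: le_lt_trans (flat_small n x) _.
rewrite mulrC -ltr_pdivlMr ?ltr0n ?fact_gt0//.
near: x; apply: (@nbhs0_lt R R); rewrite divr_gt0 ?ltr0n ?fact_gt0//.
Unshelve. all: by end_near. Qed.

Lemma is_derive_flat n x :
  is_derive x (1 : R) (flat n) (- n%:R * flat n.+1 x + flat n.+2 x).
Proof.
have [x0|x0|->] := ltgtP x 0.
- rewrite !flat_le0 ?(ltW x0)// mulr0 addr0.
  apply: (@near_eq_is_derive R R R (cst 0)).
    near=> y; rewrite /= flat_le0//; apply: ltW; near: y.
    exact: lt_nbhsl.
- apply: (@near_eq_is_derive R R R (fun y => expR (- y^-1) * y^-1 ^+ n)).
    near=> y; rewrite /flat ifT ?exprVn//; near: y.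
    exact: lt_nbhsr.
  have xn0 : x != 0 by rewrite gt_eqF.
  have dV : is_derive x (1:R) (fun y : R => y^-1) (- x ^- 2).
    apply: is_derive_eq (@is_deriveV R id x 1 1 xn0 (is_derive_id _ _)) _.
    by rewrite /GRing.scale /= mulr1.
  have dN : is_derive x (1:R) (fun y : R => - y^-1) (x ^- 2).
    by have := is_deriveN dV; rewrite opprK.
  have dE : is_derive x (1:R) (fun y : R => expR (- y^-1)) (expR (- x^-1) * x ^- 2).
    exact: (@is_derive1_comp R expR (fun y => - y^-1) x _ _ (is_derive_expR _) dN).
  have dX : is_derive x (1 : R) (fun y : R => y^-1 ^+ n)
      (n%:R * x^-1 ^+ n.-1 * - x ^- 2).
    rewrite (_ : (fun _ => _) = (fun y : R => y^-1) ^+ n).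
      exact: (@is_deriveX R R (fun y => y^-1) n x 1 _ dV).
    by apply/funext => y; rewrite fctE.
  have dM : is_derive x (1 : R) (fun y : R => expR (- y^-1) * y^-1 ^+ n)
      (expR (- x^-1) * (n%:R * x^-1 ^+ n.-1 * - x ^- 2) +
       x^-1 ^+ n * (expR (- x^-1) * x ^- 2)).
    exact: (is_deriveM dE dX).
  apply: is_derive_eq dM _; rewrite /flat x0 /= -!exprVn.
  case: n {dX} => [|n] /=.
    by rewrite !mul0r mulr0 oppr0 mul0r !add0r expr0 mul1r.
  rewrite !exprS; ring.
- rewrite !flat_le0// mulr0 addr0.
  (* At 0 the difference quotient of [flat n] is [flat n.+1], which is continuous there. *)
  apply/is_derive1_caratheodory; exists (flat n.+1); split.
  + move=> z; rewrite (@flat_le0 n 0)// !subr0 /flat; case: ifP => z0; last by rewrite mul0r.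
    by rewrite exprS invfM [z^-1 * _]mulrC mulrA mulfVK// gt_eqF.
  + exact: flat_cvg0.
  + by rewrite flat_le0.
Unshelve. all: by end_near. Qed.

Lemma smooth_flat k n : smooth_upto k (flat n).
Proof.
elim: k n => [|k IH] n.
  exact: (is_derive_continuous (is_derive_flat n)).
exists ((- n%:R) \*o flat n.+1 \+ flat n.+2); first exact: is_derive_flat.
by apply: smooth_uptoD => //; exact: smooth_uptoZ.
Qed.

End flat.

(** * Smooth cutoffs and tents on an interval *)

Section cutoff.
Context {R : realType}.
Implicit Types (a b h x : R) (n : nat).

(* Supported in [a + 1/n, b - 1/n], and tending to the indicator of ]a, b[. *)
Definition cutoff n a b x : R :=
  flat 0 (n%:R * (x - a) - 1) * flat 0 (n%:R * (b - x) - 1).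

Lemma cutoff_ge0 n a b x : 0 <= cutoff n a b x.
Proof. by rewrite mulr_ge0 ?flat_ge0. Qed.

Lemma cutoff_le1 n a b x : cutoff n a b x <= 1.
Proof. by rewrite mulr_ile1 ?flat_ge0 ?flat0_le1. Qed.

Lemma cutoff_lo n a b x : n%:R * (x - a) <= 1 -> cutoff n a b x = 0.
Proof. by move=> h; rewrite /cutoff flat_le0 ?mul0r// subr_le0. Qed.

Lemma cutoff_hi n a b x : n%:R * (b - x) <= 1 -> cutoff n a b x = 0.
Proof. by move=> h; rewrite /cutoff [X in _ * X]flat_le0 ?mulr0// subr_le0. Qed.

Lemma smooth_cutoff k n a b : smooth_upto k (cutoff n a b).
Proof.
apply: smooth_uptoM.
  have := @smooth_upto_affine R k (flat 0) n%:R (- n%:R * a - 1) (smooth_flat k 0).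
  by congr smooth_upto; apply/funext => x /=; congr flat; ring.
have := @smooth_upto_affine R k (flat 0) (- n%:R) (n%:R * b - 1) (smooth_flat k 0).
by congr smooth_upto; apply/funext => x /=; congr flat; ring.
Qed.

Lemma flat_cvg1 (y : R) : 0 < y ->
  (fun n => flat 0 (n%:R * y - 1)) @ \oo --> (1 : R).
Proof.
move=> y0.
have iy : (fun n => (n%:R * y - 1)^-1) @ \oo --> (0 : R).
  have pos : \forall n \near \oo, 0 < n%:R * y - 1.
    near=> n; rewrite subr_gt0 -ltr_pdivrMr// div1r; near: n.
    exact: nbhs_infty_gtr.
  apply: (iffRL (@gtr0_cvgV0 R nat \oo _ (fun n => n%:R * y - 1) pos)).
  apply/cvgryPge => A.
  near=> n; rewrite lerBrDr -ler_pdivrMr//; near: n.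
  exact: nbhs_infty_ger.
have ce : (fun n => expR (- (n%:R * y - 1)^-1)) @ \oo --> (1 : R).
  rewrite -[X in _ --> X](@expR0 R); apply: continuous_cvg.
    exact: continuous_expR.
  by rewrite -[X in _ --> X]oppr0; exact: cvgN.
apply: cvg_trans ce; apply: near_eq_cvg.
near=> n; rewrite /flat expr0 divr1 ifT//.
by rewrite subr_gt0 -ltr_pdivrMr// div1r; near: n; exact: nbhs_infty_gtr.
Unshelve. all: by end_near. Qed.

Lemma cutoff_cvg (a b x : R) : x != a -> x != b ->
  (fun n : nat => cutoff n a b x) @ \oo --> ((a < x < b)%R%:R : R).
Proof.
move=> xa xb.
have [ax|ax] := ltP a x; last first.
  rewrite /= (_ : (fun n => _) = cst 0); first exact: cvg_cst.
  apply/funext => n; rewrite cutoff_lo//.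
  by rewrite (le_trans _ ler01)// mulr_ge0_le0// subr_le0.
have [bx|bx] := ltP x b; last first.
  rewrite /= (_ : (fun n => _) = cst 0); first exact: cvg_cst.
  apply/funext => n; rewrite cutoff_hi//.
  by rewrite (le_trans _ ler01)// mulr_ge0_le0// subr_le0.
rewrite /= -[1]mulr1.
by apply: cvgM; apply: flat_cvg1; rewrite subr_gt0.
Qed.

(** The primitive is the integral from [-oo], finite because [f] vanishes to the left of 0; the
    fundamental theorem then applies at every point at once. *)
Lemma primitive_exists (f : R -> R) : continuous f ->
  (forall x, x <= 0 -> f x = 0) ->
  exists F, forall x, is_derive x (1 : R) F (f x).
Proof.
move=> cf f0.
pose D (u : R) : set (measurableTypeR R) := [set` Interval -oo%O (BRight u)].
have intf (u : R) : lebesgue_measure.-integrable (D u) (EFin \o f).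
  apply: (iffRL (@integrable_mkcond _ (measurableTypeR R) R lebesgue_measure
    (D u) (EFin \o f) (measurable_itv _))).
  rewrite (_ : _ \_ _ = (EFin \o f) \_ (`[0, u] : set (measurableTypeR R))).
    apply: (iffLR (@integrable_mkcond _ (measurableTypeR R) R lebesgue_measure
      `[0, u] (EFin \o f) (measurable_itv _))).
    apply: continuous_compact_integrable; first exact: segment_compact.
    exact: continuous_subspaceT.
  apply/funext => x; rewrite /patch /= !mem_setE !in_itv /=.
  have [x0|x0] := leP 0 x; first by case: (x <= u).
  by rewrite /= f0 ?(ltW x0)//; case: ifP.
exists (fun x => \int[lebesgue_measure]_(t in [set` Interval -oo%O (BRight x)]) f t).
move=> x.
have [] := @continuous_FTC1 R f -oo%O x (x + 1) _ (intf _) _ (cf x).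
- by rewrite ltrDl.
- by rewrite ltNye.
by move=> dF <-; rewrite derive1E; exact/derivableP.
Qed.

(* F is a smooth version of the tent function on [a, a + 2 h]: its derivative
   tends to the difference of the indicators of the two halves. *)
Lemma tent_exists n a h : 0 < h ->
  exists2 F : R -> R,
    (forall x : R, is_derive x (1 : R) F
       (cutoff n a (a + h) x - cutoff n (a + h) (a + h + h) x)) &
    [/\ forall x, `|F x| <= h,
        forall x, n%:R * (x - a) <= 1 -> F x = 0 &
        forall x, n%:R * (a + h + h - x) <= 1 -> F x = 0].
Proof.
move=> h0; pose f := cutoff n 0 h.
have f0 x : x <= 0 -> f x = 0.
  move=> x0; apply: cutoff_lo; rewrite subr0.
  by apply: le_trans ler01; rewrite mulr_ge0_le0.
have [F dF] := primitive_exists (@smooth_upto_continuous _ _ _ (smooth_cutoff 0 n 0 h)) f0.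
have dFa c x : is_derive x (1 : R) (fun y => F (y - c)) (f (x - c)).
  have := @is_derive_affine R 1 (- c) x F (f (x - c)).
  rewrite mul1r mul1r => /(_ (dF _)); congr is_derive.
  by apply/funext => y; rewrite mul1r.
have F_lip x y : x <= y -> exists2 c, x <= c <= y & F y - F x = f c * (y - x).
  move=> xy; have [c] := MVT_segment xy (fun z _ => dF z)
      (continuous_subspaceT (is_derive_continuous dF)).
  by rewrite in_itv /=; exists c.
(* Here [F] is a primitive of a bump on [[0, h]]. The difference is the integral of the bump over a
   window of length [h]: it is at most [h], it vanishes when the window misses the support, and its
   derivative is the difference of two translates of the bump. *)
exists (fun x => F (x - a) - F (x - (a + h))); last split.
- move=> x.
  have dB : is_derive x (1 : R) (fun y => F (y - a) - F (y - (a + h)))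
      (f (x - a) - f (x - (a + h))) := is_deriveB (dFa a x) (dFa (a + h) x).
  apply: is_derive_eq dB _; rewrite /f /cutoff; congr (flat _ _ * flat _ _ - flat _ _ * flat _ _);
  ring.
- move=> x; have /F_lip[c _ ->] : x - (a + h) <= x - a by lra.
  rewrite (_ : x - a - _ = h); last ring.
  rewrite ger0_norm ?(mulr_ge0 (cutoff_ge0 _ _ _ _) (ltW h0))//.
  by rewrite ler_piMl ?(ltW h0)// cutoff_le1.
- move=> x nx; have /F_lip[c /andP[_ cx] ->] : x - (a + h) <= x - a by lra.
  rewrite /f cutoff_lo ?mul0r// subr0 (le_trans _ nx)// ler_wpM2l//.
- move=> x nx; have /F_lip[c /andP[cx _] ->] : x - (a + h) <= x - a by lra.
  rewrite /f cutoff_hi ?mul0r// (le_trans _ nx)// ler_wpM2l//; lra.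
Qed.

End cutoff.

(** * Test functions in product form *)

Section Ck.
Context {R : realType} {V : normedModType R}.
Implicit Types (f g : V -> R) (k : nat).

Lemma CkS k f : Ck k.+1 f -> Ck k f.
Proof.
elim: k f => [f [df _] x|k IH f [df cf]]; first exact: differentiable_continuous.
by split => // v; exact/IH/cf.
Qed.

Lemma CkD k f g : Ck k f -> Ck k g -> Ck k (f \+ g).
Proof.
elim: k f g => [f g cf cg x|k IH f g [df cf] [dg cg]].
  by apply: continuousD; [exact: cf|exact: cg].
split=> [x|v]; first exact: (@differentiableD _ _ _ f g x (df x) (dg x)).
rewrite (_ : 'D_v _ = 'D_v f \+ 'D_v g); first by apply: IH; [exact: cf|exact: cg].
by apply/funext => x; apply: deriveD; exact: diff_derivable.
Qed.

Lemma CkM k f g : Ck k f -> Ck k g -> Ck k (f \* g).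
Proof.
elim: k f g => [f g cf cg x|k IH f g].
  by apply: continuousM; [exact: cf|exact: cg].
move=> sf sg; move: (sf) (sg) => [df cf] [dg cg].
split=> [x|v]; first exact: (@differentiableM _ _ f g x (df x) (dg x)).
rewrite (_ : 'D_v _ = (f \* 'D_v g) \+ (g \* 'D_v f)).
  by apply: CkD; apply: IH; [exact: CkS|exact: cg|exact: CkS|exact: cf].
by apply/funext => x; apply: deriveM; exact: diff_derivable.
Qed.

Lemma Ck_cst k (c : R) : Ck k (cst c : V -> R).
Proof.
elim: k c => [c|k IH c]; first exact: cst_continuous.
split=> [x|v]; first exact: differentiable_cst.
rewrite (_ : 'D_v _ = cst 0)//.
by apply/funext => x; exact: derive_cst.
Qed.

Lemma Ck_prod k (I : Type) (r : seq I) (f : I -> V -> R) :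
  (forall i, Ck k (f i)) -> Ck k (fun x => \prod_(i <- r) f i x).
Proof.
move=> cf; elim: r => [|i r IH].
  rewrite (_ : (fun _ => _) = cst 1); first exact: Ck_cst.
  by apply/funext => x; rewrite big_nil.
rewrite (_ : (fun _ => _) = f i \* (fun x => \prod_(j <- r) f j x)).
  exact: CkM.
by apply/funext => x; rewrite big_cons.
Qed.

Lemma derive_comp_linear (l : {linear V -> R}) (h h' : R -> R) (x v : V) :
  continuous l -> is_derive (l x) (1 : R) h (h' (l x)) ->
  differentiable (h \o l) x /\ 'D_v (h \o l) x = l v * h' (l x).
Proof.
move=> cl dh.
have dl : differentiable l x by exact: linear_differentiable.
have dhl : differentiable h (l x) by apply/derivable1_diffP; exact: ex_derive.
split; first exact: differentiable_comp.
rewrite deriveE; last exact: differentiable_comp.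
rewrite diff_comp// /= diff_lin//.
have <- : 'D_1 h (l x) = h' (l x) by exact: derive_val.
rewrite deriveE// -[X in 'd h _ X]mulr1.
by rewrite -[l v * 1]/(l v *: (1 : R)) linearZ.
Qed.

Lemma Ck_comp_linear k (l : {linear V -> R}) (h : R -> R) :
  continuous l -> smooth_upto k h -> Ck k (h \o l).
Proof.
move=> cl; elim: k h => [h ch x|k IH h [h' dh sh']].
  by apply: continuous_comp; [exact: cl|exact: ch].
split=> [x|v]; first by have [] := @derive_comp_linear l h h' x 0 cl (dh (l x)).
rewrite (_ : 'D_v _ = cst (l v) \* (h' \o l)).
  by apply: CkM; [exact: Ck_cst|exact: IH].
by apply/funext => x; have [_ ->] := @derive_comp_linear l h h' x v cl (dh (l x)).
Qed.

End Ck.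

Section coordinates.
Context {R : realType} {N : nat}.
Local Notation X := ('rV[R]_N * R)%type.
Implicit Types (j : option 'I_N) (z : X).

Definition xcoord j z : R := if j is Some i then z.1 0 i else z.2.

Lemma coord_is_linear j : linear (xcoord j).
Proof. by case: j => [i|] a x y //=; rewrite !mxE. Qed.

HB.instance Definition _ j :=
  GRing.isLinear.Build R X R _ (xcoord j) (coord_is_linear j).

Lemma continuous_coord j : continuous (xcoord j).
Proof.
case: j => [i|] z /=; last exact: cvg_snd.
apply: (@continuous_comp _ _ _ fst (fun x : 'rV[R]_N => x 0 i)).
  exact: cvg_fst.
exact: coord_continuous.
Qed.

Lemma coord_direction i j : xcoord i (direction j) = (i == j)%:R.
Proof.
case: i j => [i|] [j|] /=; rewrite ?mxE//.
Qed.

Lemma measurable_coordX j : measurable_fun [set: X] (xcoord j).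
Proof.
case: j => [i|] /=; last exact: measurable_snd.
exact: (measurableT_comp (measurable_coord i) measurable_fst).
Qed.

Definition prod_coord (F : option 'I_N -> R -> R) z : R := \prod_j F j (xcoord j z).

Lemma Ck_prod_coord k F : (forall j, smooth_upto k (F j)) -> Ck k (prod_coord F).
Proof.
move=> sF; apply: Ck_prod => j.
exact: (@Ck_comp_linear R X k (xcoord j) (F j) (@continuous_coord j)).
Qed.

Lemma derive_prod_coord F j (dF : R -> R) z :
  (forall i, smooth_upto 1 (F i)) ->
  (forall x : R, is_derive x (1 : R) (F j) (dF x)) ->
  'D_(direction j) (prod_coord F) z =
  dF (xcoord j z) * \prod_(i | i != j) F i (xcoord i z).
Proof.
move=> sF dFj.
have [dfj dfjE] : differentiable (F j \o xcoord j) z /\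
    'D_(direction j) (F j \o xcoord j) z = xcoord j (direction j) * dF (xcoord j z).
  exact: (@derive_comp_linear R X (xcoord j) (F j) dF z (direction j)
    (@continuous_coord j) (dFj _)).
pose G z := \prod_(i | i != j) F i (xcoord i z).
have FG : prod_coord F = (F j \o xcoord j) \* G.
  by apply/funext => y; rewrite /prod_coord (bigD1 j).
have dG : differentiable G z.
  suff: Ck 1 G by case.
  rewrite (_ : G = prod_coord (fun i => if i != j then F i else cst 1)).
    apply: Ck_prod_coord => i; case: ifP => // _; exact: smooth_upto_cst.
  apply/funext => y; rewrite /G /prod_coord [RHS](bigD1 j)//= eqxx mul1r.
  by apply: eq_bigr => i ->.
have dG0 : 'D_(direction j) G z = 0.
  rewrite /derive (_ : (fun _ => _) = cst 0); first exact: lim_cst.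
  apply/funext => h; rewrite [X in X - _](_ : _ = G z) ?subrr ?scaler0//.
  apply: eq_bigr => i ij; congr (F i _).
  by rewrite /= linearD linearZ /= coord_direction (negbTE ij) scaler0 add0r.
rewrite FG (_ : _ \* _ = (F j \o xcoord j) * G)// deriveM; last 2 first.
- exact: diff_derivable.
- exact: diff_derivable.
by rewrite dfjE dG0 scaler0 add0r coord_direction eqxx mul1r mulrC.
Qed.

End coordinates.

Section test_prod.
Context {R : realType} {N : nat}.
Local Notation X := ('rV[R]_N * R)%type.
Implicit Types (lo hi : option 'I_N -> R) (j : option 'I_N).

Definition cbox lo hi : set X := [set z | forall j, lo j <= xcoord j z <= hi j].

Lemma compact_cbox lo hi : compact (cbox lo hi).
Proof.
pose P : set 'rV[R]_N := [set v | forall i, `[lo (Some i), hi (Some i)]%classic (v ord0 i)].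
have -> : cbox lo hi = P `*` `[lo None, hi None]%classic.
  apply/seteqP; split => [z bz|z [/= Pz] zN [i|]] /=.
  - split; last by have := bz None; rewrite /= in_itv.
    by move=> i /=; have := bz (Some i); rewrite /= in_itv.
  - by have := Pz i; rewrite /= in_itv.
  - by move: zN; rewrite /= in_itv.
apply: compact_setX; last exact: segment_compact.
apply: (@rV_compact R N (fun i => `[lo (Some i), hi (Some i)]%classic)) => i.
exact: segment_compact.
Qed.

Lemma test_function_prod_coord (D : set X) lo hi F :
  (forall k j, smooth_upto k (F j)) ->
  (forall j x, ~~ (lo j <= x <= hi j) -> F j x = 0) ->
  cbox lo hi `<=` D ->
  test_function D (prod_coord F).
Proof.
move=> sF F0 bD.
have sub : Defs.support (prod_coord F) `<=` cbox lo hi.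
  have cb : closed (cbox lo hi).
    apply: (@compact_closed X); last exact: compact_cbox.
    exact: (@norm_hausdorff R X).
  rewrite /Defs.support (iffLR (closure_id (cbox lo hi)) cb).
  apply: closure_subset => z /= /eqP nz j; apply/negP => h.
  by apply: nz; rewrite /prod_coord (bigD1 j)//= F0 ?mul0r//; apply/negP.
split => [k||z /sub/bD//]; first by apply: Ck_prod_coord => j; exact: sF.
apply: subclosed_compact sub; [exact: closed_closure|exact: compact_cbox].
Qed.

End test_prod.

(** * Boxes *)

Section box.
Context {R : realType} {N : nat}.
Local Notation X := ('rV[R]_N * R)%type.
Local Notation mu := (lebesgue_strip N).
Implicit Types (lo hi : option 'I_N -> R) (j : option 'I_N).

(** Half-open, so that the two halves of a box partition it exactly. *)
Definition box lo hi : set X := [set z | forall j, lo j <= xcoord j z < hi j].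

Lemma measurable_coord_pre j (A : set R) : measurable A ->
  measurable [set z : X | A (xcoord j z)].
Proof.
move=> mA; have := @measurable_coordX R N j measurableT _ mA.
by rewrite setTI.
Qed.

Lemma measurable_box lo hi : measurable (box lo hi).
Proof.
rewrite [X in measurable X](_ : _ = \bigcap_(j in [set: option 'I_N])
    [set z | `[lo j, hi j[%classic (xcoord j z)]).
  apply: fin_bigcap_measurable => [|j _]; first exact: finite_finset.
  exact: measurable_coord_pre.
by apply/seteqP; split => z bz j => [_|]; have := bz j; rewrite /= in_itv /=//; apply.
Qed.

Lemma strip_measureX (A : set 'rV[R]_N) (B : set R) :
  measurable A -> measurable B ->
  mu (A `*` B) = (lebesgue_rV N A * lebesgue_measure (B : set (measurableTypeR R)))%E.
Proof. by move=> mA mB; rewrite -product_measure1E. Qed.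

Lemma strip_measure_coord (A : option 'I_N -> set R) :
  (forall j, measurable (A j)) ->
  mu [set z | forall j, A j (xcoord j z)] =
  (\prod_j (lebesgue_measure (A j : set (measurableTypeR R))))%E.
Proof.
move=> mA.
have -> : [set z : X | forall j, A j (xcoord j z)] =
    [set x : 'rV[R]_N | forall i, A (Some i) (x 0 i)] `*` A None.
  apply/seteqP; split=> [z Az|z [/= h1 h2] [i|]] //=.
have mB : measurable [set x : 'rV[R]_N | forall i, A (Some i) (x 0 i)].
  rewrite [X in measurable X](_ : _ = \bigcap_(i in [set: 'I_N])
      ((fun x : 'rV[R]_N => x 0 i) @^-1` A (Some i))); last first.
    by apply/seteqP; split => x /= h i => [_|]; exact: h.
  apply: fin_bigcap_measurable => [|i _]; first exact: finite_finset.
  rewrite -[_ @^-1` _]setTI.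
  exact: (@measurable_coord R N i measurableT _ (mA (Some i))).
rewrite strip_measureX// (@lebesgue_rV_box R N (fun i => A (Some i)))//; last first.
  by move=> i; exact: mA.
rewrite [RHS](bigD1 None)//= muleC; congr (_ * _)%E.
by rewrite (reindex_omap Some id) => [|[]]//=; apply: eq_bigl => i; rewrite eqxx.
Qed.

Lemma box_measure lo hi : (forall j, lo j <= hi j) ->
  mu (box lo hi) = (\prod_j (hi j - lo j))%:E.
Proof.
move=> lohi.
have -> : box lo hi = [set z | forall j, `[lo j, hi j[%classic (xcoord j z)].
  by apply/seteqP; split => z bz j; have := bz j; rewrite /= in_itv.
rewrite (@strip_measure_coord (fun j => `[lo j, hi j[%classic)); last first.
  by move=> j; exact: measurable_itv.
rewrite -prodEFin; apply: eq_bigr => j _.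
by rewrite lebesgue_measure_itv /= lte_fin -EFinB; case: ltP => // h; rewrite (@le_anti _ _ (lo j) (hi j)) ?subrr ?lohi.
Qed.

Lemma hyperplane_null j (c : R) : mu [set z | xcoord j z = c] = 0%E.
Proof.
pose A i : set R := if i == j then [set c] else setT.
have -> : [set z : X | xcoord j z = c] = [set z | forall i, A i (xcoord i z)].
  apply/seteqP; split => [z /= zc i|z /(_ j)]; last by rewrite /A eqxx.
  by rewrite /A; case: eqP => // ->.
rewrite strip_measure_coord; last by rewrite /A => i; case: ifP.
(* The other factors, if any, are [+oo]; the product is 0 by the convention [0 * +oo = 0]. *)
by rewrite (bigD1 j)//= /A eqxx lebesgue_measure_set1 mul0e.
Qed.

Lemma negligible_hyperplanes (c : option 'I_N -> R) :
  {ae mu, forall z, forall j, xcoord j z != c j}.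
Proof.
apply: filter_forall => j; exists [set z | xcoord j z = c j].
split; [|exact: hyperplane_null|by move=> z /= /negP/negPn/eqP].
by apply: (@measurable_coord_pre j [set c j]); exact: measurable_set1.
Qed.
End box.

(** * Square integrable functions *)

Section square_integrable.
Context d (T : measurableType d) {R : realType}.
Variable mu : {measure set T -> \bar R}.
Implicit Types (w : T -> R) (B : set T).

Definition sqint w : Prop :=
  measurable_fun setT w /\ (\int[mu]_z (w z ^+ 2)%:E < +oo)%E.

Lemma integrable_cst_lty B (k : R) : measurable B -> (mu B < +oo)%E ->
  mu.-integrable B (EFin \o cst k).
Proof.
move=> mB Boo; apply/integrableP; split; first exact/measurable_EFinP.
under eq_integral do rewrite /=.
by rewrite integral_cst// lte_mul_pinfty// abse_fin_num.
Qed.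

Lemma measurable_sqint w B : sqint w -> measurable_fun B (EFin \o w : T -> \bar R).
Proof. by case=> mw _; apply/measurable_EFinP; exact: measurable_funTS. Qed.

Lemma sqint_sqr_integrable w B : measurable B -> sqint w ->
  mu.-integrable B (fun z => (w z ^+ 2)%:E).
Proof.
move=> mB [mw w2]; apply: (@integrableS _ _ _ _ setT) => //.
have m2 : measurable_fun setT (fun z => (w z ^+ 2)%:E).
  by apply/measurable_EFinP; exact: measurable_funX.
apply/integrableP; split => //.
by under eq_integral do rewrite /= ger0_norm ?sqr_ge0//.
Qed.

Lemma sqint_integrable w B : measurable B -> (mu B < +oo)%E -> sqint w ->
  mu.-integrable B (EFin \o w).
Proof.
move=> mB Boo sw.
apply: (@le_integrable _ _ _ mu B mB _ (fun z => (1 + w z ^+ 2)%:E)).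
- exact: measurable_sqint.
- move=> x _ /=; rewrite lee_fin [leRHS]ger0_norm ?addr_ge0 ?sqr_ge0//.
  by rewrite -real_normK ?num_real//; nra.
- apply: (@integrableD _ _ _ mu B mB (EFin \o cst 1) (fun z => (w z ^+ 2)%:E)).
    exact: integrable_cst_lty.
  exact: sqint_sqr_integrable.
Qed.

(* Expand the integral of (|w| - c)^2 for c the mean of |w|. *)
Lemma sqr_Rintegral_le w B : measurable B -> (mu B < +oo)%E -> sqint w ->
  (\int[mu]_(z in B) `|w z|) ^+ 2 <=
  fine (mu B) * \int[mu]_(z in B) (w z ^+ 2).
Proof.
move=> mB Boo sw.
set b := fine (mu B); set I := \int[mu]_(z in B) `|w z|.
set J := \int[mu]_(z in B) (w z ^+ 2).
have iw := sqint_integrable mB Boo sw.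
have in_ : mu.-integrable B (EFin \o (fun z => `|w z|)) := integrable_norm iw.
have i2 := sqint_sqr_integrable mB sw.
have ic c : mu.-integrable B (EFin \o cst c) by exact: integrable_cst_lty.
have key (c : R) : 2 * c * I <= J + c ^+ 2 * b.
  rewrite /I -RintegralZl// /b -(Rintegral_cst _ mB) /J -RintegralD//; last exact: (ic (c ^+ 2)).
  apply: le_Rintegral => //.
  - exact: (integrableZl mB (2 * c) in_).
  - exact: (integrableD mB i2 (ic (c ^+ 2))).
  - move=> x _; rewrite -[w x ^+ 2]real_normK ?num_real// .
    have := sqr_ge0 (`|w x| - c); rewrite !expr2; nra.
have J0 : 0 <= J by apply: Rintegral_ge0 => x _; exact: sqr_ge0.
have b0 : 0 <= b by exact: fine_ge0.
have I0 : 0 <= I by apply: Rintegral_ge0.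
have [b00|bn0] := eqVneq b 0.
  have [->|In0] := eqVneq I 0; first by rewrite expr0n /= mulr_ge0.
  (* On a null set [key] reads [2 * c * I <= J] for every [c]; this choice of [c] contradicts
     [J >= 0] unless [I = 0]. *)
  have := key ((J + 1) / I); rewrite b00 mulr0 addr0.
  rewrite -mulrA mulfVK//; lra.
have := key (I / b).
rewrite exprMn exprVn expr2 -(ler_pM2l (_ : 0 < b)) ?lt0r ?bn0 ?b0//.
have -> : b * (2 * (I / b) * I) = 2 * (I ^+ 2) by field.
have -> : b * (J + I * I / b ^+ 2 * b) = b * J + I ^+ 2 by field.
lra.
Qed.

End square_integrable.

(** * Weak derivatives and averages *)

Section halving.
Context {R : realType} {N : nat}.
Local Notation X := ('rV[R]_N * R)%type.
Local Notation mu := (lebesgue_strip N).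
Implicit Types (lo hi : option 'I_N -> R) (i j : option 'I_N) (z : X).

Definition upd (f : option 'I_N -> R) j (x : R) : option 'I_N -> R :=
  fun i => if i == j then x else f i.

Definition mid lo hi j : R := (lo j + hi j) / 2.

Definition lbox lo hi j := box lo (upd hi j (mid lo hi j)).
Definition rbox lo hi j := box (upd lo j (mid lo hi j)) hi.

Lemma lboxE lo hi j : lo j < hi j ->
  lbox lo hi j = box lo hi `&` [set z | xcoord j z < mid lo hi j].
Proof.
move=> lh; apply/seteqP; split => z /=.
- move=> bz; split; last by have := bz j; rewrite /upd eqxx => /andP[].
  move=> i; have /andP[-> /=] := bz i; rewrite /upd; case: eqP => // ->.
  rewrite /mid => /lt_le_trans; apply; lra.
- move=> [bz zm] i; have /andP[-> /= h] := bz i.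
  by rewrite /upd; case: eqP => // ->.
Qed.

Lemma rboxE lo hi j : lo j < hi j ->
  rbox lo hi j = box lo hi `&` [set z | mid lo hi j <= xcoord j z].
Proof.
move=> lh; apply/seteqP; split => z /=.
- move=> bz; split; last by have := bz j; rewrite /upd eqxx => /andP[].
  move=> i; have /andP[+ ->] := bz i; rewrite /upd andbT; case: eqP => // ->.
  by apply: le_trans; rewrite /mid; lra.
- move=> [bz zm] i; have /andP[h ->] := bz i.
  by rewrite /upd andbT; case: eqP => // ->.
Qed.

Lemma lboxUrbox lo hi j : lo j < hi j -> box lo hi = lbox lo hi j `|` rbox lo hi j.
Proof.
move=> lh; rewrite lboxE// rboxE// -setIUr (_ : _ `|` _ = setT) ?setIT//.
by apply/seteqP; split => // z _ /=; case: (ltP (xcoord j z) (mid lo hi j)); [left|right].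
Qed.

Lemma lboxIrbox lo hi j : lo j < hi j -> [disjoint lbox lo hi j & rbox lo hi j].
Proof.
move=> lh; rewrite lboxE// rboxE//; apply/disj_setPS => z [] [_ /= h1] [_ /= h2].
by move: (lt_le_trans h1 h2); rewrite ltxx.
Qed.

Section key.
Variables (l : R) (u g : X -> R) (j : option 'I_N) (lo hi : option 'I_N -> R).
Let D : set X := strip setT l.
Hypotheses (uD : sqint mu (u \_ D)) (gD : sqint mu (g \_ D)).
Hypothesis weak : is_weak_derivative D j u g.
Hypothesis lohi : forall i, lo i < hi i.
Hypotheses (lo0 : 0 <= lo None) (hil : hi None <= l).

Let h := (hi j - lo j) / 2.
Let h0 : 0 < h. Proof. by rewrite divr_gt0// subr_gt0. Qed.
Let m := lo j + h.
Let midE : mid lo hi j = m. Proof. by rewrite /mid /m /h; lra. Qed.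
Let hiE : m + h = hi j. Proof. by rewrite /m /h; lra. Qed.

Let tentx n := cid2 (tent_exists n.+1 (lo j) h0).
Let tent n : R -> R := projT1 (tentx n).
(** [prod_coord (F n)] is the test function, and [psi n] below is its derivative along [j]. The
    index [n.+1] makes the margin [1 / n.+1] meaningful for every [n]. *)
Let F n i := if i == j then tent n else cutoff n.+1 (lo i) (hi i).
Let dtent n (x : R) := cutoff n.+1 (lo j) m x - cutoff n.+1 m (hi j) x.
Let psi n z := dtent n (xcoord j z) * \prod_(i | i != j) F n i (xcoord i z).

Let is_derive_tent n (x : R) : is_derive x (1 : R) (tent n) (dtent n x).
Proof. by rewrite /tent; case: (tentx n) => f /= + _ => /(_ x); rewrite -/m hiE. Qed.

Let tent_le n x : `|tent n x| <= h.
Proof. by rewrite /tent; case: (tentx n) => f /= _ []. Qed.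

Let smooth_F n k i : smooth_upto k (F n i).
Proof.
rewrite /F; case: eqP => _; last exact: smooth_cutoff.
apply: smooth_uptoS; exists (dtent n); first exact: is_derive_tent.
by apply: smooth_uptoB; exact: smooth_cutoff.
Qed.

Let F_lo n i x : n.+1%:R * (x - lo i) <= 1 -> F n i x = 0.
Proof.
rewrite /F; case: eqP => [->|_]; last exact: cutoff_lo.
by rewrite /tent; case: (tentx n) => f /= _ [_ + _]; apply.
Qed.

Let F_hi n i x : n.+1%:R * (hi i - x) <= 1 -> F n i x = 0.
Proof.
rewrite /F; case: eqP => [->|_]; last exact: cutoff_hi.
by rewrite /tent; case: (tentx n) => f /= _ [_ _]; rewrite -/m hiE; apply.
Qed.

Let F_out n i x : ~~ (lo i <= x < hi i) -> F n i x = 0.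
Proof.
rewrite negb_and -ltNge -leNgt => /orP[xl|xh].
  by apply: F_lo; rewrite (le_trans _ ler01)// mulr_ge0_le0// subr_le0 ltW.
by apply: F_hi; rewrite (le_trans _ ler01)// mulr_ge0_le0// subr_le0.
Qed.

Let dtent_out n x : ~~ (lo j <= x < hi j) -> dtent n x = 0.
Proof.
have mh : lo j <= m by rewrite lerDl ltW.
have mh' : m <= hi j by rewrite -hiE lerDl ltW.
have n0 : 0 <= n.+1%:R :> R by [].
rewrite /dtent negb_and -ltNge -leNgt => /orP[xl|xh].
  by rewrite !cutoff_lo ?subrr// (le_trans _ ler01)// mulr_ge0_le0//; lra.
by rewrite !cutoff_hi ?subrr// (le_trans _ ler01)// mulr_ge0_le0//; lra.
Qed.

Let test n : test_function D (prod_coord (F n)).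
Proof.
pose e : R := n.+1%:R^-1.
have e0 : 0 < e by rewrite invr_gt0.
have nK : n.+1%:R * e = 1 by rewrite divff.
(* The strip is open while the box may reach [0] or [l] along the edge: the margin [e] keeps the
   support inside. *)
apply: (@test_function_prod_coord R N D (fun i => lo i + e) (fun i => hi i - e)).
- by move=> k i; exact: smooth_F.
- move=> i x; rewrite negb_and -!ltNge => /orP[xl|xh].
    by apply: F_lo; rewrite -[X in _ <= X]nK ler_wpM2l//; lra.
  by apply: F_hi; rewrite -[X in _ <= X]nK ler_wpM2l//; lra.
- move=> z /(_ None) /= /andP[z1 z2]; rewrite /D /strip; split => //=.
  move: z1 z2 lo0 hil e0; move: (lo None) (hi None) z.2 => a b c z1 z2 ? ? ?.
  by rewrite in_itv /=; apply/andP; split; lra.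
Qed.

Let psiE n z : 'D_(direction j) (prod_coord (F n)) z = psi n z.
Proof.
apply: (@derive_prod_coord R N (F n) j (dtent n) z) => [i|x].
  exact: smooth_F.
by rewrite {1}/F eqxx; exact: is_derive_tent.
Qed.

Let prodF_out n z : ~ box lo hi z -> prod_coord (F n) z = 0.
Proof.
move=> /existsNP[i /negP zi].
by rewrite /prod_coord (bigD1 i)//= F_out// mul0r.
Qed.

Let psi_out n z : ~ box lo hi z -> psi n z = 0.
Proof.
move=> /existsNP[i /negP zi]; rewrite /psi.
have [ij|ij] := eqVneq i j; first by rewrite dtent_out ?mul0r// -ij.
by rewrite (bigD1 i)//= F_out// mul0r mulr0.
Qed.

Let cutprod_le n (z : X) :
  0 <= \prod_(i | i != j) F n i (xcoord i z) <= 1.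
Proof.
rewrite prodr_ge0/= => [|i ij]; last by rewrite /F (negbTE ij) cutoff_ge0.
apply: prodr_ile1 => i ij; by rewrite /F (negbTE ij) cutoff_ge0 cutoff_le1.
Qed.

Let prodF_le n z : `|prod_coord (F n) z| <= h.
Proof.
have /andP[p0 p1] := cutprod_le n z.
rewrite /prod_coord (bigD1 j)//= normrM (ger0_norm p0) -[h]mulr1.
by apply: ler_pM => //; rewrite /F eqxx.
Qed.

Let psi_le n z : `|psi n z| <= 1.
Proof.
have /andP[p0 p1] := cutprod_le n z.
rewrite /psi normrM (ger0_norm p0) mulr_ile1// /dtent.
have := cutoff_ge0 n.+1 (lo j) m (xcoord j z).
have := cutoff_le1 n.+1 (lo j) m (xcoord j z).
have := cutoff_ge0 n.+1 m (hi j) (xcoord j z).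
have := cutoff_le1 n.+1 m (hi j) (xcoord j z).
by move=> *; rewrite ler_norml; apply/andP; split; lra.
Qed.

Let measurable_F n i : measurable_fun [set: X] (fun z => F n i (xcoord i z)).
Proof.
apply: measurableT_comp; last exact: measurable_coordX.
exact: continuous_measurable_fun (smooth_upto_continuous (smooth_F n 0 i)).
Qed.

Let measurable_prodF n : measurable_fun [set: X] (prod_coord (F n)).
Proof. by apply: measurable_prod => i _; exact: measurable_F. Qed.

Let measurable_psi n : measurable_fun [set: X] (psi n).
Proof.
apply: measurable_funM.
  apply: (measurableT_comp _ (measurable_coordX j)).
  apply: continuous_measurable_fun; apply: (@smooth_upto_continuous _ 0).
  by apply: smooth_uptoB; exact: smooth_cutoff.
pose G (z : X) := \prod_i (if i != j then F n i (xcoord i z) else 1).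
have mG : measurable_fun [set: X] G.
  apply: measurable_prod => i _; case: (i != j); last exact: measurable_cst.
  exact: measurable_F.
by apply: eq_measurable_fun mG => z _; rewrite /G -big_mkcond.
Qed.

Let lim_psi z : z \in box lo hi -> 
  (forall i, xcoord i z != lo i) -> (forall i, xcoord i z != hi i) -> xcoord j z != m ->
  (fun n => psi n z) @ \oo --> (if xcoord j z < m then 1 else -1 : R).
Proof.
rewrite inE => bz zlo zhi zm.
have bz' i : lo i < xcoord i z < hi i.
  by have /andP[? ->] := bz i; rewrite andbT lt_neqAle eq_sym zlo.
have shift (f : nat -> R) (y : R) : f @ \oo --> y -> (fun n => f n.+1) @ \oo --> y.
  by rewrite cvg_shiftS.
have -> : (if xcoord j z < m then 1 else -1 : R) =
    ((xcoord j z < m)%R%:R - (m <= xcoord j z)%R%:R) * 1.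
  by rewrite mulr1; case: ltP => _; rewrite ?subr0 ?sub0r.
apply: cvgM.
  apply: cvgB.
    have := shift _ _ (cutoff_cvg (zlo j) zm).
    by have /andP[-> _] := bz' j; apply.
  have := shift _ _ (cutoff_cvg zm (zhi j)).
  have /andP[_ ->] := bz' j; rewrite andbT.
  by rewrite lt_neqAle eq_sym zm; apply.
rewrite [X in _ --> X](_ : 1 = \prod_(i | i != j) 1); last by rewrite big1.
apply: (@cvg_big R _ *%R 1 (fun i => i != j) (@mul_continuous R) nat \oo
  (index_enum _) (fun i n => F n i (xcoord i z)) (fun=> 1)) => i ij; rewrite /F (negbTE ij).
have := shift _ _ (cutoff_cvg (zlo i) (zhi i)).
by rewrite bz'; apply.
Qed.

Let ut := u \_ D.
Let gt := g \_ D.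
Let B := box lo hi.
Let mB : measurable B. Proof. exact: measurable_box. Qed.

Let Boo : (mu B < +oo)%E.
Proof. by rewrite box_measure ?ltry// => i; exact: ltW. Qed.

Let iu : mu.-integrable B (EFin \o ut). Proof. exact: sqint_integrable. Qed.
Let ig : mu.-integrable B (EFin \o gt). Proof. exact: sqint_integrable. Qed.

(** The box need not lie in [D], since it may contain points whose coordinate along the edge is 0;
    hence the extension of [w] by zero on the right. *)
Let restrict_test (w f : X -> R) : (forall z, ~ B z -> f z = 0) ->
  \int[mu]_(z in D) (w z * f z) = \int[mu]_(z in B) ((w \_ D) z * f z).
Proof.
move=> f0; rewrite Rintegral_mkcond [RHS]Rintegral_mkcond; congr Rintegral.
apply/funext => z; rewrite /patch; case: ifPn => zD; case: ifPn => zB //.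
- by rewrite f0 ?mulr0// => Bz; rewrite mem_set in zB.
- by rewrite mul0r.
Qed.

Let integral_psi_le n :
  `|\int[mu]_(z in B) (ut z * psi n z)| <= h * \int[mu]_(z in B) `|gt z|.
Proof.
have igp : mu.-integrable B (EFin \o (fun z => gt z * prod_coord (F n) z)).
  apply: (@le_integrable _ _ _ mu B mB _ (fun z => h%:E * `|gt z|%:E)%E).
  - apply/measurable_EFinP; apply: measurable_funM.
      by apply: measurable_funTS; case: gD.
    exact: measurable_funTS.
  - move=> z _ /=; rewrite lee_fin normrM [leRHS]normrM normr_id (gtr0_norm h0) mulrC ler_wpM2r//.
  - exact: (integrableZl mB h (integrable_norm ig)).
have <- : \int[mu]_(z in D) (u z * 'D_(direction j) (prod_coord (F n)) z) =
    \int[mu]_(z in B) (ut z * psi n z).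
  rewrite restrict_test; last by move=> z zB; rewrite psiE psi_out.
  by apply: eq_Rintegral => z _; rewrite psiE.
rewrite (weak (test n)) normrN restrict_test; last exact: prodF_out.
apply: le_trans (le_normr_Rintegral mB igp) _.
have ign := integrable_norm ig.
rewrite -RintegralZl//; apply: le_Rintegral => //.
- exact: integrable_norm igp.
- exact: (integrableZl mB h ign).
- by move=> z _; rewrite normrM mulrC ler_wpM2r// prodF_le.
Qed.

Let half z : R := if xcoord j z < m then 1 else -1.

Let half_norm z : `|half z| = 1.
Proof. by rewrite /half; case: ifP; rewrite ?normrN normr1. Qed.

Let mhalf : measurable_fun [set: X] half.
Proof.
apply: measurable_fun_ifT => //.
by apply: measurable_fun_ltr => //; exact: measurable_coordX.
Qed.

Let mut : measurable_fun [set: X] ut. Proof. by case: uD. Qed.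

Let iuh : mu.-integrable B (EFin \o (fun z => ut z * half z)).
Proof.
apply: (le_integrable mB _ _ iu).
  by apply/measurable_EFinP/measurable_funTS/measurable_funM.
by move=> z _ /=; rewrite normrM half_norm mulr1.
Qed.

Let cvg_psi : (fun n => \int[mu]_(z in B) (ut z * psi n z)) @ \oo -->
  \int[mu]_(z in B) (ut z * half z).
Proof.
apply: (@fine_cvg _ _ \oo _ (fun n => \int[mu]_(z in B) (ut z * psi n z)%:E)%E).
rewrite fineK; last exact: integrable_fin_num.
have [] := @dominated_convergence _ X R mu B mB
  (fun n z => (ut z * psi n z)%:E) (fun z => (ut z * half z)%:E)
  (fun z => `|ut z|%:E).
- by move=> n; apply/measurable_EFinP/measurable_funTS/measurable_funM.
- by apply/measurable_EFinP/measurable_funTS/measurable_funM.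
(* The pointwise limit is known off the faces of the box and off the median hyperplanes. *)
- have h1 := @negligible_hyperplanes R N lo.
  have h2 := @negligible_hyperplanes R N hi.
  have h3 := @negligible_hyperplanes R N (fun=> m).
  near=> z => Bz; apply: cvg_EFin; first exact: nearW.
  apply: cvgM; first exact: cvg_cst.
  apply: lim_psi; first by rewrite inE.
  + by near: z; exact: h1.
  + by near: z; exact: h2.
  + by move: (j); near: z; exact: h3.
- exact: integrable_norm iu.
- by apply: aeW => z n _ /=; rewrite lee_fin normrM ler_piMr.
- by [].
Unshelve. all: by end_near. Qed.

(** The functions [psi n] are bounded by 1 and tend to [half], which is 1 on the left half and -1 on
    the right one; the difference of integrals is thus a limit of tested integrals. The factor on
    the right is the height of the tents, a bound uniform in [n]. *)
Lemma half_difference_le :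
  `|\int[mu]_(z in lbox lo hi j) (u \_ D) z - \int[mu]_(z in rbox lo hi j) (u \_ D) z|
    <= (hi j - lo j) / 2 * \int[mu]_(z in box lo hi) `|(g \_ D) z|.
Proof.
have mL : measurable (lbox lo hi j) by exact: measurable_box.
have mR : measurable (rbox lo hi j) by exact: measurable_box.
have BLR := lboxUrbox (lohi j).
have <- : \int[mu]_(z in B) (ut z * half z) =
    \int[mu]_(z in lbox lo hi j) ut z - \int[mu]_(z in rbox lo hi j) ut z.
  rewrite /B BLR Rintegral_setU//; last 2 first.
  - by rewrite -BLR.
  - exact: lboxIrbox.
  congr (_ + _).
    apply: eq_Rintegral => z; rewrite inE lboxE// midE => -[_ /= zm].
    by rewrite /half zm mulr1.
  rewrite -mulN1r -RintegralZl//; last first.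
    by apply: integrableS iu => //; rewrite /B BLR; exact: subsetUr.
  apply: eq_Rintegral => z; rewrite inE rboxE// midE => -[_ /= zm].
  by rewrite /half ltNge zm /= mulrC.
apply: (@closed_cvg _ _ \oo _ _
  (fun x => x <= (hi j - lo j) / 2 * \int[mu]_(z in B) `|gt z|) _ _ _ (cvg_norm cvg_psi)).
  exact: closed_le.
by apply: nearW => n; exact: integral_psi_le.
Qed.

End key.
End halving.

(** * Dyadic partitions *)

Section dyadic.
Context {R : realType} {N : nat}.
Local Notation X := ('rV[R]_N * R)%type.
Local Notation mu := (lebesgue_strip N).
Local Notation bounds := ((option 'I_N -> R) * (option 'I_N -> R))%type.
Implicit Types (b c : bounds) (i j : option 'I_N) (z : X) (js : seq (option 'I_N)).
Implicit Types (f g w : X -> R).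

Definition cell b : set X := box b.1 b.2.
Definition proper b : Prop := forall i, b.1 i < b.2 i.
Definition side b i : R := b.2 i - b.1 i.
Definition vol b : R := \prod_i side b i.
Definition center b j : R := mid b.1 b.2 j.
Definition lhalf b j : bounds := (b.1, upd b.2 j (center b j)).
Definition rhalf b j : bounds := (upd b.1 j (center b j), b.2).

Lemma proper_lhalf b j : proper b -> proper (lhalf b j).
Proof.
move=> pb i; rewrite /= /upd; case: eqP => [->|//].
by have := pb j; rewrite /center /mid; lra.
Qed.

Lemma proper_rhalf b j : proper b -> proper (rhalf b j).
Proof.
move=> pb i; rewrite /= /upd; case: eqP => [->|//].
by have := pb j; rewrite /center /mid; lra.
Qed.

Lemma side_lhalf b j i : side (lhalf b j) i = side b i / (if i == j then 2 else 1).
Proof.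
rewrite /side /= /upd; case: eqP => [->|_]; last by rewrite divr1.
by rewrite /center /mid; field.
Qed.

Lemma side_rhalf b j i : side (rhalf b j) i = side b i / (if i == j then 2 else 1).
Proof.
rewrite /side /= /upd; case: eqP => [->|_]; last by rewrite divr1.
by rewrite /center /mid; field.
Qed.

Lemma vol_lhalf b j : vol (lhalf b j) = vol b / 2.
Proof.
rewrite /vol (bigD1 j)//= [in RHS](bigD1 j)//= side_lhalf eqxx mulrAC; congr (_ * _ / _).
by apply: eq_bigr => i ij; rewrite side_lhalf (negbTE ij) divr1.
Qed.

Lemma vol_rhalf b j : vol (rhalf b j) = vol b / 2.
Proof.
rewrite /vol (bigD1 j)//= [in RHS](bigD1 j)//= side_rhalf eqxx mulrAC; congr (_ * _ / _).
by apply: eq_bigr => i ij; rewrite side_rhalf (negbTE ij) divr1.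
Qed.

Lemma vol_gt0 b : proper b -> 0 < vol b.
Proof. by move=> pb; apply: prodr_gt0 => i _; rewrite subr_gt0. Qed.

Lemma measurable_cell b : measurable (cell b).
Proof. exact: measurable_box. Qed.

Lemma cell_measure b : proper b -> mu (cell b) = (vol b)%:E.
Proof. by move=> pb; rewrite box_measure// => i; exact/ltW. Qed.

Lemma cell_lty b : proper b -> (mu (cell b) < +oo)%E.
Proof. by move=> pb; rewrite cell_measure// ltry. Qed.

Lemma in_lhalf b j z : proper b ->
  cell (lhalf b j) z <-> cell b z /\ xcoord j z < center b j.
Proof. by move=> pb; have := lboxE (pb j); rewrite /cell /lhalf /= /lbox -/(center b j) => ->. Qed.

Lemma in_rhalf b j z : proper b ->
  cell (rhalf b j) z <-> cell b z /\ center b j <= xcoord j z.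
Proof. by move=> pb; have := rboxE (pb j); rewrite /cell /rhalf /= /rbox -/(center b j) => ->. Qed.

Lemma cell_halves b j : proper b -> cell b = cell (lhalf b j) `|` cell (rhalf b j).
Proof. by move=> pb; exact: (lboxUrbox (pb j)). Qed.

Lemma disjoint_halves b j : proper b -> [disjoint cell (lhalf b j) & cell (rhalf b j)].
Proof. by move=> pb; exact: (lboxIrbox (pb j)). Qed.

Lemma sub_lhalf b j : proper b -> cell (lhalf b j) `<=` cell b.
Proof. by move=> pb z /in_lhalf -/(_ pb) []. Qed.

Lemma sub_rhalf b j : proper b -> cell (rhalf b j) `<=` cell b.
Proof. by move=> pb z /in_rhalf -/(_ pb) []. Qed.

Lemma Rintegral_halves b j f : proper b -> mu.-integrable (cell b) (EFin \o f) ->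
  \int[mu]_(z in cell b) f z =
  \int[mu]_(z in cell (lhalf b j)) f z + \int[mu]_(z in cell (rhalf b j)) f z.
Proof.
move=> pb intf; rewrite {1}(cell_halves j pb) Rintegral_setU//.
- exact: measurable_cell.
- exact: measurable_cell.
- by rewrite -cell_halves.
- exact: disjoint_halves.
Qed.

Lemma integrable_lhalf b j f : proper b -> mu.-integrable (cell b) (EFin \o f) ->
  mu.-integrable (cell (lhalf b j)) (EFin \o f).
Proof.
by move=> pb; apply: integrableS; [exact: measurable_cell..|exact: sub_lhalf].
Qed.

Lemma integrable_rhalf b j f : proper b -> mu.-integrable (cell b) (EFin \o f) ->
  mu.-integrable (cell (rhalf b j)) (EFin \o f).
Proof.
by move=> pb; apply: integrableS; [exact: measurable_cell..|exact: sub_rhalf].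
Qed.

(* step js F b z is F c z for the cell c containing z in the partition of cell b
   obtained by halving it successively along the directions js. *)
Fixpoint step js (F : bounds -> X -> R) b z : R :=
  if js is j :: js' then
    if xcoord j z < center b j then step js' F (lhalf b j) z
    else step js' F (rhalf b j) z
  else F b z.

Fixpoint leaf js b c : Prop :=
  if js is j :: js' then leaf js' (lhalf b j) c \/ leaf js' (rhalf b j) c else c = b.

Lemma leaf_proper js b c : leaf js b c -> proper b -> proper c.
Proof.
elim: js b => [b ->//|j js IH b [] /IH h pb]; apply: h.
  exact: proper_lhalf.
exact: proper_rhalf.
Qed.

Lemma leaf_side js b c i : leaf js b c -> side c i = side b i / 2 ^+ count_mem i js.
Proof.
elim: js b => [b ->|j js IH b []/= /IH ->]; first by rewrite expr0 divr1.
  rewrite side_lhalf eq_sym; case: eqP => _; rewrite ?add0n ?divr1//.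
  by rewrite add1n exprS; field; rewrite expf_neq0.
rewrite side_rhalf eq_sym; case: eqP => _; rewrite ?add0n ?divr1//.
by rewrite add1n exprS; field; rewrite expf_neq0.
Qed.

Lemma leaf_vol js b c : leaf js b c -> vol c = vol b / 2 ^+ size js.
Proof.
elim: js b => [b ->|j js IH b []/= /IH ->]; first by rewrite expr0 divr1.
  by rewrite vol_lhalf exprS; field; rewrite expf_neq0.
by rewrite vol_rhalf exprS; field; rewrite expf_neq0.
Qed.

Lemma leaf_sub js b c : leaf js b c -> proper b -> cell c `<=` cell b.
Proof.
elim: js b => [b -> _|j js IH b []/= /IH h pb]; first exact: subset_refl.
  by move=> z /(h (proper_lhalf j pb)) /(sub_lhalf pb).
by move=> z /(h (proper_rhalf j pb)) /(sub_rhalf pb).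
Qed.

(** Used in the direction of the edge, where it keeps every cell within [[0, l]], as the estimate on
    the two halves requires. *)
Lemma leaf_inside (a : R) (d : R) js b c i : leaf js b c -> proper b ->
  a <= b.1 i -> b.2 i <= d -> a <= c.1 i /\ c.2 i <= d.
Proof.
elim: js b => [b ->//|j js IH b []/= /IH h]; move=> pb ab bd; apply: h => //.
- exact: proper_lhalf.
- rewrite /= /upd; case: eqP => // ij; apply: le_trans bd.
  by rewrite ij /center /mid; have := pb j; lra.
- exact: proper_rhalf.
- rewrite /= /upd; case: eqP => // ij; apply: (le_trans ab).
  by rewrite ij /center /mid; have := pb j; lra.
Qed.

Lemma step_leaf js F b z : proper b -> cell b z ->
  exists2 c, leaf js b c & cell c z /\ step js F b z = F c z.
Proof.
elim: js b => [|j js IH] b pb bz /=; first by exists b.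
case: ifPn => zj.
  have [|c lc [cz ->]] := IH (lhalf b j) (proper_lhalf j pb).
    exact/in_lhalf.
  by exists c => //; left.
have [|c lc [cz ->]] := IH (rhalf b j) (proper_rhalf j pb).
  by apply/in_rhalf => //; rewrite leNgt.
by exists c => //; right.
Qed.

(** The recursion peels off the coarsest cut, whereas passing from [m] to [m.+1] cuts adds the
    finest one. To express the latter, the function evaluated on the final cells has to depend on
    [z]. *)
Lemma step_rcons js j F b z : step (rcons js j) F b z =
  step js (fun c z => if xcoord j z < center c j then F (lhalf c j) z
                      else F (rhalf c j) z) b z.
Proof. by elim: js b => //= i js IH b; rewrite !IH. Qed.

Lemma stepD js F G b z :
  step js (fun c z => F c z + G c z) b z = step js F b z + step js G b z.
Proof. by elim: js b => //= j js IH b; rewrite !IH; case: ifP. Qed.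

Lemma step_comp (h : R -> R) js F b z :
  h (step js F b z) = step js (fun c z => h (F c z)) b z.
Proof. by elim: js b => //= j js IH b; rewrite -!IH; case: ifP. Qed.

Lemma eq_step js F G b z : (forall c, F c z = G c z) -> step js F b z = step js G b z.
Proof. by move=> FG; elim: js b => //= j js IH b; rewrite !IH. Qed.

Lemma measurable_step js F b : (forall c, measurable_fun [set: X] (F c)) ->
  measurable_fun [set: X] (step js F b).
Proof.
move=> mF; elim: js b => [|j js IH] b; first exact: mF.
apply: measurable_fun_ifT => //.
by apply: measurable_fun_ltr => //; exact: measurable_coordX.
Qed.

Lemma step_ge0 js F b z : (forall c z, 0 <= F c z) -> 0 <= step js F b z.
Proof. by move=> F0; elim: js b => //= j js IH b; case: ifP. Qed.

Lemma step_bounded js (a : bounds -> R) b :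
  exists M, forall z, `|step js (fun c _ => a c) b z| <= M.
Proof.
elim: js b => [|j js IH] b /=; first by exists `|a b|.
have [M1 h1] := IH (lhalf b j); have [M2 h2] := IH (rhalf b j).
by exists (Num.max M1 M2) => z; case: ifP => _; rewrite le_max ?h1 ?h2 ?orbT.
Qed.

(* nu plays the role of a measure, additive under halving. *)
Lemma integral_step_le js (a nu : bounds -> R) b : proper b ->
  (forall c, 0 <= a c) ->
  (forall c j, proper c -> nu (lhalf c j) + nu (rhalf c j) <= nu c) ->
  (forall c, leaf js b c -> a c * vol c <= nu c) ->
  (\int[mu]_(z in cell b) (step js (fun c _ => a c) b z)%:E <= (nu b)%:E)%E.
Proof.
move=> pb a0 nu_add; elim: js b pb => [|j js IH] b pb h /=.
  rewrite integral_cst; last exact: measurable_cell.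
  by rewrite [X in (_ * X)%E](cell_measure pb) -EFinM lee_fin; exact: h.
rewrite (cell_halves j pb) ge0_integral_setU.
- apply: (@le_trans _ _ ((nu (lhalf b j))%:E + (nu (rhalf b j))%:E)%E); last first.
    by rewrite -EFinD lee_fin; exact: nu_add.
  apply: leeD.
    apply: le_trans (IH _ (proper_lhalf j pb) _); last by move=> c lc; apply: h; left.
    under eq_integral => z.
      rewrite inE => /in_lhalf -/(_ pb)[_ ->]; over.
    by [].
  apply: le_trans (IH _ (proper_rhalf j pb) _); last by move=> c lc; apply: h; right.
  under eq_integral => z.
    rewrite inE => /in_rhalf -/(_ pb)[_]; rewrite leNgt => /negbTE ->; over.
  by [].
- exact: measurable_cell.
- exact: measurable_cell.
- apply: measurable_funTS; apply/measurable_EFinP.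
  apply: (@measurable_step (j :: js) (fun c _ => a c)) => c.
  exact: measurable_cst.
- by move=> z _; rewrite lee_fin; case: ifP => _; exact: step_ge0.
- exact: disjoint_halves.
Qed.

End dyadic.

(** * Averages over the cells and their increments *)

Section averages.
Context {R : realType} {N : nat}.
Local Notation X := ('rV[R]_N * R)%type.
Local Notation mu := (lebesgue_strip N).
Local Notation bounds := ((option 'I_N -> R) * (option 'I_N -> R))%type.
Implicit Types (b c : bounds) (i j : option 'I_N) (z : X) (js : seq (option 'I_N)).
Implicit Types (f g w : X -> R).

Lemma eq_step_leaf js (F G : bounds -> X -> R) b z :
  (forall c, leaf js b c -> F c z = G c z) -> step js F b z = step js G b z.
Proof.
elim: js b => [b h|j js IH b h] /=; first exact: h.
by rewrite !IH// => c lc; apply: h; [right|left].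
Qed.

Lemma integrable_leaf js b c f : proper b -> leaf js b c ->
  mu.-integrable (cell b) (EFin \o f) -> mu.-integrable (cell c) (EFin \o f).
Proof.
by move=> pb lc; apply: integrableS; [exact: measurable_cell..|exact: leaf_sub lc pb].
Qed.

Definition avg w c : R := (\int[mu]_(z in cell c) w z) / vol c.

Definition condexp js w b z : R := step js (fun c _ => avg w c) b z.

(** A Haar coefficient: the average over the left half minus the average over [c], each half having
    half the volume. On the right half the difference is the opposite. *)
Definition jump w c j : R :=
  (\int[mu]_(z in cell (lhalf c j)) w z - \int[mu]_(z in cell (rhalf c j)) w z) / vol c.

Definition incr js j w b z : R :=
  step js (fun c z => if xcoord j z < center c j then jump w c j else - jump w c j) b z.

Lemma condexp_rcons js j w b z : proper b -> mu.-integrable (cell b) (EFin \o w) ->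
  condexp (rcons js j) w b z = condexp js w b z + incr js j w b z.
Proof.
move=> pb intw; rewrite /condexp step_rcons -stepD; apply: eq_step_leaf => c lc.
have pc := leaf_proper lc pb; have v0 := vol_gt0 pc.
have vn0 : vol c != 0 by rewrite gt_eqF.
rewrite /avg (Rintegral_halves j pc (integrable_leaf pb lc intw)) /jump.
rewrite vol_lhalf vol_rhalf; set I := Rintegral _ _ _; set J := Rintegral _ _ _.
by case: ifP => _; field.
Qed.

(** Squaring removes the sign, hence the dependence on [z] within a cell, so that the bounds for
    functions constant on the cells apply. *)
Lemma incr_sqr js j w b z :
  incr js j w b z ^+ 2 = step js (fun c _ => jump w c j ^+ 2) b z.
Proof.
rewrite /incr (step_comp (fun x => x ^+ 2)); apply: eq_step => c.
by case: ifP => _; rewrite ?sqrrN.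
Qed.

Lemma measurable_condexp js w b : measurable_fun [set: X] (condexp js w b).
Proof. by apply: measurable_step => c; exact: measurable_cst. Qed.

Lemma measurable_incr js j w b : measurable_fun [set: X] (incr js j w b).
Proof.
apply: measurable_step => c; apply: measurable_fun_ifT; last 2 first.
- exact: measurable_cst.
- exact: measurable_cst.
by apply: measurable_fun_ltr => //; exact: measurable_coordX.
Qed.

Lemma leaf_le js b c (nu : bounds -> R) : proper b -> (forall c, 0 <= nu c) ->
  (forall c j, proper c -> nu (lhalf c j) + nu (rhalf c j) <= nu c) ->
  leaf js b c -> nu c <= nu b.
Proof.
move=> pb nu0 nu_add; elim: js b pb => [b pb /= -> //|j js IH b pb /= [] h].
  apply: le_trans (IH _ (proper_lhalf j pb) h) _; apply: le_trans (nu_add _ j pb).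
  by rewrite lerDl.
apply: le_trans (IH _ (proper_rhalf j pb) h) _; apply: le_trans (nu_add _ j pb).
by rewrite lerDr.
Qed.

(** The bounds on single cells add up to the L^2 bound by superadditivity of [nu]. For the sup bound
    a single cell only gives [nu c <= nu b], and dividing by [vol c] costs [2 ^+ size js]. The role
    of [nu] is played by the integral of [w ^+ 2] and by a multiple of that of the squared
    derivative. *)
Lemma incr_bounds js j w b (nu : bounds -> R) : proper b ->
  (forall c, 0 <= nu c) ->
  (forall c j, proper c -> nu (lhalf c j) + nu (rhalf c j) <= nu c) ->
  (forall c, leaf js b c -> jump w c j ^+ 2 * vol c <= nu c) ->
  (\int[mu]_(z in cell b) (incr js j w b z ^+ 2)%:E <= (nu b)%:E)%E /\
  (forall z, cell b z -> incr js j w b z ^+ 2 <= 2 ^+ size js / vol b * nu b).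
Proof.
move=> pb nu0 nu_add h; split.
  under eq_integral do rewrite incr_sqr.
  by apply: integral_step_le => // c; exact: sqr_ge0.
move=> z bz; rewrite incr_sqr.
have [c lc [cz ->]] := step_leaf js (fun c _ => jump w c j ^+ 2) pb bz.
have pc := leaf_proper lc pb.
have -> : 2 ^+ size js / vol b = (vol c)^-1.
  by rewrite (leaf_vol lc) invfM invrK mulrC.
rewrite mulrC ler_pdivlMr ?vol_gt0//; apply: le_trans (h _ lc) _.
exact: leaf_le lc.
Qed.

Lemma Rintegral_sqr_halves w c j : sqint mu w -> proper c ->
  \int[mu]_(z in cell (lhalf c j)) (w z ^+ 2) +
  \int[mu]_(z in cell (rhalf c j)) (w z ^+ 2) = \int[mu]_(z in cell c) (w z ^+ 2).
Proof.
move=> sw pc; rewrite -Rintegral_halves//.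
exact: (sqint_sqr_integrable (measurable_cell c) sw).
Qed.

Lemma jump_self w c j : sqint mu w -> proper c ->
  jump w c j ^+ 2 * vol c <= \int[mu]_(z in cell c) (w z ^+ 2).
Proof.
move=> sw pc; have v0 := vol_gt0 pc.
have iw := sqint_integrable (measurable_cell c) (cell_lty pc) sw.
have := sqr_Rintegral_le (measurable_cell c) (cell_lty pc) sw.
rewrite [X in fine X](cell_measure pc) /= (Rintegral_halves j pc (integrable_norm iw)).
have hL := le_normr_Rintegral (measurable_cell _) (integrable_lhalf j pc iw).
have hR := le_normr_Rintegral (measurable_cell _) (integrable_rhalf j pc iw).
rewrite /jump; move: hL hR.
set I := Rintegral _ _ _; set J := Rintegral _ _ _; set I' := Rintegral _ _ _.
set J' := Rintegral _ _ _; set K := Rintegral _ _ _ => hL hR hK.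
have vn0 : vol c != 0 by rewrite gt_eqF.
have -> : ((I - I') / vol c) ^+ 2 * vol c = (I - I') ^+ 2 / vol c by field.
rewrite ler_pdivrMr// mulrC; apply: le_trans hK.
have J0 : 0 <= J := le_trans (normr_ge0 _) hL.
have J'0 : 0 <= J' := le_trans (normr_ge0 _) hR.
rewrite -[leLHS]real_normK ?num_real// lerXn2r ?nnegrE ?addr_ge0//.
by apply: le_trans (ler_normB _ _) _; exact: lerD.
Qed.

Lemma jump_grad w g c j : sqint mu g -> proper c ->
  `|\int[mu]_(z in cell (lhalf c j)) w z - \int[mu]_(z in cell (rhalf c j)) w z|
    <= side c j / 2 * \int[mu]_(z in cell c) `|g z| ->
  jump w c j ^+ 2 * vol c <= (side c j / 2) ^+ 2 * \int[mu]_(z in cell c) (g z ^+ 2).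
Proof.
move=> sg pc; have v0 := vol_gt0 pc.
have := sqr_Rintegral_le (measurable_cell c) (cell_lty pc) sg.
rewrite [X in fine X](cell_measure pc) /= /jump.
set I := Rintegral _ _ _; set J := Rintegral _ _ _; set I' := Rintegral _ _ _.
set K := Rintegral _ _ _ => hK h.
have vn0 : vol c != 0 by rewrite gt_eqF.
have -> : ((I' - K) / vol c) ^+ 2 * vol c = (I' - K) ^+ 2 / vol c by field.
rewrite ler_pdivrMr//.
apply: (@le_trans _ _ ((side c j / 2 * I) ^+ 2)).
  by rewrite -[leLHS]real_normK ?num_real// lerXn2r ?nnegrE// (le_trans _ h).
by rewrite [leLHS]exprMn -[leRHS]mulrA ler_wpM2l ?sqr_ge0// [leRHS]mulrC.
Qed.

End averages.

(** * The cyclic order of the cuts and the decay of the sides *)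

Section directions.
Context {N : nat}.

(** There are [N.+1] directions, so the default value of [nth] is never reached. *)
Definition dirn (k : nat) : option 'I_N := nth None (enum {: option 'I_N}) (k %% N.+1).
Definition dirs (m : nat) : seq (option 'I_N) := mkseq dirn m.

Lemma count_dirs i m : (m %/ N.+1 <= count_mem i (dirs m))%N.
Proof.
have sz : size (enum {: option 'I_N}) = N.+1 by rewrite -cardE card_option card_ord.
(* A full period, which contains every direction, can be split off at the head. *)
have dirsD k : dirs (N.+1 + k) = enum {: option 'I_N} ++ dirs k.
  rewrite /dirs /mkseq iotaD map_cat; congr (_ ++ _).
    apply: (@eq_from_nth _ None); first by rewrite size_map size_iota sz.
    move=> n; rewrite size_map size_iota => nN.
    by rewrite (nth_map 0%N) ?size_iota// nth_iota// /dirn modn_small.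
  rewrite add0n -[X in iota X _]addn0 iotaDl -map_comp.
  by apply: eq_map => n /=; rewrite /dirn modnDl.
elim/ltn_ind: m => m IH.
have [mN|mN] := ltnP m N.+1; first by rewrite divn_small.
rewrite -(subnKC mN) dirsD count_cat divnDl// divnn/=.
rewrite leq_add//; last by apply: IH; rewrite ltn_subrL /= (leq_trans _ mN).
by rewrite -has_count has_pred1 mem_enum.
Qed.

Lemma size_dirs m : size (dirs m) = m.
Proof. exact: size_mkseq. Qed.

Lemma dirsS m : dirs m.+1 = rcons (dirs m) (dirn m).
Proof. exact: mkseqS. Qed.

End directions.

Section halving_rate.
Context {R : realType} {N : nat}.

(* The side lengths of the cells are multiplied by rho at each halving, on average. *)
Definition rho : R := 2 `^ (- N.+1%:R^-1).

Lemma rho_gt0 : 0 < rho.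
Proof. exact: powR_gt0. Qed.

Lemma rho_lt1 : rho < 1.
Proof.
rewrite -(@powRr0 R 2) /rho /powR pnatr_eq0 /= mul0r ltr_expR.
by rewrite mulNr oppr_lt0 mulr_gt0 ?invr_gt0// ln_gt0// ltr1n.
Qed.

Lemma rhoX (m : nat) : rho ^+ m = 2 `^ (- (m%:R / N.+1%:R)).
Proof. by rewrite -powR_mulrn ?ltW ?rho_gt0// -powRrM mulNr mulrC. Qed.

(** In [m] cuts each direction is met at least [m %/ N.+1] times. The additional factor 1/2 is that
    of the tent height, half a side: it makes up for the rounding, so that no constant is lost. *)
Lemma half_pow_le_rho (m : nat) : (2 ^+ (m %/ N.+1).+1)^-1 <= rho ^+ m.
Proof.
rewrite rhoX -powR_mulrn// -powRN ler_powR ?ler1n//.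
rewrite lerN2 ler_pdivrMr// -natrM ler_nat.
by rewrite mulnC -ltnS; apply: leq_trans (ltn_ceil m (ltn0Sn N)) _; rewrite mulnC.
Qed.

End halving_rate.

(** * Convergence of the averages *)

Section orthants.
Context {R : realType} {N : nat}.
Local Notation X := ('rV[R]_N * R)%type.
Local Notation mu := (lebesgue_strip N).
Implicit Types (i j : option 'I_N) (z : X) (a : option 'I_N -> R).

Definition orthant a : set X := [set z | forall i, xcoord i z < a i].
Definition orthants : set (set X) := [set orthant a | a in setT].

Lemma measurable_orthant a : measurable (orthant a).
Proof.
rewrite [X in measurable X](_ : _ = \bigcap_(j in [set: option 'I_N])
    [set z | `]-oo, a j[%classic (xcoord j z)]).
  apply: fin_bigcap_measurable => [|j _]; first exact: finite_finset.
  exact: measurable_coord_pre.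
by apply/seteqP; split => z bz j => [_|]; have := bz j; rewrite /= in_itv /=//; apply.
Qed.

Lemma setI_closed_orthants : setI_closed orthants.
Proof.
move=> _ _ [a _ <-] [c _ <-]; exists (fun i => Num.min (a i) (c i)) => //.
apply/seteqP; split => z /=.
  by move=> h; split => i; have := h i; rewrite lt_min => /andP[].
by move=> [h1 h2] i; rewrite lt_min h1 h2.
Qed.

(** The half-space of points with [xcoord i z < x] is a countable union of orthants, the other
    bounds being sent to infinity. Hence the coordinates, and with them the identity, are measurable
    from the sigma-algebra generated by the orthants. *)
Lemma orthants_generate (E : set X) : measurable E -> <<s orthants >> E.
Proof.
move=> mE; pose T := g_sigma_algebraType orthants.
have morth a : measurable (orthant a : set T) by apply: sub_sigma_algebra; exists a.
have mcoord i : measurable_fun [set: T] (fun z : T => xcoord i (z : X)).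
  apply: (measurability _ (RGenInftyO.measurableE R)).
  move=> _ [_ [x ->] <-]; rewrite setTI.
  rewrite (_ : _ @^-1` _ =
    \bigcup_n (orthant (fun k => if k == i then x else n%:R) : set T)).
    by apply: bigcup_measurable => n _; exact: morth.
  apply/seteqP; split => z /=.
    rewrite in_itv /= => zx.
    have [n Hn] : exists n : nat, forall k, xcoord k z < n%:R.
      exists (\max_k (Num.truncn `|xcoord k z|).+1)%N => k.
      apply: le_lt_trans (ler_norm _) _; apply: lt_le_trans (truncnS_gt _) _.
      by rewrite ler_nat; exact: (@leq_bigmax _ (fun k => (Num.truncn `|xcoord k z|).+1)).
    by exists n => // k; case: eqP => [->|].
  by move=> [n _] /(_ i); rewrite eqxx in_itv.
have mid : measurable_fun [set: T] (fun z : T => (z : X)).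
  rewrite (_ : (fun z : T => (z : X)) = (fun z : T => ((z : X).1, (z : X).2))).
    apply: measurable_fun_pair; last exact: (mcoord None).
    by apply: measurable_rVP => i; exact: (mcoord (Some i)).
  by apply/funext => -[].
by have := mid measurableT E mE; rewrite setTI.
Qed.

(** Dynkin's argument: orthants are stable under intersection and generate the measurable sets, and
    the sets [E] over which the integral of [u] on [K]&[E] vanishes form a lambda-system. *)
Lemma ae_eq0_orthants (K : set X) (u : X -> R) : measurable K ->
  mu.-integrable K (EFin \o u) ->
  (forall a, \int[mu]_(z in K `&` orthant a) u z = 0) ->
  ae_eq mu K (EFin \o u) (cst 0%E).
Proof.
move=> mK iu u0.
have iuI E : measurable E -> mu.-integrable (K `&` E) (EFin \o u).
  by move=> mE; apply: integrableS iu => //; exact: measurableI.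
pose H : set (set X) := [set E | measurable E /\ \int[mu]_(z in K `&` E) u z = 0].
have Hnd : ndseq_closed H.
  move=> F ndF HF; split; first by apply: bigcup_measurable => n _; case: (HF n).
  have mF n : measurable (F n) by case: (HF n).
  have : (fun n => \int[mu]_(z in K `&` F n) u z) @ \oo -->
      \int[mu]_(z in K `&` \bigcup_n F n) u z.
    rewrite Rintegral_mkcondr.
    have -> : (fun n => \int[mu]_(z in K `&` F n) u z) =
        (fun n => \int[mu]_(z in K) (u \_ (F n)) z).
      by apply/funext => n; rewrite Rintegral_mkcondr.
    have mU : measurable (\bigcup_n F n) by apply: bigcup_measurable.
    have ir E : measurable E -> mu.-integrable K (EFin \o (u \_ E)).
      move=> mE; apply: (le_integrable mK _ _ iu).
        apply/measurable_EFinP; apply/(measurable_restrict _ mE mK).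
        by apply/measurable_EFinP; case/integrableP: (iuI _ mE).
      move=> z _ /=; rewrite lee_fin /patch; case: ifP => _ //.
      by rewrite (_ : point = 0 :> R)// normr0.
    apply: (@fine_cvg _ _ \oo _ (fun n => \int[mu]_(z in K) ((u \_ (F n)) z)%:E)%E).
    rewrite fineK; last by apply: integrable_fin_num => //; exact: ir.
    have [] := @dominated_convergence _ X R mu K mK
      (fun n z => ((u \_ (F n)) z)%:E) (fun z => ((u \_ (\bigcup_n F n)) z)%:E)
      (fun z => `|u z|%:E).
    - by move=> n; case/integrableP: (ir _ (mF n)).
    - by case/integrableP: (ir _ mU).
    - apply: aeW => z Kz; apply: cvg_EFin; first exact: nearW.
      have [[n _ Fnz]|nF] := pselect ((\bigcup_n F n) z).
        apply: cvg_near_cst; exists n => // k /= nk; rewrite /patch !mem_set//.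
          by exists n.
        by have /subsetPset h := ndF _ _ nk; exact: h.
      apply: cvg_near_cst; apply: nearW => k; rewrite /= /patch !memNset// => Fk.
      by apply: nF; exists k.
    - exact: integrable_norm iu.
    - apply: aeW => z n _ /=; rewrite lee_fin /patch; case: ifP => // _.
      by rewrite (_ : point = 0 :> R)// normr0.
    by [].
  rewrite (_ : (fun n => _) = cst 0); last by apply/funext => n; case: (HF n).
  by move=> h; apply/esym; exact: (cvg_unique _ (cvg_cst _) h).
have HT : H setT.
  (* The whole space is an increasing union of orthants. *)
  rewrite (_ : setT = \bigcup_n orthant (fun=> n%:R)).
    apply: Hnd; last by move=> n; split; [exact: measurable_orthant|exact: u0].
    move=> n k nk; apply/subsetPset => z zn i.
    by apply: lt_le_trans (zn i) _; rewrite ler_nat.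
  apply/seteqP; split => // z _.
  exists (\max_k (Num.truncn `|xcoord k z|).+1)%N => // k.
  apply: le_lt_trans (ler_norm _) _; apply: lt_le_trans (truncnS_gt _) _.
  by rewrite ler_nat; exact: (@leq_bigmax _ (fun k => (Num.truncn `|xcoord k z|).+1)).
have HD : setSD_closed H.
  move=> P Q QP [mP P0] [mQ Q0]; split; first exact: measurableD.
  have : \int[mu]_(z in K `&` P) u z =
      \int[mu]_(z in K `&` (P `\` Q)) u z + \int[mu]_(z in K `&` Q) u z.
    rewrite -Rintegral_setU; first by rewrite -setIUr setDKU.
    - by apply: measurableI => //; exact: measurableD.
    - exact: measurableI.
    - by rewrite -setIUr setDKU//; exact: iuI.
    - by apply/disj_setPS => z /= [[_ [_ nQ]] [_ ?]].
  by rewrite P0 Q0 addr0 => <-.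
have Hall E : measurable E -> \int[mu]_(z in K `&` E) u z = 0.
  move=> mE; suff [] : H E by [].
  apply: (lambda_system_subset setI_closed_orthants _ _ _ (orthants_generate mE)) => //.
  by move=> _ [a _ <-]; split; [exact: measurable_orthant|exact: u0].
apply: integral_ae_eq => // E EK mE.
rewrite integral_cst// mul0e.
have := Hall E mE; rewrite (setIidr EK) /Rintegral => /eqP.
rewrite fine_eq0; first by move/eqP.
by apply: integrable_fin_num => //; exact: integrableS iu.
Qed.

End orthants.

Section convergence.
Context {R : realType} {N : nat}.
Local Notation X := ('rV[R]_N * R)%type.
Local Notation mu := (lebesgue_strip N).
Local Notation bounds := ((option 'I_N -> R) * (option 'I_N -> R))%type.
Implicit Types (b c : bounds) (i j : option 'I_N) (z : X) (m : nat) (f g w : X -> R).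

Lemma integrable_condexpM js f g b : proper b ->
  mu.-integrable (cell b) (EFin \o f) ->
  mu.-integrable (cell b) (EFin \o (fun z => f z * condexp js g b z)).
Proof.
move=> pb intf; have [M hM] := step_bounded js (avg g) b.
have mb := measurable_cell b.
apply: (le_integrable mb _ _ (integrableZl mb M intf)).
  apply/measurable_EFinP/measurable_funM.
    by apply/measurable_EFinP; case/integrableP: intf.
  by apply: measurable_funTS; exact: measurable_condexp.
move=> z _ /=; rewrite lee_fin !normrM mulrC ler_wpM2r//.
exact: le_trans (hM z) (ler_norm _).
Qed.

Lemma condexp_sym js f g b : proper b ->
  mu.-integrable (cell b) (EFin \o f) -> mu.-integrable (cell b) (EFin \o g) ->
  \int[mu]_(z in cell b) (f z * condexp js g b z) =
  \int[mu]_(z in cell b) (g z * condexp js f b z).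
Proof.
elim: js b => [|j js IH] b pb intf intg.
  rewrite /condexp /= !RintegralZr//; try exact: measurable_cell.
  by rewrite /avg; ring.
have half f' g' : mu.-integrable (cell b) (EFin \o f') ->
    \int[mu]_(z in cell b) (f' z * condexp (j :: js) g' b z) =
    \int[mu]_(z in cell (lhalf b j)) (f' z * condexp js g' (lhalf b j) z) +
    \int[mu]_(z in cell (rhalf b j)) (f' z * condexp js g' (rhalf b j) z).
  move=> intf'; rewrite (Rintegral_halves j pb); last exact: integrable_condexpM.
  congr (_ + _); apply: eq_Rintegral => z; rewrite inE.
    by move/in_lhalf => /(_ pb)[_ zj]; rewrite /condexp /= zj.
  by move/in_rhalf => /(_ pb)[_]; rewrite leNgt => /negbTE zj; rewrite /condexp /= zj.
have pl := proper_lhalf j pb; have pr := proper_rhalf j pb.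
have lf := integrable_lhalf j pb intf; have lg := integrable_lhalf j pb intg.
have rf := integrable_rhalf j pb intf; have rg := integrable_rhalf j pb intg.
rewrite (half f g intf) (half g f intg).
by rewrite -(IH _ pl lf lg) -(IH _ pr rf rg).
Qed.

(** The factor 2 pays for the last, incomplete cycle of cuts. *)
Lemma leaf_dirs_side b m c i (ell : R) : proper b -> (forall i, side b i <= ell) ->
  leaf (dirs m) b c -> side c i <= 2 * ell * @rho R N ^+ m.
Proof.
move=> pb side_b lc; rewrite (leaf_side i lc).
have s0 : 0 <= side b i by rewrite subr_ge0 ltW.
have h := @half_pow_le_rho R N m.
rewrite -mulrA mulrCA ler_pM ?invr_ge0 ?exprn_ge0//.
apply: (@le_trans _ _ (2 * (2 ^+ (m %/ N.+1).+1)^-1)); last by rewrite ler_pM2l.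
rewrite exprS invfM mulrA divff// mul1r lef_pV2 ?posrE ?exprn_gt0//.
by rewrite ler_eXn2l ?ltr1n// count_dirs.
Qed.

(** As soon as the sides are smaller than the distances from [z] to the hyperplanes bounding the
    orthant, the cell of [z] lies on one side of each, and the average of the indicator is exactly
    its value at [z]. For orthants this elementary fact stands in for the Lebesgue differentiation
    theorem. *)
Lemma condexp_orthant b (ell : R) a z : proper b -> (forall i, side b i <= ell) ->
  cell b z -> (forall i, xcoord i z != a i) ->
  \forall m \near \oo, condexp (dirs m) (\1_(orthant a)) b z = \1_(orthant a) z.
Proof.
move=> pb side_b bz za.
have ell0 : 0 < ell by apply: lt_le_trans (side_b None); rewrite subr_gt0.
have small i : \forall m \near \oo, 2 * ell * @rho R N ^+ m < `|xcoord i z - a i|.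
  have : (fun m => 2 * ell * @rho R N ^+ m) @ \oo --> (2 * ell * 0 : R).
    apply: cvgM; first exact: cvg_cst.
    by apply: cvg_expr; rewrite ger0_norm ?(@rho_lt1 R N)// ltW// (@rho_gt0 R N).
  rewrite mulr0 => /cvgr_lt; apply.
  by rewrite normr_gt0 subr_eq0.
have : \forall m \near \oo, forall i, 2 * ell * @rho R N ^+ m < `|xcoord i z - a i|.
  by apply: filter_forall.
apply: filterS => m hm.
have [c lc [cz]] := step_leaf (dirs m) (fun c _ => avg (\1_(orthant a)) c) pb bz.
rewrite /condexp => ->.
have pc := leaf_proper lc pb.
have same y : cell c y -> \1_(orthant a) y = \1_(orthant a) z :> R.
  move=> cy; rewrite !indicE; congr (_ %:R); congr nat_of_bool.
  have close i : `|xcoord i y - xcoord i z| < `|xcoord i z - a i|.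
    apply: lt_trans (hm i); apply: lt_le_trans (leaf_dirs_side i pb side_b lc).
    have /andP[? ?] := cy i; have /andP[? ?] := cz i.
    by rewrite /side ltr_norml; apply/andP; split; lra.
  apply/idP/idP; rewrite !inE => h i; have hi := h i; have := close i.
    case: (ltP (xcoord i z) (a i)) => // hz.
    have -> : `|xcoord i z - a i| = xcoord i z - a i by rewrite ger0_norm ?subr_ge0.
    by rewrite ltr_norml => /andP[? ?]; lra.
  case: (ltP (xcoord i y) (a i)) => // hy.
  have -> : `|xcoord i z - a i| = a i - xcoord i z by rewrite ltr0_norm ?subr_lt0// opprB.
  by rewrite ltr_norml => /andP[? ?]; lra.
have -> : avg (\1_(orthant a)) c =
    \int[mu]_(y in cell c) (cst (\1_(orthant a) z : R)) y / vol c.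
  by congr (_ / _); apply: eq_Rintegral => y; rewrite inE => /same.
rewrite Rintegral_cst; last exact: measurable_cell.
by rewrite [X in fine X](cell_measure pc)/= mulfK// gt_eqF// vol_gt0.
Qed.


Lemma geometric_sum_le (q : R) n : 0 <= q < 1 ->
  \sum_(0 <= k < n) q ^+ k <= (1 - q)^-1.
Proof.
move=> /andP[q0 q1]; have q10 : 0 < 1 - q by rewrite subr_gt0.
have -> : \sum_(0 <= k < n) q ^+ k = (1 - q ^+ n) / (1 - q).
  elim: n => [|n IH]; first by rewrite big_geq// subrr mul0r.
  by rewrite big_nat_recr//= IH exprS; field; rewrite gt_eqF.
by rewrite ler_piMl ?invr_ge0 ?(ltW q10)// gerBl exprn_ge0.
Qed.

Section approx_cvg.
Variables (w : X -> R) (b : bounds) (ell C q : R).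
Hypothesis pb : proper b.
Hypothesis iw : mu.-integrable (cell b) (EFin \o w).
Hypothesis side_b : forall i, side b i <= ell.
Hypothesis q01 : 0 <= q < 1.
Hypothesis C0 : 0 <= C.
Let f m z := incr (dirs m) (dirn m) w b z.
Let E m z := condexp (dirs m) w b z.
Hypothesis intf : forall m,
  (\int[mu]_(z in cell b) `|f m z|%:E <= (C * q ^+ m)%:E)%E.

Let mb : measurable (cell b). Proof. exact: measurable_cell. Qed.
Let mE m : measurable_fun [set: X] (E m). Proof. exact: measurable_condexp. Qed.
Let mf m : measurable_fun [set: X] (f m). Proof. exact: measurable_incr. Qed.

Let T z : \bar R := (\sum_(0 <= m <oo) `|f m z|%:E)%E.

Let mabs m : measurable_fun [set: X] (fun z => `|f m z|%:E).
Proof. by apply/measurable_EFinP; exact: measurableT_comp. Qed.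

Let mT : measurable_fun [set: X] T.
Proof. by apply: ge0_emeasurable_sum => // k z _ _; rewrite lee_fin. Qed.

Let T0 z : (0 <= T z)%E.
Proof. by apply: nneseries_ge0 => k _ _; rewrite lee_fin. Qed.

Let iT : mu.-integrable (cell b) T.
Proof.
apply/integrableP; split; first exact: measurable_funTS.
under eq_integral do rewrite gee0_abs//.
rewrite integral_nneseries//=; last by move=> n; exact: measurable_funTS.
apply: (@le_lt_trans _ _ (C * (1 - q)^-1)%:E); last exact: ltry.
apply: lime_le.
  by apply: is_cvg_nneseries => n _ _; apply: integral_ge0 => z _; rewrite lee_fin.
apply: nearW => n; apply: (@le_trans _ _ (\sum_(0 <= k < n) (C * q ^+ k)%:E)%E).
  by apply: lee_sum => k _; exact: intf.
by rewrite sumEFin -mulr_sumr lee_fin ler_wpM2l// geometric_sum_le.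
Qed.

Let E_sum m z : E m z = E 0 z + \sum_(0 <= k < m) f k z.
Proof.
elim: m => [|m IH]; first by rewrite big_geq// addr0.
by rewrite big_nat_recr//= addrA -IH /E dirsS condexp_rcons.
Qed.

Let E_le m z : (`|E m z|%:E <= `|E 0 z|%:E + T z)%E.
Proof.
apply: (@le_trans _ _ (`|E 0 z| + \sum_(0 <= k < m) `|f k z|)%:E).
  by rewrite lee_fin E_sum (le_trans (ler_normD _ _))// lerD2l ler_norm_sum.
rewrite EFinD leeD2l// -sumEFin; apply: nneseries_lim_ge => k _ _.
by rewrite lee_fin.
Qed.

Let E_cvg z : (T z < +oo)%E -> cvgn (E ^~ z).
Proof.
move=> Tz; have -> : E ^~ z = (fun m => E 0 z + series (f ^~ z) m).
  by apply/funext => m; rewrite E_sum.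
apply: is_cvgD; first exact: is_cvg_cst.
apply: normed_cvg; apply: nondecreasing_is_cvgn.
  apply: nondecreasing_series => k _ _ /=; exact: normr_ge0.
exists (fine (T z)) => _ [m _ <-] /=.
rewrite -lee_fin fineK ?ge0_fin_numE// /series /= -sumEFin.
by apply: nneseries_lim_ge => k _ _; rewrite lee_fin.
Qed.

(** Cut off where [T] is infinite, so that the limit exists at every point and [v] is measurable. *)
Let Eh m z : R := E m z * (if (T z < +oo)%E then 1 else 0).
Let v z : R := limn (Eh ^~ z).

Let Eh_cvg z : Eh m z @[m --> \oo] --> v z.
Proof.
rewrite /v /Eh; case: ifPn => [Tz|_].
  under eq_fun do rewrite mulr1.
  exact: E_cvg.
by under eq_fun do rewrite mulr0; exact: is_cvg_cst.
Qed.

Let mv : measurable_fun [set: X] v.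
Proof.
apply: (@measurable_fun_cvg _ _ _ _ Eh) => [m|z _]; last exact: Eh_cvg.
apply: measurable_funM => //; apply: measurable_fun_ifT => //.
exact: measurable_fun_lte.
Qed.

Let T_fin : {ae mu, forall z, cell b z -> T z \is a fin_num}.
Proof. exact: integrable_ae iT. Qed.

Let E_cvg_ae : {ae mu, forall z, cell b z -> E m z @[m --> \oo] --> v z}.
Proof.
apply: filterS T_fin => z Tz bz; have {}Tz := Tz bz.
have : Eh m z @[m --> \oo] --> v z by exact: Eh_cvg.
rewrite {1}/Eh -ge0_fin_numE// Tz.
by under eq_fun do rewrite mulr1.
Qed.

Let G z : \bar R := (`|E 0 z|%:E + T z)%E.

Let iG : mu.-integrable (cell b) G.
Proof.
apply: integrableD => //; apply: integrable_norm.
have [M hM] := step_bounded (dirs 0) (avg w) b.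
apply: (le_integrable mb _ _ (integrable_cst_lty M mb (cell_lty pb))).
  by apply/measurable_EFinP; exact: measurable_funTS.
by move=> z _ /=; rewrite lee_fin (le_trans (hM z))// ler_norm.
Qed.

Let iv : mu.-integrable (cell b) (EFin \o v).
Proof.
have [] := @dominated_convergence _ X R mu _ mb (fun m z => (E m z)%:E) (EFin \o v) G.
- by move=> m; apply/measurable_EFinP; exact: measurable_funTS.
- by apply/measurable_EFinP; exact: measurable_funTS.
- apply: filterS E_cvg_ae => z Ez bz; apply: cvg_EFin; first exact: nearW.
  exact: Ez.
- exact: iG.
- by apply: aeW => z m _; exact: E_le.
by [].
Qed.

Let m1 a : measurable_fun [set: X] (\1_(orthant a) : X -> R).
Proof. by apply: measurable_indic; exact: measurable_orthant. Qed.

Let integrable_orthantM a (g : X -> R) : mu.-integrable (cell b) (EFin \o g) ->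
  mu.-integrable (cell b) (EFin \o (fun z => g z * \1_(orthant a) z)).
Proof.
move=> ig; apply: (le_integrable mb _ _ ig).
  apply/measurable_EFinP/measurable_funM.
    by apply/measurable_EFinP; case/integrableP: ig.
  exact: measurable_funTS.
move=> z _ /=; rewrite lee_fin normrM ler_piMr// indicE.
by case: (_ \in _); rewrite ?normr0 ?normr1.
Qed.

Let cvg_Ev a :
  \int[mu]_(z in cell b) (E m z * \1_(orthant a) z) @[m --> \oo] -->
  \int[mu]_(z in cell b) (v z * \1_(orthant a) z).
Proof.
apply: (@fine_cvg _ _ \oo _ (fun m => \int[mu]_(z in cell b) (E m z * \1_(orthant a) z)%:E)%E).
rewrite fineK; last first.
  by apply: integrable_fin_num => //; apply: integrable_orthantM; exact: iv.
have [] := @dominated_convergence _ X R mu _ mb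
  (fun m z => (E m z * \1_(orthant a) z)%:E) (fun z => (v z * \1_(orthant a) z)%:E) G.
- by move=> m; apply/measurable_EFinP/measurable_funTS/measurable_funM.
- apply/measurable_EFinP/measurable_funTS; exact: measurable_funM.
- apply: filterS E_cvg_ae => z Ez bz; apply: cvg_EFin; first exact: nearW.
  by apply: cvgM; [exact: Ez|exact: cvg_cst].
- exact: iG.
- apply: aeW => z m _; apply: le_trans (E_le m z).
  rewrite abse_EFin lee_fin normrM ler_piMr// indicE.
  by case: (_ \in _); rewrite ?normr0 ?normr1.
by [].
Qed.

Let cvg_Ew a :
  \int[mu]_(z in cell b) (w z * condexp (dirs m) (\1_(orthant a)) b z) @[m --> \oo] -->
  \int[mu]_(z in cell b) (w z * \1_(orthant a) z).
Proof.
apply: (@fine_cvg _ _ \oo _ (fun m => \int[mu]_(z in cell b)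
  (w z * condexp (dirs m) (\1_(orthant a)) b z)%:E)%E).
rewrite fineK; last by apply: integrable_fin_num => //; exact: integrable_orthantM.
have mw : measurable_fun (cell b) w by apply/measurable_EFinP; case/integrableP: iw.
have m1b : measurable_fun (cell b) (\1_(orthant a) : X -> R) by exact: measurable_funTS.
have [] := @dominated_convergence _ X R mu _ mb
  (fun m z => (w z * condexp (dirs m) (\1_(orthant a)) b z)%:E)
  (fun z => (w z * \1_(orthant a) z)%:E) (fun z => `|w z|%:E).
- move=> m; apply/measurable_EFinP/measurable_funM => //.
  by apply: measurable_funTS; exact: measurable_condexp.
- by apply/measurable_EFinP/measurable_funM.
- apply: filterS (@negligible_hyperplanes R N a) => z za bz.
  apply: cvg_EFin; first exact: nearW.
  apply: cvgM; first exact: cvg_cst.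
  apply: cvg_near_cst; exact: condexp_orthant side_b bz za.
- exact: integrable_norm iw.
- apply: aeW => z m bz /=; rewrite lee_fin normrM ler_piMr//.
  have [c lc [cz]] := step_leaf (dirs m) (fun c _ => avg (\1_(orthant a)) c) pb bz.
  rewrite /condexp => ->; have pc := leaf_proper lc pb.
  rewrite /avg normrM ger0_norm; last by apply: Rintegral_ge0 => y _; rewrite indicE.
  rewrite normfV gtr0_norm ?vol_gt0// ler_pdivrMr ?vol_gt0// mul1r.
  have -> : vol c = \int[mu]_(y in cell c) 1.
    rewrite (Rintegral_cst _ (measurable_cell c)) mul1r.
    by rewrite [X in fine X](cell_measure pc).
  have i1 := integrable_cst_lty 1 (measurable_cell c) (cell_lty pc).
  apply: le_Rintegral => //.
  - exact: measurable_cell.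
  - apply: (le_integrable (measurable_cell c) _ _ i1).
      by apply/measurable_EFinP; exact: measurable_funTS.
    by move=> y _ /=; rewrite lee_fin normr1 indicE; case: (_ \in _); rewrite ?normr0 ?normr1.
  - by move=> y _.
Qed.

Let ae_eq_vw : ae_eq mu (cell b) (EFin \o (fun z => w z - v z)) (cst 0%E).
Proof.
have iwv : mu.-integrable (cell b) (EFin \o (fun z => w z - v z)).
  exact: (integrableB mb iw iv).
apply: ae_eq0_orthants => // a.
have mw1 := integrable_orthantM a iw; have mv1 := integrable_orthantM a iv.
have -> : \int[mu]_(z in cell b `&` orthant a) (w z - v z) =
    \int[mu]_(z in cell b) (w z * \1_(orthant a) z - v z * \1_(orthant a) z).
  rewrite Rintegral_mkcondr; apply: eq_Rintegral => z _.
  by rewrite /patch indicE; case: (_ \in _); rewrite ?mulr1// !mulr0 subr0.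
rewrite RintegralB//; apply/eqP; rewrite subr_eq0; apply/eqP.
have i1 : mu.-integrable (cell b) (EFin \o (\1_(orthant a) : X -> R)).
  apply: (le_integrable mb _ _ (integrable_cst_lty 1 mb (cell_lty pb))).
    by apply/measurable_EFinP; exact: measurable_funTS.
  by move=> z _ /=; rewrite lee_fin normr1 indicE; case: (_ \in _); rewrite ?normr0 ?normr1.
have h : \int[mu]_(z in cell b) (E m z * \1_(orthant a) z) @[m --> \oo] -->
    \int[mu]_(z in cell b) (w z * \1_(orthant a) z).
  (* By [condexp_sym] the average passes from [w] to the indicator, where its convergence is
     elementary. *)
  apply: cvg_trans (@cvg_Ew a); apply: near_eq_cvg; apply: nearW => m /=.
  rewrite condexp_sym//; apply: eq_Rintegral => z _; rewrite mulrC//.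
exact: (cvg_unique _ h (@cvg_Ev a)).
Qed.

Lemma condexp_cvg_ae :
  {ae mu, forall z, cell b z -> condexp (dirs m) w b z @[m --> \oo] --> w z}.
Proof.
apply: filterS2 E_cvg_ae ae_eq_vw => z Ez vw bz.
have := vw bz; rewrite /= => -[/eqP]; rewrite subr_eq0 => /eqP ->; exact: Ez.
Qed.

End approx_cvg.
End convergence.

(** * The bound on one box *)

Lemma powR_lt1 (R : realType) (x e : R) : 0 < x < 1 -> 0 < e -> x `^ e < 1.
Proof.
move=> /andP[x0 x1] e0; have := @gt0_ltr_powR R e e0 x 1.
by rewrite /= powR1 !nnegrE; apply => //; exact: ltW.
Qed.

(** * Summation of the minimum of two geometric sequences *)

Section dyadic_sum.
Context {R : realType}.
Variables (q s : R).
Hypotheses (q0 : 0 < q) (q1 : q < 1) (s0 : 0 < s) (s1 : s < 1).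

Let a : R := q `^ s.
Let a0 : 0 < a. Proof. exact: powR_gt0. Qed.
Let a1 : a < 1.
Proof. by apply: powR_lt1; rewrite ?q0. Qed.
Let r : R := q `^ (1 - s).
Let r0 : 0 < r. Proof. exact: powR_gt0. Qed.
Let r1 : r < 1.
Proof. by apply: powR_lt1; rewrite ?q0// subr_gt0. Qed.
Let ar : a * r = q.
Proof.
have h : q `^ (s + (1 - s)) = a * r by apply: powRD; rewrite (gt_eqF q0) implybT.
rewrite -h (_ : s + (1 - s) = 1); last by ring.
by rewrite powRr1// ltW.
Qed.

(** The sum to be bounded, divided by [y], with [t = x / y]. Replacing [t] by [t * q] shifts the
    index, whence a recursion in which the crossing point need not be located. *)
Let S M (t : R) : R := \sum_(0 <= m < M) (a ^+ m)^-1 * Num.min (t * q ^+ m) 1.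

Let SS M t : S M.+1 t = Num.min t 1 + a^-1 * S M (t * q).
Proof.
rewrite /S big_nat_recl//= !expr0 invr1 mul1r mulr1; congr (_ + _).
rewrite mulr_sumr; apply: eq_bigr => m _.
by rewrite !exprS invfM -!mulrA.
Qed.

Let S_small M t : 0 <= t -> S M t <= t / (1 - r).
Proof.
move=> t0; apply: (@le_trans _ _ (\sum_(0 <= m < M) t * r ^+ m)).
  apply: ler_sum => m _.
  apply: (@le_trans _ _ ((a ^+ m)^-1 * (t * q ^+ m))).
    by rewrite ler_wpM2l ?invr_ge0 ?exprn_ge0 ?(ltW a0)// ge_min lexx.
  have am : a ^+ m != 0 by rewrite expf_neq0// gt_eqF.
  have -> : (a ^+ m)^-1 * (t * q ^+ m) = t * r ^+ m by rewrite -ar exprMn; field.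
  by [].
by rewrite -mulr_sumr ler_wpM2l// geometric_sum_le// ltW.
Qed.

(* For t >= q one proves the stronger bound K t^s - c by induction on M, the
   constant c absorbing the first term of the sum. *)
Let c : R := (a^-1 - 1)^-1.
Let K : R := (1 - r)^-1 + c / a.

Let c0 : 0 < c.
Proof. by rewrite invr_gt0 subr_gt0 -invr1 ltf_pV2 ?posrE. Qed.

Let a_le t : q <= t -> a <= t `^ s.
Proof.
move=> qt; have t0 := lt_le_trans q0 qt.
by apply: ge0_ler_powR => //; rewrite ?nnegrE; exact: ltW.
Qed.

Let S_le M t : q <= t -> S M t <= K * t `^ s - c.
Proof.
elim: M t => [|M IH] t qt.
  have at_ := a_le qt.
  rewrite /S big_geq// subr_ge0 /K mulrDl.
  apply: (@le_trans _ _ (c / a * t `^ s)).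
    by rewrite -mulrA ler_peMr ?(ltW c0)// mulrC ler_pdivlMr// mul1r.
  by rewrite lerDr mulr_ge0 ?powR_ge0// invr_ge0 subr_ge0 ltW.
have t0 : 0 < t := lt_le_trans q0 qt.
have at_ := a_le qt.
(* For [t] in [[q, 1]] the minimum is never 1 beyond the first entry, and the series is geometric of
   ratio [r]; this is the first term of [K], while [c / a * t ^ s >= c] pays for the subtracted
   constant. For [t > 1] the first term is 1, the induction hypothesis applies to [t * q >= q], and
   [c] solves [1 - c / a = - c]. *)
have [t1|t1] := leP t 1.
  apply: le_trans (S_small _ (ltW t0)) _.
  rewrite /K mulrDl -addrA -[leLHS]addr0; apply: lerD.
    rewrite mulrC ler_wpM2l ?invr_ge0 ?subr_ge0 ?(ltW r1)//.
    apply: ger1_powR; [by rewrite t0|exact: ltW].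
  by rewrite subr_ge0 -mulrA ler_peMr ?(ltW c0)// mulrC ler_pdivlMr// mul1r.
rewrite SS min_r ?(ltW t1)//.
apply: (@le_trans _ _ (1 + a^-1 * (K * (t * q) `^ s - c))).
  rewrite lerD2l ler_wpM2l ?invr_ge0 ?(ltW a0)//; apply: IH.
  by rewrite ler_peMl ?(ltW q0)// ltW.
have -> : (t * q) `^ s = t `^ s * a by rewrite powRM// ltW.
have an0 : a != 0 by rewrite gt_eqF.
have cE : c * (a^-1 - 1) = 1 by rewrite mulVf// gt_eqF// subr_gt0 -invr1 ltf_pV2 ?posrE.
have -> : 1 + a^-1 * (K * (t `^ s * a) - c) = K * t `^ s - c + (1 - c * (a^-1 - 1)) by field.
by rewrite cE subrr addr0.
Qed.

Lemma dyadic_sum_le : exists2 K : R, 0 < K & forall (x y : R) M, 0 <= y -> y <= x ->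
  \sum_(0 <= m < M) ((q `^ s) ^+ m)^-1 * Num.min (x * q ^+ m) y <=
  K * (x `^ s * y `^ (1 - s)).
Proof.
exists K; first by rewrite addr_gt0// ?invr_gt0 ?subr_gt0// mulr_gt0// invr_gt0.
move=> x y M; rewrite le_eqVlt => /predU1P[<- x0|y0 yx].
  rewrite powR0; last by rewrite gt_eqF// subr_gt0.
  rewrite !mulr0 big1// => m _.
  by rewrite min_r ?mulr0// mulr_ge0// exprn_ge0// ltW.
have x0 : 0 < x := lt_le_trans y0 yx.
have -> : \sum_(0 <= m < M) ((q `^ s) ^+ m)^-1 * Num.min (x * q ^+ m) y = y * S M (x / y).
  rewrite /S mulr_sumr; apply: eq_bigr => m _; rewrite mulrCA; congr (_ * _).
  by rewrite minr_pMr ?(ltW y0)// mulr1 mulrA mulrCA divff ?mulr1// gt_eqF.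
apply: (@le_trans _ _ (y * (K * (x / y) `^ s))).
  rewrite ler_wpM2l ?(ltW y0)//.
  apply: le_trans (S_le M _) _; last by rewrite gerBl ltW.
  by rewrite (le_trans (ltW q1))// ler_pdivlMr// mul1r.
have -> : (x / y) `^ s = x `^ s * y^-1 `^ s.
  by rewrite powRM ?invr_ge0 ?(ltW x0) ?(ltW y0).
have <- : y * y^-1 `^ s = y `^ (1 - s).
  rewrite -powR_inv1 ?(ltW y0)// -powRrM mulN1r powRD; last first.
    by rewrite (gt_eqF y0) implybT.
  by rewrite powRr1// ltW.
by rewrite le_eqVlt; apply/orP; left; apply/eqP; ring.
Qed.

End dyadic_sum.

Lemma cvg_powR (R : realType) (u : nat -> R) (x p : R) : 0 < p ->
  (forall n, 0 <= u n) -> u @ \oo --> x -> (fun n => u n `^ p) @ \oo --> x `^ p.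
Proof.
move=> p0 u0 ux.
have x0 : 0 <= x.
  by apply: (@closed_cvg _ _ \oo _ _ (fun y : R => 0 <= y) _ _ _ ux); [
    exact: closed_ge|exact: nearW].
move: x0; rewrite le_eqVlt => /predU1P[x0|x0].
  rewrite -x0 powR0 ?gt_eqF//; apply/cvgr0Pnorm_lt => e e0.
  have ep : 0 < e `^ p^-1 by exact: powR_gt0.
  have : \forall n \near \oo, u n < e `^ p^-1.
    by move: ux; rewrite -x0 => /cvgr_lt; apply.
  apply: filterS => n un; rewrite ger0_norm ?powR_ge0//.
  have -> : e = (e `^ p^-1) `^ p.
    by rewrite -powRrM mulVf ?gt_eqF// powRr1// ltW.
  by apply: gt0_ltr_powR => //; rewrite nnegrE// ltW.
apply: (@continuous_cvg _ _ _ _ _ _ (fun y => y `^ p)); last exact: ux.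
apply: differentiable_continuous; apply/derivable1_diffP.
by apply: derivable_powR; rewrite in_itv /= x0.
Qed.

(** * From the increments to the L^p norm on a box *)

Section cell_bound.
Context {R : realType} {N : nat}.
Local Notation X := ('rV[R]_N * R)%type.
Local Notation mu := (lebesgue_strip N).
Local Notation bounds := ((option 'I_N -> R) * (option 'I_N -> R))%type.
Local Notation rho := (@rho R N).
Implicit Types (c : bounds) (i j : option 'I_N) (z : X) (m : nat).

Variables (w : X -> R) (gr : option 'I_N -> X -> R) (b : bounds) (ell A B p Kd : R).
Hypothesis sw : sqint mu w.
Hypothesis sg : forall j, sqint mu (gr j).
Hypothesis pb : proper b.
Hypothesis half_w : forall j c, proper c -> b.1 None <= c.1 None -> c.2 None <= b.2 None ->
  `|\int[mu]_(z in cell (lhalf c j)) w z - \int[mu]_(z in cell (rhalf c j)) w z|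
    <= side c j / 2 * \int[mu]_(z in cell c) `|gr j z|.
Hypothesis side_b : forall i, side b i <= ell.
Hypothesis ell1 : 1 <= ell.
Hypothesis B0 : 0 <= B.
Hypothesis BA : B <= A.
Hypothesis gA : forall j, \int[mu]_(z in cell b) (gr j z ^+ 2) <= A ^+ 2.
Hypothesis wB : \int[mu]_(z in cell b) (w z ^+ 2) <= B ^+ 2.
Hypothesis p2 : 2 < p.
Let s : R := N.+1%:R * (p - 2) / 2 / p.
Hypothesis Kd0 : 0 < Kd.
Hypothesis HKd : forall (x y : R) M, 0 <= y -> y <= x ->
  \sum_(0 <= m < M) ((rho `^ s) ^+ m)^-1 * Num.min (x * rho ^+ m) y <=
  Kd * (x `^ s * y `^ (1 - s)).

Let mb : measurable (cell b). Proof. exact: measurable_cell. Qed.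
Let v0 : 0 < vol b. Proof. exact: vol_gt0. Qed.
Let A0 : 0 <= A. Proof. exact: le_trans BA. Qed.
Let p0 : 0 < p. Proof. by apply: lt_trans p2. Qed.
Let s0 : 0 < s.
Proof. by rewrite /s !divr_gt0// mulr_gt0// subr_gt0. Qed.
Let ell0 : 0 <= ell. Proof. exact: le_trans ell1. Qed.

Let E m z : R := condexp (dirs m) w b z.
Let f m z : R := incr (dirs m) (dirn m) w b z.
Let D m : R := Num.min (ell * rho ^+ m * A) B.


Let mE m : measurable_fun [set: X] (E m). Proof. exact: measurable_condexp. Qed.
Let mf m : measurable_fun [set: X] (f m). Proof. exact: measurable_incr. Qed.

Let iw : mu.-integrable (cell b) (EFin \o w).
Proof. by apply: sqint_integrable => //; exact: cell_lty. Qed.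

Let ES m z : E m.+1 z = E m z + f m z.
Proof. by rewrite /E dirsS condexp_rcons. Qed.

Let D0 m : 0 <= D m.
Proof. by rewrite /D le_min B0 andbT !mulr_ge0// exprn_ge0// ltW// (@rho_gt0 R N). Qed.

Let D2 m : D m ^+ 2 = Num.min ((ell * rho ^+ m * A) ^+ 2) (B ^+ 2).
Proof.
have a0 : 0 <= ell * rho ^+ m * A by rewrite !mulr_ge0// exprn_ge0// ltW// (@rho_gt0 R N).
rewrite /D; have [h|h] := leP (ell * rho ^+ m * A) B.
  by rewrite min_l// lerXn2r.
by rewrite min_r// lerXn2r ?nnegrE// ltW.
Qed.

Let f_bounds m :
  (\int[mu]_(z in cell b) (f m z ^+ 2)%:E <= (D m ^+ 2)%:E)%E /\
  (forall z, cell b z -> f m z ^+ 2 <= 2 ^+ m / vol b * D m ^+ 2).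
Proof.
(* [k] bounds half the side, in the direction of the next cut, of every cell obtained after [m]
   cuts. *)
pose j : option 'I_N := dirn m; pose k : R := side b j / 2 ^+ (m %/ N.+1).+1.
have k0 : 0 <= k by rewrite divr_ge0 ?exprn_ge0// subr_ge0 ltW.
have [g1 g2] : (\int[mu]_(z in cell b) (f m z ^+ 2)%:E <=
    (k ^+ 2 * \int[mu]_(z in cell b) (gr j z ^+ 2))%:E)%E /\
    (forall z, cell b z -> f m z ^+ 2 <= 2 ^+ size (dirs m : seq (option 'I_N)) / vol b *
       (k ^+ 2 * \int[mu]_(z in cell b) (gr j z ^+ 2))).
  apply: (@incr_bounds R N (dirs m) j w b
     (fun c => k ^+ 2 * \int[mu]_(z in cell c) (gr j z ^+ 2))) => //.
  - by move=> c; rewrite mulr_ge0 ?sqr_ge0// Rintegral_ge0// => z _; exact: sqr_ge0.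
  - by move=> c i pc; rewrite -mulrDr Rintegral_sqr_halves.
  - move=> c lc; have pc := leaf_proper lc pb.
    have [c1 c2] := leaf_inside lc pb (lexx (b.1 None)) (lexx (b.2 None)).
    apply: le_trans (jump_grad (sg j) pc (half_w j pc c1 c2)) _.
    rewrite ler_wpM2r//; first by apply: Rintegral_ge0 => z _; exact: sqr_ge0.
    rewrite lerXn2r ?nnegrE//; first by rewrite divr_ge0// subr_ge0 ltW.
    rewrite (leaf_side j lc) /k -mulrA ler_wpM2l//; first by rewrite subr_ge0 ltW.
    rewrite -invfM mulrC -exprS lef_pV2 ?posrE ?exprn_gt0//.
    by rewrite ler_eXn2l ?ltr1n// ltnS count_dirs.
have [s1 s2] : (\int[mu]_(z in cell b) (f m z ^+ 2)%:E <=
    (\int[mu]_(z in cell b) (w z ^+ 2))%:E)%E /\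
    (forall z, cell b z -> f m z ^+ 2 <= 2 ^+ size (dirs m : seq (option 'I_N)) / vol b *
       \int[mu]_(z in cell b) (w z ^+ 2)).
  apply: (@incr_bounds R N (dirs m) j w b
     (fun c => \int[mu]_(z in cell c) (w z ^+ 2))) => //.
  - by move=> c; rewrite Rintegral_ge0// => z _; exact: sqr_ge0.
  - by move=> c i pc; rewrite Rintegral_sqr_halves.
  - by move=> c lc; apply: jump_self => //; exact: leaf_proper lc pb.
have kle : k ^+ 2 * \int[mu]_(z in cell b) (gr j z ^+ 2) <= (ell * rho ^+ m * A) ^+ 2.
  rewrite [leRHS]exprMn; apply: ler_pM (gA j).
  - exact: sqr_ge0.
  - by apply: Rintegral_ge0 => z _; exact: sqr_ge0.
  - rewrite lerXn2r ?nnegrE//; first by rewrite mulr_ge0// exprn_ge0// ltW// (@rho_gt0 R N).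
    apply: ler_pM => //; first by rewrite subr_ge0 ltW.
    exact: half_pow_le_rho.
rewrite D2; split=> [|z bz].
  rewrite EFin_min le_min (le_trans g1) ?lee_fin//=.
  by rewrite (le_trans s1) ?lee_fin.
have q0 : 0 <= 2 ^+ m / vol b by rewrite divr_ge0 ?exprn_ge0// ltW.
have [_|_] := leP ((ell * rho ^+ m * A) ^+ 2) (B ^+ 2).
  by apply: le_trans (g2 _ bz) _; rewrite size_dirs ler_wpM2l.
by apply: le_trans (s2 _ bz) _; rewrite size_dirs ler_wpM2l.
Qed.


Let f2 m : (\int[mu]_(z in cell b) (f m z ^+ 2)%:E <= (D m ^+ 2)%:E)%E.
Proof. by case: (f_bounds m). Qed.

Let fsup m z : cell b z -> f m z ^+ 2 <= 2 ^+ m / vol b * D m ^+ 2.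
Proof. by case: (f_bounds m) => _; apply. Qed.

(* |f| <= (rho^-m f^2 + rho^m) / 2 *)
Let f_L1 m : (\int[mu]_(z in cell b) `|f m z|%:E <=
  (((ell * A) ^+ 2 + vol b) / 2 * rho ^+ m)%:E)%E.
Proof.
have r0 : 0 < rho ^+ m by rewrite exprn_gt0// rho_gt0.
have mf2 : measurable_fun (cell b) (fun z => (f m z ^+ 2)%:E).
  by apply/measurable_EFinP; apply: measurable_funTS; exact: measurable_funX.
apply: (@le_trans _ _ (\int[mu]_(z in cell b)
    (((2 * rho ^+ m)^-1)%:E * (f m z ^+ 2)%:E + (rho ^+ m / 2)%:E))%E).
  apply: ge0_le_integral => //.
  - by apply/measurable_EFinP/measurable_funTS; exact: measurableT_comp.
  - by apply: emeasurable_funD => //; exact: measurable_funeM.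
  - move=> z _; rewrite -EFinM -EFinD lee_fin.
    rewrite -[f m z ^+ 2]real_normK ?num_real//; set t := `|f m z|.
    rewrite -subr_ge0 (_ : _ - t = (t - rho ^+ m) ^+ 2 / (2 * rho ^+ m)).
      by rewrite divr_ge0 ?sqr_ge0// mulr_ge0// ltW.
    by field; rewrite gt_eqF// rho_gt0.
rewrite ge0_integralD//; last 3 first.
- by move=> z _; rewrite -EFinM lee_fin mulr_ge0 ?invr_ge0 ?sqr_ge0 ?mulr_ge0 ?(ltW r0).
- exact: measurable_funeM.
- by move=> z _; rewrite lee_fin divr_ge0// ltW.
rewrite ge0_integralZl_EFin//; last 2 first.
- by move=> z _; rewrite lee_fin sqr_ge0.
- by rewrite invr_ge0 mulr_ge0// ltW.
rewrite integral_cst// [X in (_ + _ * X)%E](cell_measure pb).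
apply: (@le_trans _ _ (((2 * rho ^+ m)^-1)%:E * ((ell * rho ^+ m * A) ^+ 2)%:E +
   (rho ^+ m / 2)%:E * (vol b)%:E)%E).
  apply: leeD => //; apply: lee_pmul => //.
  - by rewrite lee_fin invr_ge0 mulr_ge0// ltW.
  - by apply: integral_ge0 => z _; rewrite lee_fin sqr_ge0.
  - apply: le_trans (f2 m) _; rewrite lee_fin D2.
    by rewrite ge_min lexx.
rewrite -!EFinM -EFinD lee_fin le_eqVlt; apply/orP; left; apply/eqP.
by field; rewrite gt_eqF// rho_gt0.
Qed.

Let E_cvg : {ae mu, forall z, cell b z -> E m z @[m --> \oo] --> w z}.
Proof.
apply: (@condexp_cvg_ae R N w b ell (((ell * A) ^+ 2 + vol b) / 2) rho) => //.
  by rewrite rho_lt1 ltW// rho_gt0.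
by rewrite divr_ge0// addr_ge0// ?sqr_ge0// ltW.
Qed.

(** This is [1/2 - 1/p], or [s / N.+1]. *)
Let kap : R := (p - 2) / (2 * p).
Let Nrm (h : X -> R) : \bar R := 'N[mu]_p%:E[EFin \o (h \_ (cell b))].

Let Nrm_pow h : (Nrm h `^ p = \int[mu]_(z in cell b) (`|h z| `^ p)%:E)%E.
Proof.
have pn0 : p != 0 by rewrite gt_eqF.
rewrite /Nrm (poweR_Lnorm _ _ pn0) [RHS]integral_mkcond; apply: eq_integral => z _.
rewrite /= /patch; case: ifP => _ //.
by rewrite normr0 powR0// gt_eqF.
Qed.

Let Nrm_le h (c : R) : 0 <= c ->
  (\int[mu]_(z in cell b) (`|h z| `^ p)%:E <= (c `^ p)%:E)%E -> (Nrm h <= c%:E)%E.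
Proof.
move=> c0 hc.
have N0 : (0 <= Nrm h)%E by exact: Lnorm_ge0.
rewrite -(poweRe1 N0) -(@divff _ p) ?gt_eqF// poweRrM Nrm_pow.
have -> : c%:E = ((c `^ p)%:E `^ p^-1)%E.
  by rewrite poweR_EFin -powRrM divff ?gt_eqF// powRr1.
apply: gt0_ler_poweR hc; first by rewrite invr_ge0 ltW.
  by rewrite in_itv /= leey andbT integral_ge0// => z _; rewrite lee_fin powR_ge0.
by rewrite in_itv /= leey andbT lee_fin powR_ge0.
Qed.

Let Vk : R := vol b `^ (- kap).

(** Integrate [|f|^p <= |f|_oo^(p - 2) f^2]. The sup bound contributes the power [kap] of
    [2 ^+ m / vol b], and [2^(m kap)] is [rho^(- s m)] because [s = N.+1 * kap]. *)
Let f_Lp m : (Nrm (f m) <= (Vk * (((rho `^ s) ^+ m)^-1 * D m))%:E)%E.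
Proof.
have kp : kap * p = (p - 2) / 2 by rewrite /kap; field; rewrite gt_eqF.
have cE : Vk * (((rho `^ s) ^+ m)^-1 * D m) = (2 ^+ m / vol b) `^ kap * D m.
  rewrite mulrA; congr (_ * _).
  rewrite powRM ?invr_ge0 ?exprn_ge0 ?(ltW v0)// /Vk mulrC; congr (_ * _).
    rewrite -powR_mulrn ?powR_ge0// -powRrM /rho -powRrM -powRN -powR_mulrn// -powRrM.
    congr (_ `^ _); rewrite /s /kap.
    by field; rewrite gt_eqF//= gt_eqF.
  by rewrite -powR_inv1 ?(ltW v0)// -powRrM mulN1r.
rewrite cE; apply: Nrm_le; first by rewrite mulr_ge0 ?powR_ge0.
have s20 : 0 <= 2 ^+ m / vol b by rewrite divr_ge0 ?exprn_ge0// ltW.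
have fs2 := @fsup m; move: (2 ^+ m / vol b) s20 fs2 => s2 s20 fs2.
have -> : ((s2 `^ kap * D m) `^ p) = (s2 * D m ^+ 2) `^ ((p - 2) / 2) * D m ^+ 2.
  rewrite powRM ?powR_ge0// -powRrM kp powRM ?sqr_ge0// -mulrA; congr (_ * _).
  have [->|Dn0] := eqVneq (D m) 0; first by rewrite powR0 ?gt_eqF// expr0n /= mulr0.
  rewrite -!powR_mulrn// -powRrM -powRD ?Dn0 ?implybT//; congr (_ `^ _).
  by field.
have mf2 : measurable_fun (cell b) (fun z => (f m z ^+ 2)%:E).
  by apply/measurable_EFinP; apply: measurable_funTS; exact: measurable_funX.
apply: (@le_trans _ _ (\int[mu]_(z in cell b)
    (((s2 * D m ^+ 2) `^ ((p - 2) / 2))%:E * (f m z ^+ 2)%:E))%E).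
  apply: ge0_le_integral => //.
  - apply/measurable_EFinP/measurable_funTS.
    apply: (measurableT_comp (measurable_powR p)); exact: measurableT_comp.
  - exact: measurable_funeM.
  - move=> z bz; rewrite -EFinM lee_fin.
    have -> : `|f m z| `^ p = (f m z ^+ 2) `^ ((p - 2) / 2) * f m z ^+ 2.
      rewrite -[f m z ^+ 2]real_normK ?num_real//; set t := `|f m z|.
      have t0 : 0 <= t by rewrite /t.
      have [->|tn0] := eqVneq t 0; first by rewrite powR0 ?gt_eqF// expr0n /= mulr0.
      rewrite -!powR_mulrn// -powRrM -powRD ?tn0 ?implybT//; congr (_ `^ _).
      by field.
    apply: ler_wpM2r; first exact: sqr_ge0.
    apply: ge0_ler_powR.
    + by rewrite divr_ge0// subr_ge0 ltW.
    + by rewrite nnegrE sqr_ge0.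
    + by rewrite nnegrE mulr_ge0// sqr_ge0.
    + exact: fs2.
rewrite ge0_integralZl_EFin ?powR_ge0//; last by move=> z _; rewrite lee_fin sqr_ge0.
rewrite EFinM; apply: lee_wpmul2l; first by rewrite lee_fin powR_ge0.
exact: f2.
Qed.

Let E0_Lp : (Nrm (E 0) <= (Vk * B)%:E)%E.
Proof.
apply: Nrm_le; first by rewrite mulr_ge0 ?powR_ge0.
have E0z z : E 0 z = avg w b by [].
under eq_integral do rewrite E0z.
rewrite integral_cst// [X in (_ * X)%E](cell_measure pb) -EFinM lee_fin.
have avgB : avg w b ^+ 2 * vol b <= B ^+ 2.
  have h := sqr_Rintegral_le mb (cell_lty pb) sw.
  rewrite [X in fine X](cell_measure pb)/= in h.
  have vn0 : vol b != 0 by rewrite gt_eqF.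
  rewrite /avg; set I := Rintegral _ _ _.
  have -> : (I / vol b) ^+ 2 * vol b = I ^+ 2 / vol b by field.
  rewrite ler_pdivrMr//; apply: (@le_trans _ _ (vol b * \int[mu]_(z in cell b) (w z ^+ 2))).
    apply: le_trans h; rewrite -[leLHS]real_normK ?num_real//.
    by rewrite lerXn2r ?nnegrE// ?le_normr_Rintegral// (le_trans _ (le_normr_Rintegral _ _)).
  by rewrite mulrC ler_pM2r.
have -> : (Vk * B) `^ p = (B ^+ 2 / vol b) `^ (p / 2) * vol b.
  rewrite powRM ?powR_ge0// powRM ?sqr_ge0 ?invr_ge0 ?(ltW v0)// -mulrA mulrC; congr (_ * _).
    rewrite -powR_mulrn// -powRrM; congr (_ `^ _); by field.
  rewrite -[X in _ = _ * X](powRr1 (ltW v0)) -powR_inv1 ?(ltW v0)// -!powRrM -powRD.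
    congr (_ `^ _); rewrite /kap; by field; rewrite gt_eqF.
  by rewrite (gt_eqF v0) implybT.
apply: ler_wpM2r; first exact: ltW.
have -> : `|avg w b| `^ p = (avg w b ^+ 2) `^ (p / 2).
  rewrite -[avg w b ^+ 2]real_normK ?num_real// -powR_mulrn// -powRrM.
  by congr (_ `^ _); field.
apply: ge0_ler_powR.
- by rewrite divr_ge0// ltW.
- by rewrite nnegrE sqr_ge0.
- by rewrite nnegrE divr_ge0 ?sqr_ge0// ltW.
- by rewrite ler_pdivlMr.
Qed.

Let E_Lp M : (Nrm (E M) <= (Vk * (B + \sum_(0 <= m < M) ((rho `^ s) ^+ m)^-1 * D m))%:E)%E.
Proof.
elim: M => [|M IH]; first by rewrite big_geq// addr0.
rewrite big_nat_recr//= addrA mulrDr EFinD.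
have -> : (Nrm (E M.+1) = 'N[mu]_p%:E[EFin \o ((E M \_ (cell b)) \+ (f M \_ (cell b)))%R])%E.
  apply: eq_Lnorm => z /=; congr EFin; rewrite /patch; case: ifP => _.
    exact: ES.
  by rewrite addr0.
apply: (@le_trans _ _ (Nrm (E M) + Nrm (f M))%E).
  apply: minkowski_EFin; last by apply: ltW; apply: lt_trans p2; rewrite ltr1n.
    by apply/(measurable_restrictT _ mb)/measurable_funTS.
  by apply/(measurable_restrictT _ mb)/measurable_funTS.
exact: leeD.
Qed.

Let c : R := Vk * (1 + Kd) * ((ell * A) `^ s * B `^ (1 - s)).

Let c0 : 0 <= c.
Proof. by rewrite /c !mulr_ge0 ?powR_ge0// addr_ge0// ltW. Qed.

Let E_int M : (\int[mu]_(z in cell b) (`|E M z| `^ p)%:E <= (c `^ p)%:E)%E.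
Proof.
rewrite -Nrm_pow -poweR_EFin; apply: gt0_ler_poweR.
- exact: ltW.
- by rewrite in_itv /= leey andbT; exact: Lnorm_ge0.
- by rewrite in_itv /= leey andbT lee_fin.
apply: le_trans (E_Lp M) _; rewrite lee_fin /c -mulrA ler_wpM2l ?powR_ge0// mulrDl mul1r.
have BA' : B <= ell * A by apply: (le_trans BA); rewrite ler_peMl.
apply: lerD.
  (* Since [B <= ell * A], writing [B] as [B^s B^(1 - s)] absorbs the initial average; it accounts
     for the 1 in [1 + Kd]. *)
  rewrite -[leLHS]powRr1// -{1}(subrK s 1) addrC.
  rewrite powRD; last by rewrite subrKC oner_eq0.
  rewrite ler_wpM2r ?powR_ge0//; apply: ge0_ler_powR => //; first exact: ltW.
  by rewrite nnegrE (le_trans B0).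
apply: le_trans (HKd M B0 BA'); rewrite le_eqVlt; apply/orP; left; apply/eqP.
by apply: eq_bigr => m _; rewrite /D mulrAC.
Qed.

Lemma cell_Lp_bound :
  (\int[mu]_(z in cell b) (`|w z| `^ p)%:E <= (c `^ p)%:E)%E.
Proof.
have mpow (h : X -> R) : measurable_fun [set: X] h ->
    measurable_fun (cell b) (fun z => (`|h z| `^ p)%:E).
  move=> mh; apply/measurable_EFinP/measurable_funTS.
  by apply: (measurableT_comp (measurable_powR p)); exact: measurableT_comp.
have -> : (\int[mu]_(z in cell b) (`|w z| `^ p)%:E =
    \int[mu]_(z in cell b) limn_einf (fun m => (`|E m z| `^ p)%:E))%E.
  apply: ge0_ae_eq_integral => //.
  - by apply: mpow; case: sw.
  - rewrite /limn_einf; apply: measurableT_comp => //.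
    apply: measurable_fun_limn_esup => m; apply: measurableT_comp => //.
    exact: mpow.
  - move=> z _; rewrite limn_einf_lim; apply: lime_ge; first exact: is_cvg_einfs.
    by apply: nearW => m; apply: le_ereal_inf_tmp => _ [k _ <-]; rewrite lee_fin powR_ge0.
  - apply: filterS E_cvg => z Ez bz; apply/esym.
    apply: (cvg_limn_einf_sup _).1.
    apply: cvg_EFin; first exact: nearW.
    by apply: cvg_powR => //; apply: cvg_norm; exact: Ez.
apply: le_trans (fatou mu mb (fun m => mpow _ (mE m)) _) _.
  by move=> n z _; rewrite lee_fin powR_ge0.
rewrite limn_einf_lim; apply: lime_le; first exact: is_cvg_einfs.
apply: nearW => m; apply: le_trans (E_int m).
by apply: ereal_inf_lbound; exists m => /=.
Qed.

End cell_bound.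

(** * Summation over the cubes and the edges *)

Section L2_restrict.
Context {R : realType} {N : nat}.
Local Notation X := ('rV[R]_N * R)%type.
Local Notation mu := (lebesgue_strip N).
Implicit Types (D : set X) (u : X -> R).

Lemma LnormD_pow D u (p : R) : p != 0 ->
  (LnormD mu D p u `^ p = \int[mu]_z (`|(u \_ D) z| `^ p)%:E)%E.
Proof. by move=> p0; rewrite /LnormD poweR_Lnorm. Qed.

Lemma LnormD_sqr D u :
  (LnormD mu D 2 u `^ 2 = \int[mu]_z ((u \_ D) z ^+ 2)%:E)%E.
Proof.
rewrite LnormD_pow//; apply: eq_integral => z _.
by rewrite powR_mulrn// real_normK ?num_real.
Qed.

Lemma L2_sqint D u : measurable D -> L2 mu D u -> sqint mu (u \_ D).
Proof.
move=> mD [mu_ uoo]; split; first exact/(measurable_restrictT _ mD).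
by rewrite -LnormD_sqr poweR_lty.
Qed.

Lemma measurable_strip (A : set 'rV[R]_N) (l : R) : measurable A ->
  measurable (strip A l : set X).
Proof. by move=> mA; apply: measurableX => //; exact: measurable_itv. Qed.

End L2_restrict.

Section cubes.
Context {R : realType} {N : nat}.
Local Notation X := ('rV[R]_N * R)%type.
Local Notation mu := (lebesgue_strip N).
Local Notation bounds := ((option 'I_N -> R) * (option 'I_N -> R))%type.
Variable (l : R).
Hypothesis l0 : 0 < l.
Implicit Types (c : 'rV[int]_N) (z : X).

Definition cube_bounds c : bounds :=
  (fun i => if i is Some k then (c 0 k)%:~R - 2^-1 else 0,
   fun i => if i is Some k then (c 0 k)%:~R + 2^-1 else l).

Lemma proper_cube c : proper (cube_bounds c).
Proof. by move=> [i|] //=; lra. Qed.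

Lemma side_cube c i : side (cube_bounds c) i = if i is Some _ then 1 else l.
Proof. by case: i => [i|]; rewrite /side /=; lra. Qed.

Lemma vol_cube c : vol (cube_bounds c) = l.
Proof.
rewrite /vol (bigD1 None)//= side_cube big1 ?mulr1// => -[i|]//= _.
by rewrite side_cube.
Qed.

Lemma cube_unique c c' z : cell (cube_bounds c) z -> cell (cube_bounds c') z -> c = c'.
Proof.
move=> h h'; apply/rowP => i; have := h (Some i); have := h' (Some i) => /=.
move=> /andP[a1 a2] /andP[b1 b2].
have c1 : (c 0 i)%:~R < (c' 0 i)%:~R + 1 :> R by lra.
have c2 : (c' 0 i)%:~R < (c 0 i)%:~R + 1 :> R by lra.
move: c1 c2; rewrite -[1]/(1%:~R) -!intrD !ltr_int !ltzD1 => c1 c2.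
by apply/eqP; rewrite eq_le c1.
Qed.

Lemma cube_exists z : 0 <= z.2 < l -> exists c, cell (cube_bounds c) z.
Proof.
move=> zl; exists (\row_i Num.floor (z.1 0 i + 2^-1)) => -[i|] //=.
rewrite mxE; have := floor_itv (z.1 0 i + 2^-1).
by rewrite intrD => /andP[? ?]; apply/andP; split; lra.
Qed.

(** With [pickle_inv] each centre has exactly one index, so the sequence is disjoint; the other
    indices give the empty set. *)
Definition cube_seq (n : nat) : set X :=
  if pickle_inv n is Some c then cell (cube_bounds c) else set0.

Lemma measurable_cube_seq n : measurable (cube_seq n).
Proof. by rewrite /cube_seq; case: pickle_inv => [c|] //; exact: measurable_cell. Qed.

Lemma trivIset_cube_seq : trivIset setT cube_seq.
Proof.
move=> m n _ _ [z []]; rewrite /cube_seq.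
case em : (pickle_inv m) => [c|]//; case en : (pickle_inv n) => [c'|]// zc zc'.
have := @pickle_invK 'rV[int]_N m; have := @pickle_invK 'rV[int]_N n.
by rewrite em en /= (cube_unique zc zc') => -> ->.
Qed.

Lemma bigcup_cube_seq z : 0 <= z.2 < l -> (\bigcup_n cube_seq n) z.
Proof.
move=> /cube_exists[c zc]; exists (pickle c) => //.
by rewrite /cube_seq pickleK_inv.
Qed.

(* The half-open cubes are disjoint and cover the strip, so that both integrals
   are sums over the cubes. *)
Lemma integral_cubes_le (f g : X -> R) :
  measurable_fun setT f -> measurable_fun setT g ->
  (forall z, 0 <= f z) -> (forall z, 0 <= g z) ->
  (forall z, ~ strip setT l z -> f z = 0) ->
  (forall c, \int[mu]_(z in cell (cube_bounds c)) (f z)%:E <=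
             \int[mu]_(z in cell (cube_bounds c)) (g z)%:E)%E ->
  (\int[mu]_z (f z)%:E <= \int[mu]_z (g z)%:E)%E.
Proof.
move=> mf mg f0 g0 fD fg.
have mU : measurable (\bigcup_n cube_seq n).
  by apply: bigcup_measurable => n _; exact: measurable_cube_seq.
have bigE (h : X -> R) : measurable_fun setT h -> (forall z, 0 <= h z) ->
    (\int[mu]_(z in \bigcup_n cube_seq n) (h z)%:E =
     \sum_(0 <= n <oo) \int[mu]_(z in cube_seq n) (h z)%:E)%E.
  move=> mh h0; apply: ge0_integral_bigcup.
  - exact: measurable_cube_seq.
  - by apply/measurable_EFinP; exact: measurable_funTS.
  - by move=> z _; rewrite lee_fin.
  - exact: trivIset_cube_seq.
have -> : (\int[mu]_z (f z)%:E = \int[mu]_(z in \bigcup_n cube_seq n) (f z)%:E)%E.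
  rewrite [RHS]integral_mkcond; apply: eq_integral => z _; rewrite /patch.
  case: ifPn => // zU; rewrite fD// => -[_ /=]; rewrite in_itv /= => /andP[z0 zl].
  by move/negP: zU; apply; rewrite inE; apply: bigcup_cube_seq; rewrite (ltW z0).
apply: (@le_trans _ _ (\int[mu]_(z in \bigcup_n cube_seq n) (g z)%:E)%E); last first.
  apply: ge0_subset_integral => //; first exact/measurable_EFinP.
  by move=> z _; rewrite lee_fin.
rewrite !bigE//; apply: lee_nneseries => [n _ _|n _].
  by apply: integral_ge0 => z _; rewrite lee_fin.
rewrite /cube_seq; case: pickle_inv => [c|]; first exact: fg.
by rewrite !integral_set0.
Qed.

(* The open and half-open cubes differ by a null set. *)
Lemma integral_cube_strip c (u : X -> R) : measurable_fun (strip setT l) u ->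
  (\int[mu]_(z in cell (cube_bounds c)) ((u \_ (strip setT l)) z ^+ 2)%:E =
   LnormD mu (strip (cube c) l) 2 u `^ 2)%E.
Proof.
move=> mu_; rewrite LnormD_sqr integral_mkcond.
have mcube : measurable (cube c : set 'rV[R]_N).
  rewrite [X in measurable X](_ : _ = \bigcap_(i in [set: 'I_N])
      ((fun x : 'rV[R]_N => x 0 i) @^-1`
        `](c 0 i)%:~R - 2^-1, (c 0 i)%:~R + 2^-1[%classic)); last first.
    apply/seteqP; split => x /= h i.
      by move=> _; have := h i; rewrite ltr_distl /= in_itv.
    by have := h i I; rewrite ltr_distl /= in_itv.
  apply: fin_bigcap_measurable => [|i _]; first exact: finite_finset.
  rewrite -[_ @^-1` _]setTI.
  exact: (@measurable_coord R N i measurableT _ (measurable_itv _)).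
have ms := @measurable_strip R N _ l mcube.
have msT := @measurable_strip R N _ l measurableT.
have mD : measurable_fun setT (u \_ (strip setT l)) by exact/(measurable_restrictT _ msT).
apply: ge0_ae_eq_integral => //.
- rewrite restrict_EFin; apply/measurable_EFinP.
  apply/(measurable_restrictT _ (measurable_cell _))/measurable_funTS.
  exact: measurable_funX.
- apply/measurable_EFinP/measurable_funX/(measurable_restrictT _ ms).
  by apply: measurable_funS mu_ => // z [].
- move=> z _; rewrite restrict_EFin lee_fin /patch; case: ifP => // _.
  exact: sqr_ge0.
- by move=> z _; rewrite lee_fin sqr_ge0.
apply: filterS (@negligible_hyperplanes R N (cube_bounds c).1) => z zc _.
have [zs|zs] := pselect (strip (cube c) l z).
  case: (zs) => /= zcube; rewrite in_itv /= => /andP[z0 zl].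
  have zcell : cell (cube_bounds c) z.
    move=> [i|] /=; last by rewrite ltW.
    by have := zcube i; rewrite ltr_distl => /andP[/ltW -> ->].
  have zD : strip setT l z by split => //=; rewrite in_itv /= z0.
  by rewrite /patch !mem_set.
rewrite [in RHS]/patch (memNset zs) /= (_ : point = 0 :> R)// expr0n /=.
rewrite /patch; case: ifPn => // /set_mem zcell.
case: ifPn => [/set_mem[_ zl]|_]; last by rewrite expr0n.
exfalso; apply: zs; split => // i /=.
rewrite ltr_distl lt_neqAle eq_sym (zc (Some i)) /=.
by have := zcell (Some i).
Qed.

End cubes.

(** * From products of powers to weighted sums of squares *)

Section weights.
Context {R : realType}.
Implicit Types (A B S a b t p : R).

(* For t < 2 this is Young's inequality for a / A and b / B. Summed over the cubes,
   where a and b are the local norms and A and B the global ones, the first bound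
   yields the second: no Hoelder inequality for series is needed. *)
Lemma young_weights A B S p t : 0 < t < p -> 2 < p -> 0 <= B -> B <= A -> 0 <= S ->
  exists alpha beta : R, [/\ 0 <= alpha, 0 <= beta,
    forall a b, 0 <= a -> a <= A -> 0 <= b -> b <= B -> b <= S ->
      a `^ t * b `^ (p - t) <= alpha * a ^+ 2 + beta * b ^+ 2 &
    alpha * A ^+ 2 + beta * B ^+ 2 <=
      A `^ t * B `^ (2 * Num.max 0 (1 - t / 2)) *
      S `^ (p - t - 2 * Num.max 0 (1 - t / 2))].
Proof.
move=> /andP[t0 tp] p2 B0 BA S0.
have pt : 0 < p - t by rewrite subr_gt0.
have [B00|Bn0] := eqVneq B 0.
  exists 0, 0; split=> // [a b _ _ b0 bB _|].
    have -> : b = 0 by apply/eqP; rewrite eq_le b0 -B00 bB.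
    by rewrite powR0 ?gt_eqF// !mul0r mulr0 addr0.
  by rewrite !mul0r addr0 !mulr_ge0 ?powR_ge0.
have {Bn0} Bp : 0 < B by rewrite lt_neqAle eq_sym Bn0.
have Ap : 0 < A := lt_le_trans Bp BA.
have [t2|t2] := leP 2 t.
  rewrite max_l; last by rewrite subr_le0 ler_pdivlMr// mul1r.
  (* For [t >= 2] a square of [a] is kept, the remaining power of [a] being bounded by that of [A],
     and [b] by [S]. *)
  exists (A `^ (t - 2) * S `^ (p - t)), 0; split => //.
  - by rewrite mulr_ge0 ?powR_ge0.
  - move=> a b a0 aA b0 _ bS; rewrite mul0r addr0.
    rewrite mulrAC; apply: ler_pM; rewrite ?powR_ge0//; last first.
      by apply: ge0_ler_powR => //; exact: ltW.
    have [->|an0] := eqVneq a 0; first by rewrite powR0 ?gt_eqF// expr0n /= mulr0.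
    have -> : a `^ t = a `^ (t - 2) * a ^+ 2.
      rewrite -powR_mulrn// -[RHS](@powRD _ _ (t - 2) 2) ?subrK//.
      by rewrite an0 implybT.
    apply: ler_wpM2r; first exact: sqr_ge0.
    apply: ge0_ler_powR => //; first by rewrite subr_ge0.
    by rewrite nnegrE ltW.
  - rewrite mul0r addr0 mulr0 powRr0 mulr1 subr0 mulrAC -powR_mulrn ?(ltW Ap)//.
    rewrite -[X in X * _](@powRD _ _ (t - 2) 2) ?subrK//.
    by rewrite (gt_eqF Ap) implybT.
rewrite max_r; last by rewrite subr_ge0 ler_pdivrMr// mul1r ltW.
have -> : 2 * (1 - t / 2) = 2 - t by field.
have -> : p - t - (2 - t) = p - 2 by ring.
have t2' : 0 < 2 - t by rewrite subr_gt0.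
have young x y : 0 <= x -> 0 <= y ->
    x `^ t * y `^ (2 - t) <= t / 2 * x ^+ 2 + (1 - t / 2) * y ^+ 2.
  move=> x0 y0.
  have h := @conjugate_powR R (x `^ t) (y `^ (2 - t)) (2 / t) (2 / (2 - t))
    (powR_ge0 _ _) (powR_ge0 _ _).
  apply: le_trans (h _ _ _) _.
  - by rewrite divr_gt0.
  - by rewrite divr_gt0.
  - by field; rewrite ?(gt_eqF t0) ?(gt_eqF t2').
  rewrite -!powRrM.
  have -> : t * (2 / t) = 2%:R by field; rewrite gt_eqF.
  have -> : (2 - t) * (2 / (2 - t)) = 2%:R by field; rewrite gt_eqF.
  rewrite !powR_mulrn// le_eqVlt; apply/orP; left; apply/eqP.
  by field; rewrite ?(gt_eqF t0) ?(gt_eqF t2').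
pose M := A `^ t * B `^ (2 - t) * S `^ (p - 2).
have M0 : 0 <= M by rewrite !mulr_ge0 ?powR_ge0.
have th0 : 0 <= t / 2 by rewrite divr_ge0// ltW.
have th1 : 0 <= 1 - t / 2 by rewrite subr_ge0 ler_pdivrMr// mul1r ltW.
(* [M] is the target bound, and the weights are normalised so that the weighted sum of [A ^+ 2] and
   [B ^+ 2] equals [M]. *)
exists (M * (t / 2) / A ^+ 2), (M * (1 - t / 2) / B ^+ 2); split.
- exact: divr_ge0 (mulr_ge0 M0 th0) (sqr_ge0 _).
- exact: divr_ge0 (mulr_ge0 M0 th1) (sqr_ge0 _).
- move=> a b a0 aA b0 bB bS.
  have -> : M * (t / 2) / A ^+ 2 * a ^+ 2 + M * (1 - t / 2) / B ^+ 2 * b ^+ 2 =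
      M * (t / 2 * (a / A) ^+ 2 + (1 - t / 2) * (b / B) ^+ 2).
    by field; rewrite ?(gt_eqF Ap) ?(gt_eqF Bp).
  have aA0 : 0 <= a / A by rewrite divr_ge0// ltW.
  have bB0 : 0 <= b / B by rewrite divr_ge0// ltW.
  apply: le_trans (ler_wpM2l M0 (young _ _ aA0 bB0)).
  have eA : A `^ t * (a / A) `^ t = a `^ t.
    by rewrite -powRM ?(ltW Ap)//; congr (_ `^ _); field; rewrite gt_eqF.
  have eB : B `^ (2 - t) * (b / B) `^ (2 - t) = b `^ (2 - t).
    by rewrite -powRM ?(ltW Bp)//; congr (_ `^ _); field; rewrite gt_eqF.
  have -> : M * ((a / A) `^ t * (b / B) `^ (2 - t)) =
      a `^ t * (b `^ (2 - t) * S `^ (p - 2)).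
    by rewrite -eA -eB /M; ring.
  rewrite ler_wpM2l ?powR_ge0//.
  have -> : p - t = (2 - t) + (p - 2) by ring.
  have e0 : 0 < 2 - t + (p - 2) by lra.
  rewrite (@powRD _ b (2 - t) (p - 2)); last by rewrite (gt_eqF e0).
  rewrite ler_wpM2l ?powR_ge0//; apply: ge0_ler_powR => //.
  by rewrite subr_ge0 ltW.
- rewrite !mulfVK ?expf_neq0 ?gt_eqF// -mulrDr.
  by rewrite addrC subrK mulr1.
Qed.

End weights.

(** * The estimate on one edge *)

Section edge.
Context {R : realType} {N : nat}.
Local Notation X := ('rV[R]_N * R)%type.
Local Notation mu := (lebesgue_strip N).
Implicit Types (u : X -> R) (j : option 'I_N).

Definition grad (l : R) u j : X -> R :=
  weak_derivative (strip setT l) j u \_ (strip setT l).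

(** The density of the squared H^1 norm, defined on the whole space so that it can be integrated
    over cells. *)
Definition energy (l : R) u (z : X) : R :=
  (u \_ (strip setT l)) z ^+ 2 + \sum_j grad l u j z ^+ 2.

Lemma weak_derivativeP (D : set X) j u : H1 D u ->
  L2_weak_derivatives D j u (weak_derivative D j u).
Proof. by move=> [_ /(_ j) ?]; exact: getPex. Qed.

Let mstrip (l : R) : measurable (strip setT l : set X).
Proof. exact: measurable_strip. Qed.

Lemma sqint_H1 (l : R) u : H1 (strip setT l) u -> sqint mu (u \_ (strip setT l)).
Proof. by move=> [+ _]; exact: L2_sqint. Qed.

Lemma sqint_grad (l : R) u j : H1 (strip setT l) u -> sqint mu (grad l u j).
Proof. by move=> /(weak_derivativeP j)[+ _]; exact: L2_sqint. Qed.

Lemma energy_ge0 (l : R) u z : 0 <= energy l u z.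
Proof. by rewrite addr_ge0 ?sqr_ge0// sumr_ge0// => j _; exact: sqr_ge0. Qed.

Lemma measurable_energy (l : R) u : H1 (strip setT l) u ->
  measurable_fun [set: X] (energy l u).
Proof.
move=> Hu; apply: measurable_funD.
  by apply: measurable_funX; case: (sqint_H1 Hu).
apply: measurable_sum => j; apply: measurable_funX.
by case: (sqint_grad j Hu).
Qed.

Lemma integral_energy (l : R) u : H1 (strip setT l) u ->
  (\int[mu]_z (energy l u z)%:E = H1norm (strip setT l) u `^ 2)%E.
Proof.
move=> Hu; rewrite /H1norm -poweRrM mulVf// poweRe1; last first.
  by rewrite adde_ge0 ?poweR_ge0// sume_ge0// => j _; exact: poweR_ge0.
have m2 (w : X -> R) : sqint mu w -> measurable_fun setT (fun z => (w z ^+ 2)%:E).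
  by move=> [mw _]; apply/measurable_EFinP; exact: measurable_funX.
rewrite LnormD_sqr; under [in RHS]eq_bigr do rewrite LnormD_sqr.
rewrite -ge0_integral_sum//; last 2 first.
- by move=> j; exact: m2 (sqint_grad j Hu).
- by move=> j z _; rewrite lee_fin sqr_ge0.
rewrite -ge0_integralD//.
- by apply: eq_integral => z _; rewrite /energy EFinD -sumEFin.
- by move=> z _; rewrite lee_fin sqr_ge0.
- exact: m2 (sqint_H1 Hu).
- by move=> z _; rewrite sume_ge0// => j _; rewrite lee_fin sqr_ge0.
- by apply: emeasurable_sum => j; exact: m2 (sqint_grad j Hu).
Qed.

Lemma integrable_energy (l : R) u : H1 (strip setT l) u ->
  mu.-integrable setT (EFin \o energy l u).
Proof.
move=> Hu; rewrite (_ : EFin \o _ = (fun z => ((u \_ (strip setT l)) z ^+ 2)%:E +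
    \sum_j (grad l u j z ^+ 2)%:E)%E).
  apply: integrableD => //.
    exact: (sqint_sqr_integrable measurableT (sqint_H1 Hu)).
  apply: integrable_sum => // j _.
  exact: (sqint_sqr_integrable measurableT (sqint_grad j Hu)).
by apply/funext => z /=; rewrite /energy EFinD sumEFin.
Qed.

Lemma half_difference_H1 (l : R) u j (c : (option 'I_N -> R) * (option 'I_N -> R)) :
  H1 (strip setT l) u -> proper c -> 0 <= c.1 None -> c.2 None <= l ->
  `|\int[mu]_(z in cell (lhalf c j)) (u \_ (strip setT l)) z -
    \int[mu]_(z in cell (rhalf c j)) (u \_ (strip setT l)) z|
    <= side c j / 2 * \int[mu]_(z in cell c) `|grad l u j z|.
Proof.
move=> Hu pc c0 cl; have [_ weak] := weak_derivativeP j Hu.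
exact: (half_difference_le (sqint_H1 Hu) (sqint_grad j Hu) weak pc c0 cl).
Qed.

(** Clearing denominators, [theta < p] reads [(N - 1) p < 2 (N + 1)]: this is the upper bound on
    [p], and it is automatic for [N <= 1]. *)
Lemma theta_lt (p : R) : 2 < p ->
  ((1 < N)%N -> p < 2 * N.+1%:R / (N%:R - 1)) -> theta N p < p.
Proof.
move=> p2 hp; rewrite /theta ltr_pdivrMr//.
have eN : N.+1%:R = N%:R + 1 :> R by rewrite natr1.
have [N1|N1] := ltnP 1 N.
  have := hp N1; rewrite ltr_pdivlMr; last by rewrite subr_gt0 ltr1n.
  by rewrite eN => ?; lra.
have N1' : N%:R <= 1 :> R by rewrite -[1]/(1%:R) ler_nat.
have : N%:R * (p - 2) <= p - 2 by rewrite ler_piMl// subr_ge0 ltW.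
by rewrite eN => ?; lra.
Qed.

Lemma theta_gt0 (p : R) : 2 < p -> 0 < theta N p.
Proof. by move=> p2; rewrite /theta divr_gt0// mulr_gt0// subr_gt0. Qed.

Lemma interpolation_constant (k e A B s p : R) : 0 <= k -> 0 <= e -> 0 <= A ->
  (k * ((e * A) `^ s * B `^ (1 - s))) `^ p =
  (k * e `^ s) `^ p * (A `^ (s * p) * B `^ ((1 - s) * p)).
Proof.
move=> k0 e0 A0; rewrite (powRM s e0 A0) !(powRrM _ _ p) -!mulrA mulrA.
rewrite -(powRM p (powR_ge0 A s) (powR_ge0 B (1 - s))).
by rewrite (@powRM _ (k * e `^ s) (A `^ s * B `^ (1 - s)))// mulr_ge0 ?powR_ge0.
Qed.

(** The weights make the local bound linear in the densities, hence summable over the cubes. They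
    are left free because they will be chosen from norms over the whole graph, whereas [K] depends
    only on [N], [p] and [l]: the cells over the cubes are translates of one another. *)
Lemma edge_Lp_bound (l p : R) : 0 < l -> 2 < p -> theta N p < p ->
  exists2 K : R, 0 < K & forall u, H1 (strip setT l) u ->
  forall alpha beta : R, 0 <= alpha -> 0 <= beta ->
  (forall (c : 'rV[int]_N) (a b : R), 0 <= a -> 0 <= b ->
    (a ^+ 2)%:E = (\int[mu]_(z in cell (cube_bounds l c)) (energy l u z)%:E)%E ->
    (b ^+ 2)%:E = (\int[mu]_(z in cell (cube_bounds l c))
                     ((u \_ (strip setT l)) z ^+ 2)%:E)%E ->
    a `^ theta N p * b `^ (p - theta N p) <= alpha * a ^+ 2 + beta * b ^+ 2) ->
  (LnormD mu (strip setT l) p u `^ p <=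
   \int[mu]_z (K * (alpha * energy l u z + beta * (u \_ (strip setT l)) z ^+ 2))%:E)%E.
Proof.
move=> l0 p2 tp; pose s := theta N p / p.
have p0 : 0 < p := lt_trans (ltr0Sn R 1) p2.
have s0 : 0 < s by rewrite divr_gt0// theta_gt0.
have s1 : s < 1 by rewrite ltr_pdivrMr// mul1r.
have sE : s * p = theta N p by rewrite mulfVK// gt_eqF.
have sE' : (1 - s) * p = p - theta N p by rewrite mulrBl mul1r sE.
have [Kd Kd0 HKd] := dyadic_sum_le (@rho_gt0 R N) (@rho_lt1 R N) s0 s1.
pose ell := Num.max 1 l.
have ell1 : 1 <= ell by rewrite le_max lexx.
have ell0 : 0 < ell := lt_le_trans ltr01 ell1.
pose K := (l `^ (- ((p - 2) / (2 * p))) * (1 + Kd) * ell `^ s) `^ p.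
have K0 : 0 < K by rewrite powR_gt0// !mulr_gt0 ?powR_gt0// addr_gt0.
exists K => // u Hu alpha beta al0 be0 young.
set w := u \_ (strip setT l).
have sw : sqint mu w := sqint_H1 Hu.
have pn0 : p != 0 by rewrite gt_eqF.
rewrite LnormD_pow//.
have mw : measurable_fun [set: X] w by case: sw.
have mrhs : measurable_fun [set: X]
    (fun z => K * (alpha * energy l u z + beta * w z ^+ 2)).
  apply: measurable_funM => //; apply: measurable_funD.
    by apply: measurable_funM => //; exact: measurable_energy.
  by apply: measurable_funM => //; exact: measurable_funX.
have rhs0 z : 0 <= K * (alpha * energy l u z + beta * w z ^+ 2).
  by rewrite mulr_ge0 ?(ltW K0)// addr_ge0// mulr_ge0 ?energy_ge0 ?sqr_ge0.
apply: (@integral_cubes_le R N l (fun z => `|w z| `^ p)) => //.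
- by apply: (measurableT_comp (measurable_powR p)); exact: measurableT_comp.
- by move=> z zD; rewrite /w /patch memNset// (_ : point = 0 :> R)// normr0 powR0.
move=> c; set b := cube_bounds l c.
have pb : proper b by exact: proper_cube.
have mb : measurable (cell b) by exact: measurable_cell.
have ie : mu.-integrable (cell b) (EFin \o energy l u).
  by apply: integrableS (integrable_energy Hu).
have iw2 : mu.-integrable (cell b) (fun z => (w z ^+ 2)%:E).
  exact: sqint_sqr_integrable.
pose a2 := \int[mu]_(z in cell b) energy l u z.
pose b2 := \int[mu]_(z in cell b) (w z ^+ 2).
have a20 : 0 <= a2 by apply: Rintegral_ge0 => z _; exact: energy_ge0.
have b20 : 0 <= b2 by apply: Rintegral_ge0 => z _; exact: sqr_ge0.
have b2a2 : b2 <= a2.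
  apply: le_Rintegral => // z _; rewrite lerDl sumr_ge0// => j _; exact: sqr_ge0.
have ga2 j : \int[mu]_(z in cell b) (grad l u j z ^+ 2) <= a2.
  apply: le_Rintegral => //.
    exact: (sqint_sqr_integrable mb (sqint_grad j Hu)).
  move=> z _; rewrite /energy (bigD1 j)//= addrCA lerDl addr_ge0 ?sqr_ge0//.
  by rewrite sumr_ge0// => i _; exact: sqr_ge0.
pose A := Num.sqrt a2; pose B := Num.sqrt b2.
have A2 : A ^+ 2 = a2 by rewrite sqr_sqrtr.
have B2 : B ^+ 2 = b2 by rewrite sqr_sqrtr.
have A0 : 0 <= A := sqrtr_ge0 _.
have B0 : 0 <= B := sqrtr_ge0 _.
have bound := @cell_Lp_bound R N w (grad l u) b ell A B p Kd sw
  (fun j => sqint_grad j Hu) pb.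
have side_b i : side b i <= ell.
  by rewrite side_cube /ell le_max; case: i => [i|]; rewrite lexx ?orbT.
have half j c' : proper c' -> b.1 None <= c'.1 None -> c'.2 None <= b.2 None ->
    `|\int[mu]_(z in cell (lhalf c' j)) w z - \int[mu]_(z in cell (rhalf c' j)) w z|
    <= side c' j / 2 * \int[mu]_(z in cell c') `|grad l u j z|.
  by move=> pc' h1 h2; exact: half_difference_H1.
have BA : B <= A by exact: ler_wsqrtr.
have gA j : \int[mu]_(z in cell b) (grad l u j z ^+ 2) <= A ^+ 2 by rewrite A2.
have wB : \int[mu]_(z in cell b) (w z ^+ 2) <= B ^+ 2 by rewrite B2.
have {bound half gA wB} bound' := bound half side_b ell1 B0 BA gA wB p2 Kd0 HKd.
apply: le_trans bound' _.
rewrite vol_cube.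
have -> : (l `^ (- ((p - 2) / (2 * p))) * (1 + Kd) *
    ((ell * A) `^ s * B `^ (1 - s))) `^ p = K * (A `^ theta N p * B `^ (p - theta N p)).
  rewrite interpolation_constant ?mulr_ge0 ?powR_ge0 ?addr_ge0 ?(ltW Kd0) ?(ltW ell0)//.
  by rewrite /K sE sE'.
apply: (@le_trans _ _ (K * (alpha * a2 + beta * b2))%:E).
  rewrite lee_fin ler_wpM2l ?(ltW K0)// -A2 -B2.
  apply: (young c) => //.
    rewrite A2 /a2 /Rintegral fineK//; exact: integrable_fin_num.
  rewrite B2 /b2 /Rintegral fineK//; exact: integrable_fin_num.
have i1 : mu.-integrable (cell b) (EFin \o (fun z => alpha * energy l u z)).
  exact: (integrableZl mb alpha ie).
have i2 : mu.-integrable (cell b) (EFin \o (fun z => beta * w z ^+ 2)).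
  exact: (integrableZl mb beta iw2).
have i3 : mu.-integrable (cell b)
    (EFin \o (fun z => alpha * energy l u z + beta * w z ^+ 2)).
  exact: (integrableD mb i1 i2).
have iK : mu.-integrable (cell b)
    (EFin \o (fun z => K * (alpha * energy l u z + beta * w z ^+ 2))).
  exact: (integrableZl mb K i3).
have <- : \int[mu]_(z in cell b) (K * (alpha * energy l u z + beta * w z ^+ 2)) =
    K * (alpha * a2 + beta * b2).
  rewrite (RintegralZl K mb i3); congr (_ * _).
  by rewrite (RintegralD mb i1 i2) (RintegralZl alpha mb ie) (RintegralZl beta mb iw2).
by rewrite /Rintegral fineK//; exact: integrable_fin_num iK.
Qed.

End edge.

(** * Summation over the edges *)

Section graph.
Context {R : realType} (G : metric_graph R) (N : nat).
Local Notation X := ('rV[R]_N * R)%type.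
Local Notation mu := (lebesgue_strip N).
Implicit Types u : edge G -> X -> R.

Lemma Lnorm_graph_pow (A : set 'rV[R]_N) (q : R) u : q != 0 ->
  (Lnorm_graph A q u `^ q =
   \sum_(e : edge G) LnormD mu (strip A (len G e)) q (u e) `^ q)%E.
Proof.
move=> q0; rewrite /Lnorm_graph -poweRrM mulVf// poweRe1//.
by apply: sume_ge0 => e _; exact: poweR_ge0.
Qed.

Lemma H1norm_graph_pow u :
  (H1norm_graph u `^ 2 =
   \sum_(e : edge G) H1norm (strip setT (len G e)) (u e) `^ 2)%E.
Proof.
rewrite /H1norm_graph -poweRrM mulVf// poweRe1//.
by apply: sume_ge0 => e _; exact: poweR_ge0.
Qed.

Lemma poweR_sqr_fin (x : \bar R) (y : R) : (0 <= x)%E -> (x `^ 2 = y%:E)%E ->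
  exists2 r : R, 0 <= r & x = r%:E /\ r ^+ 2 = y.
Proof.
case: x => [r| |] //=; rewrite ?lee_fin => x0.
  by rewrite -poweR_EFin poweR_EFin => -[] <-; exists r => //; rewrite powR_mulrn.
by rewrite pnatr_eq0.
Qed.

Variable u : edge G -> X -> R.
Hypothesis Hu : forall e, H1 (strip setT (len G e)) (u e).
Let w e : X -> R := u e \_ (strip setT (len G e)).
Let en e : R := \int[mu]_z energy (len G e) (u e) z.
Let we e : R := \int[mu]_z (w e z ^+ 2).

Lemma integral_energyE e :
  (\int[mu]_z (energy (len G e) (u e) z)%:E = (en e)%:E)%E.
Proof.
rewrite /en /Rintegral fineK//.
exact: (integrable_fin_num measurableT (integrable_energy (Hu e))).
Qed.

Lemma integral_sqrE e : (\int[mu]_z (w e z ^+ 2)%:E = (we e)%:E)%E.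
Proof.
rewrite /we /Rintegral fineK//; apply: integrable_fin_num => //.
exact: (sqint_sqr_integrable measurableT (sqint_H1 (Hu e))).
Qed.

Lemma H1norm_graph_fin : exists2 A : R, 0 <= A &
  H1norm_graph u = A%:E /\ A ^+ 2 = \sum_e en e.
Proof.
apply: poweR_sqr_fin; first exact: poweR_ge0.
rewrite H1norm_graph_pow -sumEFin; apply: eq_bigr => e _.
by rewrite -integral_energy// integral_energyE.
Qed.

Lemma L2norm_graph_fin : exists2 B : R, 0 <= B &
  Lnorm_graph setT 2 u = B%:E /\ B ^+ 2 = \sum_e we e.
Proof.
apply: poweR_sqr_fin; first exact: poweR_ge0.
rewrite Lnorm_graph_pow// -sumEFin; apply: eq_bigr => e _.
by rewrite LnormD_sqr integral_sqrE.
Qed.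

Lemma cube_le_graph c : (Lnorm_graph (cube c) 2 u <= Lnorm_graph setT 2 u)%E.
Proof.
apply: gt0_ler_poweR.
- by rewrite invr_ge0.
- by rewrite in_itv /= leey andbT sume_ge0// => e _; exact: poweR_ge0.
- by rewrite in_itv /= leey andbT sume_ge0// => e _; exact: poweR_ge0.
apply: lee_sum => e _; rewrite -(@integral_cube_strip R N (len G e) c (u e)).
  rewrite LnormD_sqr; apply: ge0_subset_integral => //.
  - exact: measurable_cell.
  - by apply/measurable_EFinP/measurable_funX; case: (sqint_H1 (Hu e)).
  - by move=> z _; rewrite lee_fin sqr_ge0.
by case: (Hu e) => -[].
Qed.

Lemma sup_cubes_fin : exists2 S : R, 0 <= S & sup_cubes u = S%:E.
Proof.
have [B B0 [BE _]] := L2norm_graph_fin.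
have S0 : (0 <= sup_cubes u)%E.
  apply: le_trans (ereal_sup_ubound _); last by exists (0 : 'rV[int]_N).
  exact: poweR_ge0.
have SB : (sup_cubes u <= B%:E)%E.
  by apply: ge_ereal_sup => _ [c _ <-]; rewrite -BE; exact: cube_le_graph.
have Sfin : sup_cubes u \is a fin_num.
  by rewrite ge0_fin_numE// (le_lt_trans SB)// ltry.
by exists (fine (sup_cubes u)); [exact: fine_ge0|rewrite fineK].
Qed.

Lemma cell_sup_cubes e c (b S : R) : 0 <= b -> 0 <= S -> sup_cubes u = S%:E ->
  (b ^+ 2)%:E = (\int[mu]_(z in cell (cube_bounds (len G e) c)) (w e z ^+ 2)%:E)%E ->
  b <= S.
Proof.
move=> b0 S0 SE bE.
have h : (Lnorm_graph (cube c) 2 u <= S%:E)%E.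
  by rewrite -SE; apply: ereal_sup_ubound; exists c.
have L0 : (0 <= Lnorm_graph (cube c) 2 u)%E by exact: poweR_ge0.
rewrite -(@ler_pXn2r _ 2)// -lee_fin bE integral_cube_strip; last by case: (Hu e) => -[].
apply: (@le_trans _ _ (Lnorm_graph (cube c) 2 u `^ 2)%E).
  rewrite Lnorm_graph_pow// (bigD1 e)//= leeDl// sume_ge0// => e' _.
  exact: poweR_ge0.
rewrite -powR_mulrn// -poweR_EFin; apply: gt0_ler_poweR => //.
- by rewrite in_itv /= leey andbT.
- by rewrite in_itv /= leey andbT lee_fin.
Qed.

(** A single pair of weights, chosen from the global quantities [A], [B], [S], serves all edges,
    because the norms over any one cell are bounded by these. The bounds on the edges, linear in the
    squared norms, then simply add up. *)
Lemma graph_Lp_bound (p C : R) (K : edge G -> R) : 2 < p -> theta N p < p ->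
  0 <= C ->
  (forall e, 0 < K e) -> (forall e, K e <= C) ->
  (forall e (alpha beta : R), 0 <= alpha -> 0 <= beta ->
    (forall (c : 'rV[int]_N) (a b : R), 0 <= a -> 0 <= b ->
      (a ^+ 2)%:E = (\int[mu]_(z in cell (cube_bounds (len G e) c))
                       (energy (len G e) (u e) z)%:E)%E ->
      (b ^+ 2)%:E = (\int[mu]_(z in cell (cube_bounds (len G e) c)) (w e z ^+ 2)%:E)%E ->
      a `^ theta N p * b `^ (p - theta N p) <= alpha * a ^+ 2 + beta * b ^+ 2) ->
    (LnormD mu (strip setT (len G e)) p (u e) `^ p <=
     \int[mu]_z (K e * (alpha * energy (len G e) (u e) z + beta * w e z ^+ 2))%:E)%E) ->
  (Lnorm_graph setT p u `^ p <= C%:E * H1norm_graph u `^ theta N p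
     * Lnorm_graph setT 2 u `^ (2 * delta N p)
     * sup_cubes u `^ (p - theta N p - 2 * delta N p))%E.
Proof.
move=> p2 tp C0 K0 KC edgeK.
have [A A0 [AE A2]] := H1norm_graph_fin.
have [B B0 [BE B2]] := L2norm_graph_fin.
have [S S0 SE] := sup_cubes_fin.
have en0 e : 0 <= en e by apply: Rintegral_ge0 => z _; exact: energy_ge0.
have we0 e : 0 <= we e by apply: Rintegral_ge0 => z _; exact: sqr_ge0.
have ien e := integrable_energy (Hu e).
have iwe e := sqint_sqr_integrable measurableT (sqint_H1 (Hu e)).
have we_en e : we e <= en e.
  apply: (le_Rintegral measurableT (iwe e) (ien e)) => z _.
  by rewrite lerDl sumr_ge0// => j _; exact: sqr_ge0.
have BA : B <= A.
  by rewrite -(@ler_pXn2r _ 2)// A2 B2; apply: ler_sum => e _; exact: we_en.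
have [|alpha [beta [al0 be0 weights weights_sum]]] :=
    @young_weights R A B S p (theta N p) _ p2 B0 BA S0.
  by rewrite theta_gt0.
rewrite Lnorm_graph_pow; last by rewrite gt_eqF// (lt_trans _ p2).
apply: (@le_trans _ _ (\sum_(e : edge G) (C * (alpha * en e + beta * we e))%:E)%E).
  apply: lee_sum => e _; apply: le_trans (edgeK e alpha beta al0 be0 _) _.
    move=> c a b a0 b0 aE bE; apply: weights => //.
    - rewrite -(@ler_pXn2r _ 2)// -lee_fin aE A2 (bigD1 e)//=.
      apply: (@le_trans _ _ (en e)%:E); last by rewrite lee_fin lerDl sumr_ge0.
      rewrite -integral_energyE; apply: ge0_subset_integral => //.
      + exact: measurable_cell.
      + by apply/measurable_EFinP; exact: measurable_energy.
      + by move=> z _; rewrite lee_fin energy_ge0.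
    - rewrite -(@ler_pXn2r _ 2)// -lee_fin bE B2 (bigD1 e)//=.
      apply: (@le_trans _ _ (we e)%:E); last by rewrite lee_fin lerDl sumr_ge0.
      rewrite -integral_sqrE; apply: ge0_subset_integral => //.
      + exact: measurable_cell.
      + by apply/measurable_EFinP/measurable_funX; case: (sqint_H1 (Hu e)).
      + by move=> z _; rewrite lee_fin sqr_ge0.
    - exact: (@cell_sup_cubes e c).
  have mT : measurable [set: X] := measurableT.
  have i1 : mu.-integrable setT (EFin \o (fun z => alpha * energy (len G e) (u e) z)).
    exact: (integrableZl mT alpha (ien e)).
  have i2 : mu.-integrable setT (EFin \o (fun z => beta * w e z ^+ 2)).
    exact: (integrableZl mT beta (iwe e)).
  have i3 : mu.-integrable setT
      (EFin \o (fun z => alpha * energy (len G e) (u e) z + beta * w e z ^+ 2)).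
    exact: (integrableD mT i1 i2).
  have iK : mu.-integrable setT
      (EFin \o (fun z => K e * (alpha * energy (len G e) (u e) z + beta * w e z ^+ 2))).
    exact: (integrableZl mT (K e) i3).
  have -> : (\int[mu]_z (K e * (alpha * energy (len G e) (u e) z + beta * w e z ^+ 2))%:E
      = (K e * (alpha * en e + beta * we e))%:E)%E.
    rewrite /en /we -(RintegralZl alpha mT (ien e)) -(RintegralZl beta mT (iwe e)).
    rewrite -(RintegralD mT i1 i2) -(RintegralZl (K e) mT i3) /Rintegral fineK//.
    exact: integrable_fin_num iK.
  by rewrite lee_fin ler_wpM2r// addr_ge0// mulr_ge0.
rewrite sumEFin -mulr_sumr big_split /= -!mulr_sumr -A2 -B2.
rewrite AE BE SE !poweR_EFin -!EFinM lee_fin -!mulrA.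
by rewrite ler_wpM2l// mulrA; exact: weights_sum.
Qed.

End graph.

Theorem proposition4p4 (R : realType) (G : metric_graph R) (N : nat) (p : R)
    (hN : (1 <= N)%N) (hp2 : 2 < p)
    (hp : (1 < N)%N -> p < 2 * N.+1%:R / (N%:R - 1)) :
  exists C : R, 0 < C /\
    forall u : edge G -> 'rV[R]_N * R -> R, H1_graph u ->
    [/\ (Lnorm_graph setT p u `^ p <=
           C%:E * H1norm_graph u `^ theta N p
             * Lnorm_graph setT 2 u `^ (2 * delta N p)
             * sup_cubes u `^ (p - theta N p - 2 * delta N p))%E,
        2 + 4 / N.+1%:R <= p ->
        (Lnorm_graph setT p u `^ p <=
           C%:E * H1norm_graph u `^ theta N p
             * sup_cubes u `^ (p - theta N p))%E &
        p < 2 + 4 / N.+1%:R ->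
        (Lnorm_graph setT p u `^ p <=
           C%:E * H1norm_graph u `^ theta N p
             * Lnorm_graph setT 2 u `^ (2 - theta N p)
             * sup_cubes u `^ (p - 2))%E].
Proof.
have tp := theta_lt hp2 hp.
pose Kx e := cid2 (@edge_Lp_bound R N (len G e) p (len_gt0 e) hp2 tp).
pose K e := projT1 (Kx e).
have K0 e : 0 < K e by rewrite /K; case: (Kx e).
(* The sum dominates each [K e]; the 1 keeps the constant positive for a graph without edges. *)
have C0 : 0 < \sum_e K e + 1.
  by rewrite ltr_wpDl// sumr_ge0// => e _; exact: ltW.
exists (\sum_e K e + 1); split=> //.
move=> u [Hu _].
have main := @graph_Lp_bound R G N u Hu p (\sum_e K e + 1) K hp2 tp (ltW C0) K0.
have {}main : (Lnorm_graph setT p u `^ p <=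
           (\sum_e K e + 1)%:E * H1norm_graph u `^ theta N p
             * Lnorm_graph setT 2 u `^ (2 * delta N p)
             * sup_cubes u `^ (p - theta N p - 2 * delta N p))%E.
  apply: main => e.
    rewrite (bigD1 e)//= -addrA lerDl addr_ge0// sumr_ge0// => e' _; exact: ltW.
  by rewrite /K; case: (Kx e) => k /= _ h alpha beta; exact: h.
have N0 : 0 < N.+1%:R :> R by [].
split => //.
(* The threshold [2 + 4 / (N + 1)] is the value of [p] at which [theta = 2], where the two
   expressions in the maximum defining [delta] meet. *)
- move=> hle; have d0 : delta N p = 0.
    apply: max_l; move: hle; rewrite -lerBrDl ler_pdivrMr// /theta => hle.
    by rewrite subr_le0; lra.
  by move: main; rewrite d0 mulr0 subr0 poweRe0 mule1.
- move=> hlt; have d1 : 2 * delta N p = 2 - theta N p.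
    rewrite /delta max_r; first by field.
    move: hlt; rewrite -ltrBlDl ltr_pdivlMr// /theta => hlt.
    by rewrite subr_ge0; lra.
  move: main; rewrite d1; congr (_ <= _ * _)%E; congr (_ `^ _)%E; ring.
Qed.
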